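(* Let $b,f,\sigma,g$ satisfy assumptions (A1), (A2), (A3) of the context, let $\beta=1/T$, let $0<\varepsilon<\varepsilon'<1$, and assume that $T$ and $K$ are small enough that $$(33+144K)\,K\,e\,\max(1,T^2)<1 .$$ Let $(t,x)\in[0,T]\times\mathbb R$. Then there exists a constant $C>0$, independent of $\varepsilon$, $\varepsilon'$ and $T$, such that $$\mathbb{E}\Big[\sup_{t\le s\le T}e^{\beta s}|X^{t,x,\varepsilon'}(s)-X^{t,x,\varepsilon}(s)|^2+\sup_{t\le s\le T}e^{\beta s}|Y^{t,x,\varepsilon'}(s)-Y^{t,x,\varepsilon}(s)|^2+\int_0^Te^{\beta s}|Z^{t,x,\varepsilon'}(s)-Z^{t,x,\varepsilon}(s)|^2ds\Big]\le C\big(\sqrt{\varepsilon'}-\sqrt{\varepsilon}\big)^2 .$$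
   Context: Fix $T>0$ and a filtered probability space $(\Omega,\mathcal F,\mathbb P,(\mathcal F_t)_{0\le t\le T})$ satisfying the usual conditions, with filtration generated by a one-dimensional Brownian motion $W$ (and completed); $\lambda$ is Lebesgue measure. $L^\infty_{-T}(\mathbb R)$ is the space of bounded measurable functions $[-T,0]\to\mathbb R$; $L^2_{-T}(\mathbb R)$ is the space of measurable square-integrable functions $[-T,0]\to\mathbb R$. $\mathcal S^2(\mathbb R)$ (resp. $\mathcal H^2(\mathbb R)$) is the space of real predictable processes $\eta$ with $\mathbb E[\sup_{0\le s\le T}e^{\beta s}|\eta(s)|^2]<\infty$ (resp. $\mathbb E[\int_0^Te^{\beta s}|\eta(s)|^2ds]<\infty$). For a path $H$, the segment $H_s$ is $H_s(\theta)=H(s+\theta)$, $\theta\in[-T,0]$. Assumptions, with a probability measure $\alpha$ on $[-T,0]$ and a constant $K>0$: (A1) For $\phi\in\{b,f\}$, $\phi:\Omega\times[-T,T]\times L^\infty_{-T}(\mathbb R)\times L^\infty_{-T}(\mathbb R)\times L^2_{-T}(\mathbb R)\to\mathbb R$ is product measurable and adapted; for $\mathbb P\otimes\lambda$-a.e. $(\omega,t)\in\Omega\times[0,T]$ and all $u=(\varphi,\psi,\eta)$, $u'=(\varphi',\psi',\eta')$, $|\phi(t,u)-\phi(t,u')|^2\le K\int_{-T}^0(|\varphi-\varphi'|^2+|\psi-\psi'|^2+|\eta-\eta'|^2)(r)\,\alpha(dr)$; $\phi(t,u)=0$ for $t<0$; and $\mathbb E\int_0^T|\phi(t,0)|^2dt<\infty$,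 where $0$ is the null trajectory $(0,0,0)$. (A2) $\sigma:\Omega\times[-T,T]\times L^\infty_{-T}(\mathbb R)\times L^\infty_{-T}(\mathbb R)\to\mathbb R$ is product measurable and adapted; for a.e. $(\omega,t)$ and all $(\varphi,\psi),(\varphi',\psi')$, $|\sigma(t,\varphi,\psi)-\sigma(t,\varphi',\psi')|^2\le K\int_{-T}^0(|\varphi-\varphi'|^2+|\psi-\psi'|^2)(r)\,\alpha(dr)$; $\sigma(t,\cdot)=0$ for $t<0$; and $\mathbb E\int_0^T|\sigma(t,0)|^2dt<\infty$. (A3) $g:\Omega\times L^2_{-T}(\mathbb R)\to\mathbb R$ is product measurable ($\mathcal F_T$-measurable in $\omega$) and $|g(\varphi)-g(\varphi')|^2\le K\int_{-T}^0|\varphi(r)-\varphi'(r)|^2\alpha(dr)$. For $(t,x)\in[0,T]\times\mathbb R$ and $\varepsilon\in(0,1]$, $(X^{t,x,\varepsilon},Y^{t,x,\varepsilon},Z^{t,x,\varepsilon})\in\mathcal S^2(\mathbb R)\times\mathcal S^2(\mathbb R)\times\mathcal H^2(\mathbb R)$ denotes the unique adapted solution of the delayed FBSDE: $\mathbb P$-a.s. for $s\in[0,T]$ (superscripts $t,x,\varepsilon$ omitted), $$X(s)=x+\int_t^{s\vee t}b(r,X_r,Y_r,Z_r)dr+\sqrt\varepsilon\int_t^{s\vee t}\sigma(r,X_r,Y_r)dW(r),$$ $$Y(s)=g(X_T)+\int_{s\vee t}^Tf(r,X_r,Y_r,Z_r)dr-\int_{s\vee t}^TZ(r)dW(r),$$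 with the convention $(X(s),Y(s),Z(s))=(x,Y(t),0)$ for $s<t$, including all $s<0$. *)

(* Defs.v *)
From HB Require Import structures.
From mathcomp Require Export all_boot all_order all_algebra.
From mathcomp Require Export all_classical all_reals all_analysis.

Set Implicit Arguments.
Unset Strict Implicit.
Unset Printing Implicit Defensive.

Export Order.TTheory GRing.Theory Num.Theory.
Export numFieldNormedType.Exports.

Local Open Scope classical_set_scope.
Local Open Scope ring_scope.

(* A set of points with a sigma-algebra of subsets of it.  The spaces of paths
   on [-T, 0] and the members of a filtration are subsets or coarser
   sigma-algebras of ambient types, so that measurableType does not fit. *)
Record sspace (X : Type) := SSpace {
  points : set X ;
  events : set (set X) }.

Definition sprod (X Y : Type) (S : sspace X) (S' : sspace Y) : sspace (X * Y) :=
  SSpace (points S `*` points S')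
    <<s points S `*` points S',
        [set A `*` B | A in events S & B in events S'] >>.

Definition smeasurable (R : realType) (X : Type) (S : sspace X) (f : X -> R) :=
  forall B : set R, measurable B -> events S (points S `&` f @^-1` B).

Section PathSpaces.
Context {R : realType}.
Implicit Types (T : R) (h : R -> R).

Definition segment h (s : R) : R -> R := fun theta => h (s + theta).

(* Paths on [-T, 0] are represented by functions on R whose values outside
   [-T, 0] play no role. *)
Definition Linfty T : set (R -> R) :=
  [set h : R -> R | measurable_fun `[- T, 0] h /\
           exists M : R, forall r, r \in `[- T, 0] -> `|h r| <= M].

Definition L2 T : set (R -> R) :=
  [set h : R -> R | measurable_fun `[- T, 0] h /\
           (\int[lebesgue_measure]_(r in `[(- T)%R, 0%R]) (h r ^+ 2)%:E < +oo)%E].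

(* L endowed with the Borel sigma-algebra of the (extended) pseudo-distance
   rho; rho may also be the square of a pseudo-distance. *)
Definition borel_paths (L : set (R -> R)) (rho : (R -> R) -> (R -> R) -> \bar R)
    : sspace (R -> R) :=
  SSpace L
    <<s L, [set U | U `<=` L /\ forall h, U h -> exists r : R, 0 < r /\
                      forall h', L h' -> (rho h h' < r%:E)%E -> U h'] >>.

Definition Linfty_space T : sspace (R -> R) :=
  borel_paths (Linfty T)
    (fun h h' => ereal_sup [set `|h r - h' r|%:E | r in `[- T, 0] ]).

(* The elements of L2 are functions and not classes, and alpha may charge
   points (as in the case without delay, alpha = \d_0).  The mean-square
   distances for Lebesgue measure and for alpha are therefore used together:
   with the former alone, a map measurable in the third path could not depend on
   the value of that path at an atom of alpha. *)
Definition L2_space T (alpha : probability (measurableTypeR R) R)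
    : sspace (R -> R) :=
  borel_paths (L2 T)
    (fun h h' =>
      \int[lebesgue_measure]_(r in `[(- T)%R, 0%R]) ((h r - h' r) ^+ 2)%:E +
      \int[alpha]_(r in `[(- T)%R, 0%R]) ((h r - h' r) ^+ 2)%:E)%E.

Definition time_space T : sspace R :=
  SSpace `[- T, T] [set I : set R | measurable I /\ I `<=` `[- T, T] ].

End PathSpaces.

Section Brownian.
Context {R : realType} {d : measure_display} {Om : measurableType d}.
Variables (P : probability Om R) (W : Om -> R -> R).
Implicit Types (t T : R).

Definition natural_filtration (t : R) : set (set Om) :=
  <<s [set A | exists s (B : set R),
         [/\ 0 <= s <= t, measurable B & A = [set w | B (W w s)] ] ] >>.

Definition brownian_filtration (t : R) : set (set Om) :=
  <<s natural_filtration t `|` P.-negligible >>.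

Definition usual_conditions T :=
  measure_is_complete P /\
  forall t, 0 <= t < T ->
    \bigcap_(u in `]t, T]) brownian_filtration u `<=` brownian_filtration t.

Definition is_brownian T :=
  [/\ forall s, 0 <= s <= T -> measurable_fun setT (W ^~ s),
      {ae P, forall w, W w 0 = 0},
      {ae P, forall w, {within `[0, T], continuous (W w)}} &
      forall s u, 0 <= s -> s < u -> u <= T ->
      forall (A : set Om) (B : set R), natural_filtration s A -> measurable B ->
        P (A `&` [set w | B (W w u - W w s)]) =
        (P A * normal_prob 0 (Num.sqrt (u - s)) B)%E].

Definition filtration_space (t : R) : sspace Om :=
  SSpace setT (brownian_filtration t).

(* Processes restricted to the time interval [t, T]. *)
Definition predictable_space t T : sspace (Om * R) :=
  SSpace (setT `*` `[t, T])
    <<s setT `*` `[t, T],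
        [set A `*` [set t] | A in brownian_filtration t] `|`
        [set D | exists s u A, [/\ t <= s, u <= T, brownian_filtration s A &
                                D = A `*` `]s, u] ] ] >>.

Definition predictable t T (eta : Om -> R -> R) :=
  smeasurable (predictable_space t T) (fun p => eta p.1 p.2).

(* The simple process equal to xi i on ]tau i, tau i.+1] for i < n. *)
Record simple_process := SimpleProcess {
  sp_size : nat ;
  sp_time : nat -> R ;
  sp_coef : nat -> Om -> R }.

Definition is_simple t T (S : simple_process) :=
  [/\ t <= sp_time S 0%N,
      sp_time S (sp_size S) <= T,
      forall i, (i < sp_size S)%N -> sp_time S i <= sp_time S i.+1 &
      forall i, (i < sp_size S)%N ->
        smeasurable (filtration_space (sp_time S i)) (sp_coef S i) /\
        exists M : R, forall w, `|sp_coef S i w| <= M].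

Definition sp_value (S : simple_process) (w : Om) (r : R) : R :=
  \sum_(i < sp_size S)
    sp_coef S i w * (sp_time S i < r <= sp_time S i.+1)%R%:R.

Definition sp_integral (S : simple_process) (w : Om) (s : R) : R :=
  \sum_(i < sp_size S) sp_coef S i w *
    (W w (Num.min s (sp_time S i.+1)) - W w (Num.min s (sp_time S i))).

(* J is a continuous version of s |-> int_t^s H(r) dW(r) on [t, T], for H in
   the class of a square-integrable predictable process. *)
Definition is_ito_integral t T (H J : Om -> R -> R) :=
  [/\ forall s, t <= s <= T -> smeasurable (filtration_space s) (J ^~ s),
      {ae P, forall w, {within `[t, T], continuous (J w)}} &
      exists H', [/\ predictable t T H',
        {ae (P \x lebesgue_measure)%E, forall p : Om * R,
          t <= p.2 <= T -> H p.1 p.2 = H' p.1 p.2} &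
        exists S : nat -> simple_process,
          [/\ forall n, is_simple t T (S n),
              (fun n => \int[P]_w \int[lebesgue_measure]_(r in `[t, T])
                 ((sp_value (S n) w r - H' w r) ^+ 2)%:E)%E @ \oo --> 0%E &
              forall s, t <= s <= T ->
              (fun n => \int[P]_w
                 ((sp_integral (S n) w s - J w s) ^+ 2)%:E)%E @ \oo --> 0%E]]].

(* The spaces S^2 and H^2.  Predictability is asked on [t, T] only: the
   convention Y(s) = Y(t) for s < t makes Y(s) F_t-measurable, not
   F_s-measurable. *)
Definition S2 t T (beta : R) (eta : Om -> R -> R) :=
  predictable t T eta /\
  (\int[P]_w ereal_sup [set (expR (beta * s) * `|eta w s| ^+ 2)%:E
                       | s in `[0%R, T] ] < +oo)%E.

Definition H2 t T (beta : R) (eta : Om -> R -> R) :=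
  predictable t T eta /\
  (\int[P]_w \int[lebesgue_measure]_(s in `[0%R, T])
     (expR (beta * s) * `|eta w s| ^+ 2)%:E < +oo)%E.

End Brownian.

Section DelayedFBSDE.
Context {R : realType} {d : measure_display} {Om : measurableType d}.
Variables (P : probability Om R) (W : Om -> R -> R).
Variables (T : R) (alpha : probability (measurableTypeR R) R) (K : R).

Definition coef3 := Om -> R -> (R -> R) -> (R -> R) -> (R -> R) -> R.
Definition coef2 := Om -> R -> (R -> R) -> (R -> R) -> R.
Definition coef1 := Om -> (R -> R) -> R.

Definition null_path : R -> R := fun=> 0.

Definition sqnorm3 (phi : coef3) : \bar R :=
  (\int[P]_w \int[lebesgue_measure]_(r in `[0%R, T])
     (`|phi w r null_path null_path null_path| ^+ 2)%:E)%E.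

Definition sqnorm2 (sigma : coef2) : \bar R :=
  (\int[P]_w \int[lebesgue_measure]_(r in `[0%R, T])
     (`|sigma w r null_path null_path| ^+ 2)%:E)%E.

Definition sqnorm1 (g : coef1) : \bar R :=
  (\int[P]_w (`|g w null_path| ^+ 2)%:E)%E.

Let ambient : sspace Om := SSpace setT measurable.
Let Li := Linfty_space T.
Let L2s := L2_space T alpha.

Definition assumption_A1 (phi : coef3) :=
  [/\ smeasurable (sprod (sprod (sprod (sprod ambient (time_space T)) Li) Li) L2s)
        (fun p => phi p.1.1.1.1 p.1.1.1.2 p.1.1.2 p.1.2 p.2) /\
      (forall t, 0 <= t <= T ->
        smeasurable (sprod (sprod (sprod (filtration_space P W t) Li) Li) L2s)
          (fun p => phi p.1.1.1 t p.1.1.2 p.1.2 p.2)),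
      {ae (P \x lebesgue_measure)%E, forall p : Om * R, 0 <= p.2 <= T ->
        forall h k z h' k' z',
        Linfty T h -> Linfty T k -> L2 T z ->
        Linfty T h' -> Linfty T k' -> L2 T z' ->
        ((`|phi p.1 p.2 h k z - phi p.1 p.2 h' k' z'| ^+ 2)%:E <=
         K%:E * \int[alpha]_(r in `[(- T)%R, 0%R])
           (`|h r - h' r| ^+ 2 + `|k r - k' r| ^+ 2 + `|z r - z' r| ^+ 2)%:E)%E},
      forall w t h k z, - T <= t < 0 ->
        Linfty T h -> Linfty T k -> L2 T z -> phi w t h k z = 0 &
      (sqnorm3 phi < +oo)%E].

Definition assumption_A2 (sigma : coef2) :=
  [/\ smeasurable (sprod (sprod (sprod ambient (time_space T)) Li) Li)
        (fun p => sigma p.1.1.1 p.1.1.2 p.1.2 p.2) /\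
      (forall t, 0 <= t <= T ->
        smeasurable (sprod (sprod (filtration_space P W t) Li) Li)
          (fun p => sigma p.1.1 t p.1.2 p.2)),
      {ae (P \x lebesgue_measure)%E, forall p : Om * R, 0 <= p.2 <= T ->
        forall h k h' k',
        Linfty T h -> Linfty T k -> Linfty T h' -> Linfty T k' ->
        ((`|sigma p.1 p.2 h k - sigma p.1 p.2 h' k'| ^+ 2)%:E <=
         K%:E * \int[alpha]_(r in `[(- T)%R, 0%R])
           (`|h r - h' r| ^+ 2 + `|k r - k' r| ^+ 2)%:E)%E},
      forall w t h k, - T <= t < 0 ->
        Linfty T h -> Linfty T k -> sigma w t h k = 0 &
      (sqnorm2 sigma < +oo)%E].

Definition assumption_A3 (g : coef1) :=
  smeasurable (sprod (filtration_space P W T) L2s) (fun p => g p.1 p.2) /\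
  forall w h h', L2 T h -> L2 T h' ->
    ((`|g w h - g w h'| ^+ 2)%:E <=
     K%:E * \int[alpha]_(r in `[(- T)%R, 0%R]) (`|h r - h' r| ^+ 2)%:E)%E.

Definition along3 (phi : coef3) (X Y Z : Om -> R -> R) (w : Om) (r : R) : R :=
  phi w r (segment (X w) r) (segment (Y w) r) (segment (Z w) r).

Definition along2 (sigma : coef2) (X Y : Om -> R -> R) (w : Om) (r : R) : R :=
  sigma w r (segment (X w) r) (segment (Y w) r).

(* (X, Y, Z) solves the delayed FBSDE started from x at time t.  The values of
   the processes matter on [-T, T] only. *)
Definition fbsde_solution (b f : coef3) (sigma : coef2) (g : coef1)
    (beta t x eps : R) (X Y Z : Om -> R -> R) :=
  [/\ [/\ S2 P W t T beta X, S2 P W t T beta Y & H2 P W t T beta Z],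
      forall w s, - T <= s < t -> [/\ X w s = x, Y w s = Y w t & Z w s = 0],
      {ae P, forall w,
        lebesgue_measure.-integrable `[t, T] (EFin \o along3 b X Y Z w) /\
        lebesgue_measure.-integrable `[t, T] (EFin \o along3 f X Y Z w)} &
      exists J M : Om -> R -> R,
      [/\ is_ito_integral P W t T (along2 sigma X Y) J,
          is_ito_integral P W t T Z M &
          {ae P, forall w, forall s, 0 <= s <= T ->
            X w s = x
              + Rintegral lebesgue_measure `[t, Num.max s t] (along3 b X Y Z w)
              + Num.sqrt eps * J w (Num.max s t) /\
            Y w s = g w (segment (X w) T)
              + Rintegral lebesgue_measure `[Num.max s t, T] (along3 f X Y Z w)
              - (M w T - M w (Num.max s t))}]].

End DelayedFBSDE.

(* Main.v *)
(* Write m = max(1, T^2) and let U, V, Z solve the delayed system on [t, T],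
   constant or null before t.  By Ito's isometry and Doob's inequality,
     E sup U^2 <= 3 u0^2 + 3 E q_b + 12 E int H^2,
     E int Z^2 <= 2 E q_g + 2 E q_f,    E sup V^2 <= 10 E q_g + 15 E q_f,
   where q_b, q_f bound the squares of the drift integrals, q_g that of the
   terminal value, and H is the integrand of the noise.  If the coefficients are
   split as phi(u) = (phi(u) - phi(0)) + phi(0) with
   (p + q)^2 <= 3/2 p^2 + 3 q^2, the delayed Lipschitz bounds give each of these
   terms the size kappa (E sup U^2 + E sup V^2 + E int Z^2) up to data, with
   kappa = 3/2 K m.  The total coefficient is (3 + 12 + 10 + 15 + 2 + 2) kappa =
   44 kappa, and e >= 9/4 in the smallness condition gives 44 kappa <= 8/9: the
   unknown quantity is absorbed at the price of a factor 9.

   This is used twice.  For one solution it gives an a priori bound, hence a bound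
   for E int sigma(X, Y)^2.  For the difference of two solutions the only data is
   (sqrt eps' - sqrt eps) sigma(X, Y), from
     sqrt eps' s' - sqrt eps s = sqrt eps' (s' - s) + (sqrt eps' - sqrt eps) s.
   The weights e^(s/T) lie in [1, e], and the smallness condition forces
   T <= 1/K, so that the constant does not depend on T.

   The suprema over [t, T] are not known to be measurable.  The integral of a
   nonnegative function is a supremum over the simple functions below it, hence
   monotone without measurability, and the suprema are dominated by suprema over
   a countable dense set of times. *)

Require Import Defs.
From mathcomp Require Import ring lra measurable_realfun.

Set Implicit Arguments.
Unset Strict Implicit.
Unset Printing Implicit Defensive.

Local Open Scope classical_set_scope.
Local Open Scope ring_scope.

(** * Lower integrals and square-integrable functions *)

(** Ito's isometry, the martingale property and Doob's inequality are derived from the definition of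
    the stochastic integral as a square-mean limit of simple integrals. Two choices shape this. The
    isometry is treated as an identity between inner products: by bilinearity it reduces to pairs of
    single-interval integrands, and no common refinement of time grids is formed. The martingale
    property is the orthogonality of M(u) - M(s) to the square-integrable F_s-measurable variables;
    it passes to limits by the Cauchy-Schwarz inequality and is enough for a pathwise form of Doob's
    inequality, so that neither conditional expectations nor stopping times occur.

    Absorbing 8/9 of the unknown is sound only if the unknown is finite: this uses the finite norms
    of S^2 and H^2. Continuity of X and Y is not part of these spaces; it is read off the equations,
    and it lets countable suprema control the paths at all times.

    (A3) does not say that g(0) is square-integrable; this is recovered from Y(T) = g(X_T). *)

Section LowerIntegral.
Context {d : measure_display} {T : measurableType d} {R : realType}.
Variable mu : {measure set T -> \bar R}.
Local Open Scope ereal_scope.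

Lemma le_lower_integral (f g : T -> \bar R) :
  (forall x, 0 <= f x) -> (forall x, f x <= g x) ->
  \int[mu]_x f x <= \int[mu]_x g x.
Proof.
move=> f0 fg; rewrite !ge0_integralTE//; last by move=> x; exact: le_trans (fg x).
apply: ereal_sup_le => _ [h hf <-]; exists h => // x.
exact: le_trans (hf x) (fg x).
Qed.

Lemma le_lower_integral_set (D : set T) (f g : T -> \bar R) :
  (forall x, D x -> 0 <= f x) -> (forall x, D x -> f x <= g x) ->
  \int[mu]_(x in D) f x <= \int[mu]_(x in D) g x.
Proof.
move=> f0 fg; rewrite integral_mkcond [leRHS]integral_mkcond.
apply: le_lower_integral => x; rewrite !patchE; case: ifPn => // /set_mem.
  exact: f0.
exact: fg.
Qed.

(** Only the dominating function has to be measurable: raised to +oo on a null set that contains the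
    exceptional points, it dominates everywhere and keeps its integral. *)
Lemma ae_le_lower_integral (f g : T -> \bar R) :
  (forall x, 0 <= f x) -> (forall x, 0 <= g x) -> measurable_fun setT g ->
  {ae mu, forall x, f x <= g x} -> \int[mu]_x f x <= \int[mu]_x g x.
Proof.
move=> f0 g0 mg [N [mN N0 fgN]].
pose h x := if x \in N then +oo else g x.
have -> : \int[mu]_x g x = \int[mu]_x h x.
  have mh : measurable_fun setT h.
    apply: measurable_fun_ifT => //; apply: (measurable_fun_bool true).
    rewrite setTI (_ : _ @^-1` _ = N)//.
    by apply/seteqP; split => x /=; [exact: set_mem|exact: mem_set].
  apply: ge0_ae_eq_integral => //.
    by move=> x _; rewrite /h; case: ifP.
  exists N; split => // x /=; apply: contra_notP => Nx _.
  by rewrite /h memNset.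
apply: le_lower_integral => // x; rewrite /h; case: ifPn => [_|].
  by rewrite leey.
rewrite notin_setE => Nx; apply: contrapT => fg; apply: Nx; exact: fgN.
Qed.

Lemma ae_imply (Q Q' : T -> Prop) : {ae mu, forall x, Q x} ->
  (forall x, Q x -> Q' x) -> {ae mu, forall x, Q' x}.
Proof.
move=> [N [mN N0 QN]] QQ'; exists N; split => // x nQ'; apply: QN => /QQ'.
exact: nQ'.
Qed.

Lemma ae_imply2 (Q Q' Q'' : T -> Prop) : {ae mu, forall x, Q x} ->
  {ae mu, forall x, Q' x} -> (forall x, Q x -> Q' x -> Q'' x) ->
  {ae mu, forall x, Q'' x}.
Proof.
move=> aQ aQ' H; apply: (@ae_imply (fun x => Q x /\ Q' x)); last first.
  by move=> x [] ; exact: H.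
have := negligibleU aQ aQ'; apply: negligibleS => x /= /not_andP.
by move=> [] ?; [left|right].
Qed.

Lemma ae_and (Q Q' : T -> Prop) : {ae mu, forall x, Q x} ->
  {ae mu, forall x, Q' x} -> {ae mu, forall x, Q x /\ Q' x}.
Proof. by move=> h h'; apply: (ae_imply2 h h'). Qed.

End LowerIntegral.

Section SquareIntegrable.
Context {d : measure_display} {T : measurableType d} {R : realType}.
Variable mu : {measure set T -> \bar R}.
Implicit Types f g h : T -> R.

Definition nsq f : \bar R := (\int[mu]_x ((f x) ^+ 2)%:E)%E.

Definition sqint f := measurable_fun setT f /\ (nsq f < +oo)%E.

Definition ip f g : R := Rintegral mu setT (fun x => f x * g x).

Lemma nsq_ge0 f : (0 <= nsq f)%E.
Proof. by apply: integral_ge0 => x _; rewrite lee_fin sqr_ge0. Qed.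

Lemma measurable_sqr_EFin f : measurable_fun setT f ->
  measurable_fun setT (fun x => ((f x) ^+ 2)%:E).
Proof. by move=> mf; apply/measurable_EFinP; exact: measurable_funX. Qed.

Lemma nsq_le_comb c c' f g h : measurable_fun setT f -> measurable_fun setT g ->
  0 <= c -> 0 <= c' ->
  (forall x, (h x) ^+ 2 <= c * (f x) ^+ 2 + c' * (g x) ^+ 2) ->
  (nsq h <= c%:E * nsq f + c'%:E * nsq g)%E.
Proof.
move=> mf mg c0 c'0 H; rewrite /nsq.
have fc k u : (0 <= k) -> (0 <= (k * u ^+ 2)%:E :> \bar R)%E.
  by move=> k0; rewrite lee_fin mulr_ge0// sqr_ge0.
rewrite -!ge0_integralZl//; try exact: measurable_sqr_EFin;
  try by move=> x _; rewrite lee_fin sqr_ge0.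
rewrite -ge0_integralD//; first last.
- by apply: measurable_funeM; exact: measurable_sqr_EFin.
- by move=> x _; exact: fc.
- by apply: measurable_funeM; exact: measurable_sqr_EFin.
- by move=> x _; exact: fc.
apply: le_lower_integral => x; first by rewrite lee_fin sqr_ge0.
by rewrite -!EFinM -EFinD lee_fin.
Qed.

Lemma nsqZ c f : measurable_fun setT f ->
  nsq (fun x => c * f x) = ((c ^+ 2)%:E * nsq f)%E.
Proof.
move=> mf; rewrite /nsq -ge0_integralZl//.
- by apply: eq_integral => x _; rewrite exprMn EFinM.
- exact: measurable_sqr_EFin.
- by move=> x _; rewrite lee_fin sqr_ge0.
- by rewrite lee_fin sqr_ge0.
Qed.

Lemma nsqD_le f g : measurable_fun setT f -> measurable_fun setT g ->
  (nsq (fun x => f x + g x)%R <= 2%:E * nsq f + 2%:E * nsq g)%E.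
Proof.
move=> mf mg; apply: nsq_le_comb => // x.
rewrite -subr_ge0 (_ : _ - _ = (f x - g x) ^+ 2) ?sqr_ge0//; ring.
Qed.

Lemma sqint0 : sqint (fun=> 0).
Proof.
split => //; rewrite /nsq (eq_integral (fun=> 0%E)) ?integral0//.
by move=> x _; rewrite expr0n.
Qed.

Lemma sqintD f g : sqint f -> sqint g -> sqint (fun x => f x + g x).
Proof.
move=> [mf f2] [mg g2]; split; first exact: measurable_funD.
apply: le_lt_trans; first exact: nsqD_le.
by apply: lte_add_pinfty; exact: lte_mul_pinfty.
Qed.

Lemma sqintZ c f : sqint f -> sqint (fun x => c * f x).
Proof.
move=> [mf f2]; split; first exact: measurable_funM.
rewrite nsqZ//; apply: lte_mul_pinfty => //; by rewrite lee_fin sqr_ge0.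
Qed.

Lemma sqintB f g : sqint f -> sqint g -> sqint (fun x => f x - g x).
Proof.
move=> sf /(sqintZ (-1)) sg; have := sqintD sf sg.
by under eq_fun do rewrite mulN1r.
Qed.

Lemma integrable_ip f g : sqint f -> sqint g ->
  mu.-integrable setT (fun x => (f x * g x)%:E).
Proof.
move=> [mf f2] [mg g2].
have mm : measurable_fun setT (fun x => (f x * g x)%:E).
  by apply/measurable_EFinP; exact: measurable_funM.
apply/integrableP; split => //.
apply: (@le_lt_trans _ _ (nsq f + nsq g)%E); last exact: lte_add_pinfty.
rewrite /nsq -ge0_integralD//; try exact: measurable_sqr_EFin;
  try by move=> x _; rewrite lee_fin sqr_ge0.
apply: le_lower_integral => x; first exact: abse_ge0.
rewrite abse_EFin -EFinD lee_fin normrM.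
rewrite -(@real_normK _ (f x)) ?num_real// -(@real_normK _ (g x)) ?num_real//.
have /= := sqr_ge0 (`|f x| - `|g x|); have := normr_ge0 (f x); have := normr_ge0 (g x).
nra.
Qed.

Lemma ip_self f : sqint f -> (ip f f)%:E = nsq f.
Proof.
move=> sf; rewrite /ip /Rintegral fineK.
  by apply: eq_integral => x _; rewrite expr2.
exact: integrable_fin_num (integrable_ip sf sf).
Qed.

Lemma ipC f g : ip f g = ip g f.
Proof. by congr Rintegral; apply/funext => x; rewrite mulrC. Qed.

Lemma ipDl f g h : sqint f -> sqint g -> sqint h ->
  ip (fun x => f x + g x) h = ip f h + ip g h.
Proof.
move=> sf sg sh; rewrite /ip -RintegralD//; try exact: integrable_ip.
by congr Rintegral; apply/funext => x; rewrite mulrDl.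
Qed.

Lemma ipZl c f g : sqint f -> sqint g -> ip (fun x => c * f x) g = c * ip f g.
Proof.
move=> sf sg; rewrite /ip -RintegralZl//; last exact: integrable_ip.
by congr Rintegral; apply/funext => x; rewrite mulrA.
Qed.

Lemma ipBl f g h : sqint f -> sqint g -> sqint h ->
  ip (fun x => f x - g x) h = ip f h - ip g h.
Proof.
move=> sf sg sh; rewrite -[in RHS]mulN1r -ipZl// -ipDl//; last exact: sqintZ.
by congr ip; apply/funext => x; rewrite mulN1r.
Qed.

Lemma ipDr f g h : sqint f -> sqint g -> sqint h ->
  ip h (fun x => f x + g x) = ip h f + ip h g.
Proof. by move=> *; rewrite ipC ipDl// ipC (ipC g). Qed.

Lemma ipBr f g h : sqint f -> sqint g -> sqint h ->
  ip h (fun x => f x - g x) = ip h f - ip h g.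
Proof. by move=> *; rewrite ipC ipBl// ipC (ipC g). Qed.

Lemma ipZr c f g : sqint f -> sqint g -> ip g (fun x => c * f x) = c * ip g f.
Proof. by move=> *; rewrite ipC ipZl// ipC. Qed.

Lemma ip_ge0 f : 0 <= ip f f.
Proof. by apply: Rintegral_ge0 => x _; rewrite -expr2 sqr_ge0. Qed.

Lemma cauchy_schwarz_ip f g : sqint f -> sqint g ->
  ip f g ^+ 2 <= ip f f * ip g g.
Proof.
move=> sf sg.
have H a b : 0 <= a ^+ 2 * ip f f - 2 * a * b * ip f g + b ^+ 2 * ip g g.
  have := ip_ge0 (fun x => a * f x - b * g x).
  have sa := sqintZ a sf; have sb := sqintZ b sg.
  have sab := sqintB sa sb.
  rewrite (ipBl sa sb sab) (ipZl a sf sab) (ipZl b sg sab).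
  rewrite (ipBr sa sb sf) (ipBr sa sb sg) !ipZr//.
  rewrite (ipC g f) => h; lra.
(* With a = (g, g) and b = (f, g) the form equals (g, g) ((f, f) (g, g) - (f, g)^2). If (g, g) = 0,
   the roles of f and g are exchanged; if both squares vanish, a = 1 and b = (f, g) leave - 2 (f,
   g)^2 >= 0. *)
have A0 := ip_ge0 f; have B0 := ip_ge0 g.
have [B|B] := eqVneq (ip g g) 0; last first.
  have Bp : 0 < ip g g by rewrite lt_neqAle eq_sym B.
  rewrite -subr_ge0 -(pmulr_rge0 _ Bp); have := H (ip g g) (ip f g); lra.
have [A|A] := eqVneq (ip f f) 0; last first.
  have Ap : 0 < ip f f by rewrite lt_neqAle eq_sym A.
  rewrite -subr_ge0 -(pmulr_rge0 _ Ap); have := H (ip f g) (ip f f); lra.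
have := H 1 (ip f g); rewrite A B => h; lra.
Qed.

End SquareIntegrable.

Section SquareMeanLimits.
Context {d : measure_display} {T : measurableType d} {R : realType}.
Variable mu : {measure set T -> \bar R}.
Variables (u : nat -> T -> R) (f : T -> R).
Hypothesis sqint_u : forall n, sqint mu (u n).
Hypothesis mf : measurable_fun setT f.
Hypothesis cvg_u : (fun n => nsq mu (fun x => u n x - f x)) @ \oo --> 0%E.

Lemma sqint_lim : sqint mu f.
Proof.
split=> //.
(* Convergence to 0 in the extended reals gives an index N at finite distance from [f]; then f = u_N
   - (u_N - f). *)
have /fine_cvgP [[N _ /(_ N (leqnn N)) fN] _] := cvg_u.
have mu_ : measurable_fun setT (fun x => u N x - f x).
  by apply: measurable_funB => //; case: (sqint_u N).
have sN : sqint mu (fun x => u N x - f x).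
  by split=> //; rewrite -ge0_fin_numE// nsq_ge0.
have [_] := sqintB (sqint_u N) sN.
by congr (_ < _)%E; congr nsq; apply/funext => x; ring.
Qed.

Let sqint_err n : sqint mu (fun x => u n x - f x).
Proof. exact: sqintB sqint_lim. Qed.

Lemma cvg_ip_err :
  (fun n => ip mu (fun x => u n x - f x) (fun x => u n x - f x)) @ \oo --> 0.
Proof.
have /fine_cvgP [_] := cvg_u; apply: cvg_trans; apply: near_eq_cvg.
by near=> n; rewrite /= -ip_self.
Unshelve. all: by end_near. Qed.

Lemma cvg_ip g : sqint mu g -> (fun n => ip mu (u n) g) @ \oo --> ip mu f g.
Proof.
move=> sg.
have key : (fun n => (ip mu (u n) g - ip mu f g) ^+ 2) @ \oo --> 0.
  apply: (@squeeze_cvgr _ _ _ _ (cst 0) (fun n =>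
    ip mu (fun x => u n x - f x) (fun x => u n x - f x) * ip mu g g)).
  - near=> n; rewrite sqr_ge0/= -(ipBl (sqint_u n) sqint_lim sg).
    exact: cauchy_schwarz_ip.
  - exact: cvg_cst.
  - by rewrite -(mul0r (ip mu g g)); apply: cvgMl; exact: cvg_ip_err.
apply/cvgrPdist_lt => e e0; have e2 : 0 < e ^+ 2 by rewrite exprn_gt0.
move/cvgrPdist_lt : key => /(_ _ e2); apply: filterS => n.
rewrite sub0r normrN normrX -ltr_sqrt// distrC.
by rewrite !sqrtr_sqr normr_id (gtr0_norm e0).
Unshelve. all: by end_near. Qed.

Lemma cvg_ip_self : (fun n => ip mu (u n) (u n)) @ \oo --> ip mu f f.
Proof.
have H n : ip mu (u n) (u n) = ip mu (fun x => u n x - f x) (fun x => u n x - f x)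
     + (2 * ip mu (u n) f - ip mu f f).
  have su := sqint_u n; have sf := sqint_lim; have se := sqint_err n.
  rewrite (ipBl su sf se) (ipBr su sf su) (ipBr su sf sf) (ipC _ f (u n)); ring.
rewrite (_ : (fun n => _) = fun n => ip mu (fun x => u n x - f x) (fun x => u n x - f x)
     + (2 * ip mu (u n) f - ip mu f f)); last exact/funext.
rewrite -[X in _ --> X](_ : 0 + (2 * ip mu f f - ip mu f f) = _); last by ring.
apply: cvgD; first exact: cvg_ip_err.
apply: cvgB; last exact: cvg_cst.
by apply: cvgMr; apply: cvg_ip; exact: sqint_lim.
Qed.

End SquareMeanLimits.

(** * Normal moments and products of independent variables *)

(** [h] coincides almost everywhere with the Radon-Nikodym derivative of [nu], both having the same
    integral on every measurable set. *)
Lemma ge0_integral_density {d : measure_display} {T : measurableType d} {R : realType}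
    (mu : {sigma_finite_measure set T -> \bar R})
    (nu : {finite_measure set T -> \bar R}) (h : T -> R) (f : T -> \bar R) :
  measurable_fun setT h ->
  (forall A, measurable A -> nu A = (\int[mu]_(x in A) (h x)%:E)%E) ->
  measurable_fun setT f -> (forall x, 0 <= f x)%E ->
  (\int[nu]_x f x = \int[mu]_x (f x * (h x)%:E))%E.
Proof.
move=> mh nuE mf f0; have numu : nu `<< mu.
  apply/null_content_dominatesP => A mA A0; rewrite nuE//.
  apply: null_set_integral => //.
  exact/measurable_EFinP/measurable_funTS.
have ig := Radon_Nikodym_SigmaFinite.f_integrable numu.
rewrite -(Radon_Nikodym_SigmaFinite.change_of_variables numu)//.
apply: ae_eq_integral => //.
- by apply: emeasurable_funM => //; exact: measurable_int ig.
- by apply: emeasurable_funM => //; exact/measurable_EFinP.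
apply: ae_eqe_mul2l; apply: integral_ae_eq => //; first exact/measurable_EFinP.
by move=> A _ mA; rewrite -Radon_Nikodym_SigmaFinite.f_integral// nuE.
Qed.

Section NormalMoments.
Context {R : realType}.
Variable s : R.
Hypothesis s0 : 0 < s.
Local Notation mu := (@lebesgue_measure R).
Let c : R := - (s ^+ 2 *+ 2)^-1.
Let p := normal_pdf 0 s.

Let s_neq0 : s != 0. Proof. by rewrite gt_eqF. Qed.

Let s2_gt0 : 0 < s ^+ 2. Proof. by rewrite exprn_gt0. Qed.

Let pE x : p x = normal_peak s * expR (c * x ^+ 2).
Proof.
rewrite /p normal_pdfE// /normal_fun subr0 /c; congr (_ * expR _).
by rewrite mulNr mulrC mulNr.
Qed.

Let p_ge0 x : 0 <= p x. Proof. exact: normal_pdf_ge0. Qed.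

Let mp : measurable_fun setT p. Proof. exact: measurable_normal_pdf. Qed.

Let p_even x : p (- x) = p x. Proof. by rewrite !pE sqrrN. Qed.

Let is_derive_p (x : R) : is_derive x (1 : R) p (2 * c * x * p x).
Proof.
have -> : p = (fun x => normal_peak s * expR (c * x ^+ 2)) by apply/funext => y; rewrite pE.
apply: is_derive_eq; rewrite /GRing.scale/=; ring.
Qed.

Let cvg_np : (fun n : nat => n%:R * p n%:R) @ \oo --> 0.
Proof.
have H : (fun n : nat => (normal_peak s * (s ^+ 2 *+ 2)) * n.+1%:R^-1) @ \oo --> 0.
  rewrite -[X in _ --> X](mulr0 (normal_peak s * (s ^+ 2 *+ 2))).
  by apply: cvgMr; exact: cvg_harmonic.
rewrite -(cvg_shiftS); apply: (squeeze_cvgr _ (cvg_cst 0) H).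
near=> n; rewrite mulr_ge0//=.
rewrite pE mulrCA -!mulrA ler_pM2l ?normal_peak_gt0//.
set m : R := n.+1%:R; have m0 : 0 < m by rewrite ltr0n.
have k0 : 0 < s ^+ 2 *+ 2 by rewrite pmulrn_lgt0.
(* From e^y >= 1 + y with y = m^2 / (2 s^2), the density at m is at most its peak times 2 s^2 /
   m^2. *)
have := expR_ge1Dx (m ^+ 2 / (s ^+ 2 *+ 2)).
rewrite (_ : c * _ = - (m ^+ 2 / (s ^+ 2 *+ 2))); last by rewrite /c; ring.
rewrite expRN => h.
rewrite ler_pdivlMr// mulrAC -expr2 ler_pdivrMr ?expR_gt0//.
rewrite -ler_pdivrMl// mulrC; apply: le_trans h; by rewrite lerDr.
Unshelve. all: by end_near. Qed.

Let cp : continuous p. Proof. exact: continuous_normal_pdf. Qed.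

(** A primitive of x^2 p(x) - s^2 p(x): over [-n, n] it reduces the second moment to the total mass
    of the density, up to a boundary term in n p(n). *)
Let F (x : R) : R := - s ^+ 2 * (x * p x).

Let is_derive_F (x : R) : is_derive x (1 : R) F (x ^+ 2 * p x - s ^+ 2 * p x).
Proof.
have dp := is_derive_p x; rewrite /F.
apply: is_derive_eq; rewrite /GRing.scale/= /c.
by field; exact: s_neq0.
Qed.

Let cF : continuous F.
Proof.
move=> x; apply: cvgMr; apply: cvgM; first exact: cvg_id.
exact: cp.
Qed.

Let cf : continuous (fun x : R => x ^+ 2 * p x - s ^+ 2 * p x).
Proof.
move=> x; apply: cvgB; apply: cvgM; try exact: cp; try exact: cvg_cst.
exact: exprn_continuous.
Qed.

Let segint n (f : R -> R) := (\int[mu]_(x in `[(- n%:R)%R, n%:R%R]) (f x)%:E)%E.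

Let integrable_seg n (f : R -> R) : continuous f ->
  mu.-integrable `[- n%:R, n%:R] (EFin \o f).
Proof.
move=> cf'; apply: continuous_compact_integrable; first exact: segment_compact.
exact: continuous_subspaceT.
Qed.

Let FTC n : segint n.+1 (fun x => x ^+ 2 * p x) =
  ((s ^+ 2)%:E * segint n.+1 p + (- 2 * s ^+ 2 * (n.+1%:R * p n.+1%:R))%:E)%E.
Proof.
have nn : - n.+1%:R < n.+1%:R :> R by rewrite gtrN // ltr0n.
have ip1 : mu.-integrable `[- n.+1%:R, n.+1%:R] (fun x => (s ^+ 2 * p x)%:E).
  by apply: integrable_seg => x; apply: cvgMr; exact: cp.
rewrite -integralZl//; last exact: integrable_seg.
have := @continuous_FTC2 R _ F _ _ nn (continuous_subspaceT cf) _ _.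
rewrite (_ : (F _)%:E - _ = (- 2 * s ^+ 2 * (n.+1%:R * p n.+1%:R))%:E)%E; last first.
  by rewrite -EFinB /F p_even; congr EFin; ring.
move=> <-; first last.
- by move=> x _; rewrite derive1E; apply: derive_val.
- split; last 2 first.
  + by apply: cvg_at_right_filter; exact: cF.
  + by apply: cvg_at_left_filter; exact: cF.
  + by move=> x _; apply: ex_derive.
rewrite -integralD//; first last.
- exact: integrable_seg.
- by apply: eq_integral => x _; rewrite -EFinM -EFinD; congr EFin; ring.
Qed.

Let cover : \bigcup_n `[- n.+1%:R, n.+1%:R]%classic = [set: R].
Proof.
apply/seteqP; split => // x _; exists (Num.truncn `|x|) => //=.
by rewrite in_itv/= -ler_norml ltW// truncnS_gt.
Qed.

Let cvg_seg (f : R -> R) : measurable_fun setT f -> (forall x, 0 <= f x) ->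
  (fun n => segint n.+1 f) @ \oo --> (\int[mu]_x (f x)%:E)%E.
Proof.
move=> mf f0; rewrite -cover; apply: ge0_nondecreasing_set_cvg_integral => //.
- apply/nondecreasing_seqP => n; apply/subsetPset => x /=.
  by rewrite !in_itv/= -!ler_norml => /le_trans; apply; rewrite ler_nat.
- by move=> n; apply/measurable_EFinP; exact: measurable_funTS.
- by move=> n x _; rewrite lee_fin.
Qed.

Lemma integral_sqr_normal_pdf : (\int[mu]_x (x ^+ 2 * p x)%:E = (s ^+ 2)%:E)%E.
Proof.
have m2 : measurable_fun setT (fun x : R => x ^+ 2 * p x) by exact: measurable_funM.
have /cvg_lim := cvg_seg m2 (fun x => mulr_ge0 (sqr_ge0 x) (p_ge0 x)).
move=> /(_ (@ereal_hausdorff R)) <-; apply/cvg_lim; first exact: ereal_hausdorff.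
rewrite (_ : (fun n => _) = fun n => ((s ^+ 2)%:E * segint n.+1 p +
   (- 2 * s ^+ 2 * (n.+1%:R * p n.+1%:R))%:E)%E); last exact/funext/FTC.
rewrite -[X in _ --> X]adde0 -[X in (X + _)%E]mule1.
apply: cvgeD => //.
  apply: cvgeMl => //; rewrite -(integral_normal_pdf 0 s); exact: cvg_seg.
apply: cvg_EFin; first by near=> n.
rewrite -[X in _ --> X](mulr0 (- 2 * s ^+ 2)); apply: cvgMr.
by rewrite (cvg_shiftS (fun n => n%:R * p n%:R)); exact: cvg_np.
Unshelve. all: by end_near. Qed.

Lemma normal_prob_sqr : (\int[normal_prob 0 s]_x (x ^+ 2)%:E = (s ^+ 2)%:E)%E.
Proof.
rewrite (@ge0_integral_density _ _ _ mu (normal_prob 0 s) p)//.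
- rewrite -integral_sqr_normal_pdf; apply: eq_integral => x _; by rewrite EFinM.
- exact/measurable_EFinP/measurable_funX.
- by move=> x; rewrite lee_fin sqr_ge0.
Qed.

Let normal_prob_sym f : measurable_fun setT f -> (forall x, 0 <= f x)%E ->
  (\int[normal_prob 0 s]_x f (- x)%R = \int[normal_prob 0 s]_x f x)%E.
Proof.
move=> mf f0.
have mN : measurable_fun setT (-%R : R -> R) by exact: measurable_funN.
rewrite !(@ge0_integral_density _ _ _ mu (normal_prob 0 s) p)//; last first.
  exact: measurableT_comp.
transitivity (\int[mu]_x ((fun y => (f y * (p y)%:E)) (- x)%R))%E.
  by apply: eq_integral => x _; rewrite /= p_even.
pose g (y : measurableTypeR R) : \bar R := (f y * (p y)%:E)%E.
have mg : measurable_fun setT g.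
  by apply: emeasurable_funM => //; exact/measurable_EFinP.
have g0 : {in [set: measurableTypeR R], forall y, 0 <= g y}%E.
  by move=> y _; rewrite mule_ge0 ?lee_fin.
rewrite -[LHS](@ge0_integral_pushforward _ _ (measurableTypeR R)
  (measurableTypeR R) R -%R mN mu setT g measurableT mg g0).
by apply: eq_measure_integral => A mA _; exact: lebesgue_measureN.
Qed.

(** Positive and negative parts have the same integral, the density being even, and this integral is
    finite because x <= 1 + x^2. *)
Lemma normal_prob_mean : (\int[normal_prob 0 s]_x x%:E = 0)%E.
Proof.
pose f (x : R) : \bar R := x%:E.
have mf : measurable_fun setT f by exact/measurable_EFinP.
rewrite -[LHS]/(\int[normal_prob 0 s]_x f x)%E integralE.
have -> : (\int[normal_prob 0 s]_x (f^\- x) = \int[normal_prob 0 s]_x (f^\+ x))%E.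
  rewrite -[RHS]normal_prob_sym//; last exact: measurable_funepos.
  by apply: eq_integral => x _; rewrite funenegE funeposE /f EFinN.
apply: subee; rewrite ge0_fin_numE; last exact: integral_ge0.
apply: (@le_lt_trans _ _ (\int[normal_prob 0 s]_x (1%:E + (x ^+ 2)%:E)))%E.
  apply: le_lower_integral => x //.
  rewrite funeposE /f -EFinD -EFin_max lee_fin ge_max; apply/andP; split; last first.
    by rewrite addr_ge0// sqr_ge0.
  have := sqr_ge0 (x - 1); have := sqr_ge0 x; nra.
rewrite ge0_integralD//; last 2 first.
- by move=> x _; rewrite lee_fin sqr_ge0.
- exact/measurable_EFinP/measurable_funX.
rewrite normal_prob_sqr integral_cst// mul1e.
by rewrite [X in (X + _)%E](integral_normal_pdf 0 s) -EFinD ltry.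
Qed.

End NormalMoments.

Section IndependentProduct.
Context {d : measure_display} {T : measurableType d} {R : realType}.
Variables (P : probability T R) (U V : T -> R).
Hypotheses (mU : measurable_fun setT U) (mV : measurable_fun setT V).
Hypothesis indep : forall A B : set R, measurable A -> measurable B ->
  P (U @^-1` A `&` V @^-1` B) = (P (U @^-1` A) * P (V @^-1` B))%E.
Hypotheses (iU : P.-integrable setT (EFin \o U))
  (iV : P.-integrable setT (EFin \o V))
  (iUV : P.-integrable setT (fun x => (U x * V x)%:E)).

Let mixinU := isMeasurableFun.Build _ _ _ _ _ mU.
Let packU : {mfun T >-> R} := MeasurableFun.Pack (MeasurableFun.Class mixinU).
Let mixinV := isMeasurableFun.Build _ _ _ _ _ mV.
Let packV : {mfun T >-> R} := MeasurableFun.Pack (MeasurableFun.Class mixinV).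
Let m1 : probability R R := distribution P packU.
Let m2 : probability R R := distribution P packV.
Let UV x := (U x, V x).
Let mUV : measurable_fun setT UV. Proof. exact: measurable_fun_pair. Qed.

Let f (p : R * R) : \bar R := (p.1 * p.2)%:E.

Let mf : measurable_fun setT f.
Proof. by apply/measurable_EFinP; exact: measurable_funM. Qed.

Let m12E X : measurable X -> (m1 \x m2)%E X = pushforward P UV X.
Proof. by move=> mX; apply: (@product_measure_unique _ _ _ _ _ m1 m2 (pushforward P UV)). Qed.

Let integral_pair (g : R * R -> \bar R) : measurable_fun setT g ->
  (forall x, 0 <= g x)%E ->
  (\int[m1 \x m2]_p g p = \int[P]_x g (UV x))%E.
Proof.
move=> mg g0; transitivity (\int[pushforward P UV]_p g p)%E.
  by apply: eq_measure_integral => A mA _; exact: m12E.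
by rewrite ge0_integral_pushforward.
Qed.

Let integrable_f : (m1 \x m2)%E.-integrable setT f.
Proof.
apply/integrableP; split => //; rewrite integral_pair//.
  by have /integrableP[] := iUV.
exact: measurableT_comp.
Qed.

Let integral_f : (\int[m1 \x m2]_p f p = \int[P]_x (U x * V x)%:E)%E.
Proof.
transitivity (\int[pushforward P UV]_p f p)%E.
  by apply: eq_measure_integral => A mA _; exact: m12E.
by rewrite integral_pushforward.
Qed.

Let integral_m1 : (\int[m1]_u u%:E = \int[P]_x (U x)%:E)%E.
Proof. by rewrite integral_pushforward//; exact/measurable_EFinP. Qed.

Let integral_m2 : (\int[m2]_u u%:E = \int[P]_x (V x)%:E)%E.
Proof. by rewrite integral_pushforward//; exact/measurable_EFinP. Qed.

Let integrable_m1 : m1.-integrable setT (@EFin R).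
Proof. by apply: integrable_pushforward => //; exact/measurable_EFinP. Qed.

Let integrable_m2 : m2.-integrable setT (@EFin R).
Proof. by apply: integrable_pushforward => //; exact/measurable_EFinP. Qed.

(** The joint law of (U, V) agrees with the product of the two laws on rectangles, hence everywhere;
    Fubini's theorem for the product law concludes. *)
Lemma Rintegral_indepM :
  Rintegral P setT (fun x => U x * V x) = Rintegral P setT U * Rintegral P setT V.
Proof.
rewrite /Rintegral -integral_f -integral12_prod_meas1//.
have fV : (\int[P]_x (V x)%:E)%E \is a fin_num by exact: integrable_fin_num.
have fU : (\int[P]_x (U x)%:E)%E \is a fin_num by exact: integrable_fin_num.
rewrite -fineM//; congr fine.
rewrite -(fineK fV) muleC -integral_m1 -integralZl//.
apply: eq_integral => u _; rewrite /fubini_F /f /= fineK//.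
by rewrite -integral_m2 muleC -integralZl.
Qed.

End IndependentProduct.

(** * Stochastic integrals *)

Section Bounded.
Context {d : measure_display} {T : measurableType d} {R : realType}.
Variable P : probability T R.

Lemma integral_probability_cst (r : R) : (\int[P]_x r%:E = r%:E)%E.
Proof.
rewrite integral_cst// -[RHS]mule1; congr (_ * _)%E; exact: probability_setT.
Qed.

Lemma sqint_bounded (xi : T -> R) M : measurable_fun setT xi ->
  (forall w, `|xi w| <= M) -> sqint P xi.
Proof.
move=> mxi xiM; split => //.
apply: (@le_lt_trans _ _ (\int[P]_w (M ^+ 2)%:E)%E).
  apply: le_lower_integral => w; rewrite lee_fin ?sqr_ge0//.
  by rewrite -real_normK ?num_real// ler_sqr ?nnegrE// (le_trans _ (xiM w)).
by rewrite integral_probability_cst ltry.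
Qed.

End Bounded.

(** * Completed Brownian filtration and increments *)

Section Filtration.
Context {R : realType} {d : measure_display} {Om : measurableType d}.
Variables (P : probability Om R) (W : Om -> R -> R) (T : R).
Hypotheses (brW : is_brownian P W T) (cP : measure_is_complete P).

Definition adapted_to (s : R) (xi : Om -> R) :=
  smeasurable (filtration_space P W s) xi.

Let gen s : set (set Om) := natural_filtration W s `|` P.-negligible.

(** Through this, the closure of adapted variables under algebraic operations is inherited from that
    of measurable functions. *)
Lemma adapted_toP s xi :
  adapted_to s xi <-> measurable_fun [set: g_sigma_algebraType (gen s)] xi.
Proof.
by split=> [h _ B mB|h B mB]; [exact: h|apply: h].
Qed.

Lemma natural_filtration_measurable s A : 0 <= s <= T ->
  natural_filtration W s A -> measurable A.
Proof.
move=> sT; apply: smallest_sub => [|_ [u [B [uT mB ->]]]].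
  exact: sigma_algebra_measurable.
have [mW _ _ _] := brW; have uT' : 0 <= u <= T.
  by case/andP: uT sT => -> us /andP[_ sT]; exact: le_trans us sT.
suff : measurable (setT `&` W ^~ u @^-1` B) by rewrite setTI.
exact: mW.
Qed.

Lemma brownian_filtration_measurable s A : 0 <= s <= T ->
  brownian_filtration P W s A -> measurable A.
Proof.
move=> sT; apply: smallest_sub => [|B [|]].
- exact: sigma_algebra_measurable.
- exact: natural_filtration_measurable.
- exact: cP.
Qed.

Lemma adapted_to_measurable s xi : 0 <= s <= T -> adapted_to s xi ->
  measurable_fun setT xi.
Proof. by move=> sT axi _ B mB; apply: (brownian_filtration_measurable sT); exact: axi. Qed.

Lemma brownian_filtrationS s u : s <= u ->
  brownian_filtration P W s `<=` brownian_filtration P W u.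
Proof.
move=> su; apply: sub_smallest2r => [|A [nA|NA]].
- exact: smallest_sigma_algebra.
- left; move: A nA; apply: sub_smallest2r; first exact: smallest_sigma_algebra.
  move=> _ [r [B [/andP[r0 rs] mB ->]]]; exists r, B; split => //.
  by rewrite r0 (le_trans rs).
- by right.
Qed.

Lemma adapted_toS s u xi : s <= u -> adapted_to s xi -> adapted_to u xi.
Proof. by move=> su a B mB; apply: (brownian_filtrationS su); exact: a. Qed.

Lemma adapted_to_cst s c : adapted_to s (fun=> c).
Proof. exact/adapted_toP. Qed.

Lemma adapted_toM s xi eta : adapted_to s xi -> adapted_to s eta ->
  adapted_to s (fun w => xi w * eta w).
Proof. by move=> /adapted_toP h /adapted_toP k; apply/adapted_toP; exact: measurable_funM. Qed.

Lemma adapted_toD s xi eta : adapted_to s xi -> adapted_to s eta ->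
  adapted_to s (fun w => xi w + eta w).
Proof. by move=> /adapted_toP h /adapted_toP k; apply/adapted_toP; exact: measurable_funD. Qed.

Lemma adapted_toB s xi eta : adapted_to s xi -> adapted_to s eta ->
  adapted_to s (fun w => xi w - eta w).
Proof. by move=> /adapted_toP h /adapted_toP k; apply/adapted_toP; exact: measurable_funB. Qed.

Lemma adapted_to_comp s xi (h : R -> R) : measurable_fun setT h ->
  adapted_to s xi -> adapted_to s (fun w => h (xi w)).
Proof. by move=> mh /adapted_toP k; apply/adapted_toP; exact: measurableT_comp. Qed.

Lemma adapted_to_max s xi eta : adapted_to s xi -> adapted_to s eta ->
  adapted_to s (fun w => Num.max (xi w) (eta w)).
Proof. by move=> /adapted_toP h /adapted_toP k; apply/adapted_toP; exact: measurable_maxr. Qed.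

Lemma adapted_to_W s u : 0 <= s -> s <= u -> adapted_to u (W ^~ s).
Proof.
move=> s0 su B mB; rewrite setTI; apply: sub_gen_smallest; left.
by apply: sub_gen_smallest; exists s, B; rewrite s0 su.
Qed.

(** The definition of Brownian motion gives independence from the natural filtration only. The sets
    that agree with a natural event off a null set form a sigma-algebra; it contains the natural
    events and the negligible sets, hence the completed filtration. *)
Lemma increment_indep s u (A : set Om) (B : set R) :
  0 <= s -> s < u -> u <= T -> brownian_filtration P W s A -> measurable B ->
  P (A `&` [set w | B (W w u - W w s)]) =
    (P A * normal_prob 0 (Num.sqrt (u - s)) B)%E.
Proof.
move=> s0 su uT FA mB.
have sT : 0 <= s <= T by rewrite s0 (le_trans (ltW su)).
have uT' : 0 <= u <= T by rewrite uT (le_trans s0 (ltW su)).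
have [mW _ _ indep] := brW.
have [A0 [N [nA0 mN N0 AN]]] : exists A0 N, [/\ natural_filtration W s A0,
    measurable N, P N = 0%E & A `\` N = A0 `\` N].
  move: A FA; apply: smallest_sub => [|A [nA|[N [mN N0 AN]]]]; last 2 first.
  - by exists A, set0; split.
  - exists set0, N; split => //; last first.
      by rewrite set0D; apply/seteqP; split => // x [/AN].
    by have [] := smallest_sigma_algebra setT [set A | exists s0 (B : set R),
       [/\ 0 <= s0 <= s, measurable B & A = [set w | B (W w s0)]]].
  have [n0 nC nU] := smallest_sigma_algebra setT [set A | exists s0 (B : set R),
       [/\ 0 <= s0 <= s, measurable B & A = [set w | B (W w s0)]]].
  split.
  - by exists set0, set0; split.
  - move=> A [A0 [N [nA mN N0 AN]]]; exists (setT `\` A0), N; split => //.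
      exact: nC.
    apply/seteqP; split => x [[_ Ax] Nx]; split => //; split => // A'x.
      have : (A `\` N) x by rewrite AN.
      by case.
    have : (A0 `\` N) x by rewrite -AN.
    by case.
  - move=> F /choice[F0 /choice[N FN]].
    exists (\bigcup_k F0 k), (\bigcup_k N k); split.
    + by apply: nU => k; case: (FN k).
    + by apply: bigcupT_measurable => k; case: (FN k).
    + have mU : measurable (\bigcup_k N k).
        by apply: bigcupT_measurable => k; case: (FN k).
      apply: (measure_negligible mU); apply: negligible_bigcup => k.
      by case: (FN k) => _ mN N0 _; exists (N k); split.
    + apply/seteqP; split => x [[k _ kx] Nx]; split => //; exists k => //.
        have : (F0 k `\` N k) x.
          by case: (FN k) => _ _ _ <-; split => // ?; apply: Nx; exists k.
        by case.
      have : (F k `\` N k) x.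
        by case: (FN k) => _ _ _ ->; split => // ?; apply: Nx; exists k.
      by case.
(* Two events that coincide off [N] have the same probability: this exchanges [A] for the natural
   event [A0]. *)
have PE (C C' : set Om) : measurable C -> measurable C' -> C `\` N = C' `\` N -> P C = P C'.
  move=> mC mC' CC'.
  have H (D : set Om) : measurable D -> P D = P (D `\` N).
    move=> mD; rewrite measureD//; last by rewrite (le_lt_trans (probability_le1 P mD)) ?ltry.
    rewrite [X in (_ - X)%E](_ : _ = 0%E) ?sube0//.
    by apply: (subset_measure0 _ _ _ N0) => //; exact: measurableI.
  by rewrite H// (H C')// CC'.
have mA : measurable A by exact: brownian_filtration_measurable FA.
have mA0 : measurable A0 by exact: natural_filtration_measurable nA0.
have mD : measurable [set w | B (W w u - W w s)].
  rewrite -[X in measurable X]setTI; apply: (measurable_funB (mW u uT') (mW s sT)) => //.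
rewrite (PE A A0)// -indep//.
move: mD; set D := [set w | B (W w u - W w s)] => mD.
apply: PE; [exact: measurableI|exact: measurableI|].
by rewrite (setIC A) (setIC A0) -!setIDA AN.
Qed.

Definition incr (s u : R) (w : Om) : R := W w u - W w s.

Lemma measurable_incr s u : 0 <= s <= T -> 0 <= u <= T -> measurable_fun setT (incr s u).
Proof. by have [mW _ _ _] := brW => ? ?; apply: measurable_funB; exact: mW. Qed.

Let incr_law s u (B : set R) : 0 <= s -> s < u -> u <= T -> measurable B ->
  P (incr s u @^-1` B) = normal_prob 0 (Num.sqrt (u - s)) B.
Proof.
move=> s0 su uT mB; rewrite -[LHS]/(P [set w | B (W w u - W w s)]) -[X in P X]setTI.
rewrite (increment_indep s0 su uT _ mB) ?probability_setT ?mul1e//.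
by have [? h _] := smallest_sigma_algebra setT (gen s); rewrite -[X in _ X]setD0; apply: h.
Qed.

Lemma nsq_incr s u : 0 <= s -> s <= u -> u <= T -> nsq P (incr s u) = (u - s)%:E.
Proof.
(* The law of an increment is known for s < u only; the increment over a point is null. *)
move=> s0; rewrite le_eqVlt => /predU1P[-> _|su uT].
  rewrite /nsq (eq_integral (fun=> 0%E)) ?integral0 ?subrr//.
  by move=> x _; rewrite /incr subrr expr0n.
have mi : measurable_fun setT (incr s u).
  by apply: measurable_incr; rewrite ?s0 ?uT ?(le_trans _ uT) ?(le_trans s0) ?ltW.
have us0 : 0 < u - s by rewrite subr_gt0.
have <- : (Num.sqrt (u - s)) ^+ 2 = u - s by rewrite sqr_sqrtr// ltW.
rewrite -normal_prob_sqr ?sqrtr_gt0//.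
transitivity (\int[pushforward P (incr s u : Om -> measurableTypeR R)]_x (x ^+ 2)%:E)%E.
  rewrite ge0_integral_pushforward//.
  - exact/measurable_EFinP/measurable_funX.
  - by move=> x _; rewrite lee_fin sqr_ge0.
by apply: eq_measure_integral => B mB _; exact: incr_law.
Qed.

Lemma sqint_incr s u : 0 <= s -> s <= u -> u <= T -> sqint P (incr s u).
Proof.
move=> s0 su uT; split; last by rewrite nsq_incr// ltry.
by apply: measurable_incr; rewrite ?s0 ?uT ?(le_trans _ uT) ?(le_trans s0).
Qed.

Lemma mean_incr s u : 0 <= s -> s <= u -> u <= T -> (\int[P]_w (incr s u w)%:E = 0)%E.
Proof.
move=> s0; rewrite le_eqVlt => /predU1P[-> _|su uT].
  rewrite (eq_integral (fun=> 0%E)) ?integral0//.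
  by move=> x _; rewrite /incr subrr.
have us0 : 0 < u - s by rewrite subr_gt0.
have [mi i2] := sqint_incr s0 (ltW su) uT.
rewrite -(@normal_prob_mean _ (Num.sqrt (u - s))) ?sqrtr_gt0//.
transitivity (\int[pushforward P (incr s u : Om -> measurableTypeR R)]_x x%:E)%E.
  rewrite integral_pushforward//; last first.
  have s1 : sqint P (fun=> 1).
    by apply: (@sqint_bounded _ _ _ P _ 1) => // w; rewrite normr1.
  have := integrable_ip (conj mi i2) s1.
  by under eq_fun do rewrite mulr1.
by apply: eq_measure_integral => B mB _; exact: incr_law.
Qed.

End Filtration.

Section MoreSquareIntegrable.
Context {d : measure_display} {T : measurableType d} {R : realType}.
Variable mu : {measure set T -> \bar R}.

Lemma sqint_Mbounded (f xi : T -> R) M : measurable_fun setT xi ->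
  (forall w, `|xi w| <= M) -> sqint mu f -> sqint mu (fun w => xi w * f w).
Proof.
move=> mxi xiM [mf f2]; split; first exact: measurable_funM.
have M2 : 0 <= M ^+ 2 by exact: sqr_ge0.
apply: (@le_lt_trans _ _ ((M ^+ 2)%:E * nsq mu f + 0%:E * nsq mu f)%E).
  apply: nsq_le_comb => // w; rewrite mul0r addr0 exprMn ler_wpM2r ?sqr_ge0//.
  by rewrite -real_normK ?num_real// ler_sqr ?nnegrE// (le_trans _ (xiM w)).
by rewrite mul0e adde0; apply: lte_mul_pinfty => //; rewrite lee_fin.
Qed.

End MoreSquareIntegrable.

Section Increments.
Context {R : realType} {d : measure_display} {Om : measurableType d}.
Variables (P : probability Om R) (W : Om -> R -> R) (T : R).
Hypotheses (brW : is_brownian P W T) (cP : measure_is_complete P).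

Implicit Types (c u M : R) (eta zeta xi theta : Om -> R).

Let incr_indep c u theta (h : R -> R) (A B : set R) : 0 <= c -> c < u -> u <= T ->
  adapted_to P W c theta -> measurable_fun setT h -> measurable A -> measurable B ->
  P (theta @^-1` A `&` (h \o incr W c u) @^-1` B) =
  (P (theta @^-1` A) * P ((h \o incr W c u) @^-1` B))%E.
Proof.
move=> c0 cu uT ath mh mA mB.
have mhB : measurable (h @^-1` B) by rewrite -[X in measurable X]setTI; exact: mh.
have fT : brownian_filtration P W c setT.
  by have := @adapted_to_cst _ _ _ P W c 0 setT measurableT; rewrite /= setTI.
have E := increment_indep brW cP c0 cu uT fT mhB.
have := increment_indep brW cP c0 cu uT _ mhB => /(_ (theta @^-1` A)) ->.
  by congr (_ * _)%E; rewrite -[LHS]mul1e -(probability_setT P) -E setTI.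
by rewrite -[X in brownian_filtration _ _ _ X]setTI; exact: ath.
Qed.

Lemma sqint_adaptedM c u eta M : 0 <= c -> c <= u -> u <= T ->
  measurable_fun setT eta -> (forall w, `|eta w| <= M) ->
  sqint P (fun w => eta w * incr W c u w).
Proof.
move=> c0 cu uT meta etaM; apply: (sqint_Mbounded meta etaM).
exact: (sqint_incr brW cP).
Qed.

(** The product [eta * zeta] is F_c-measurable, hence independent of the increment after c, which is
    centred. The bound on [eta] keeps the products square-integrable. *)
Lemma ip_adapted_incr c u zeta eta M : 0 <= c -> c <= u -> u <= T ->
  adapted_to P W c zeta -> sqint P zeta ->
  adapted_to P W c eta -> (forall w, `|eta w| <= M) ->
  ip P zeta (fun w => eta w * incr W c u w) = 0.
Proof.
move=> c0; rewrite le_eqVlt => /predU1P[<- _ *|cu uT az sz ae eM].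
  rewrite /ip (_ : (fun _ => _) = cst 0) ?Rintegral_cst ?mul0r//.
  by apply/funext => w; rewrite /incr subrr !mulr0.
have cT : 0 <= c <= T by rewrite c0 (le_trans (ltW cu)).
have me := adapted_to_measurable brW cP cT ae.
have si := sqint_incr brW cP c0 (ltW cu) uT.
have st : sqint P (fun w => eta w * zeta w) by exact: sqint_Mbounded eM sz.
have s1 : sqint P (fun=> 1) by apply: (@sqint_bounded _ _ _ P _ 1) => // w; rewrite normr1.
transitivity (Rintegral P setT (fun w => (eta w * zeta w) * incr W c u w)).
  by congr Rintegral; apply/funext => w; ring.
rewrite Rintegral_indepM.
- by rewrite [X in _ * X]/Rintegral (mean_incr brW cP c0 (ltW cu) uT) mulr0.
- by case: st.
- by case: si.
- move=> A B mA mB; apply: (@incr_indep _ _ _ id) => //.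
  exact: adapted_toM.
- by have := integrable_ip st s1; under eq_fun do rewrite mulr1.
- by have := integrable_ip si s1; under eq_fun do rewrite mulr1.
- exact: integrable_ip.
Qed.

(** Independence again, now between [xi * eta] and the squared increment, whose mean is u - c. *)
Lemma ip_incr_sqr c u xi eta M M' : 0 <= c -> c <= u -> u <= T ->
  adapted_to P W c xi -> (forall w, `|xi w| <= M') ->
  adapted_to P W c eta -> (forall w, `|eta w| <= M) ->
  ip P (fun w => xi w * incr W c u w) (fun w => eta w * incr W c u w) =
  ip P xi eta * (u - c).
Proof.
move=> c0; rewrite le_eqVlt => /predU1P[<- _ *|cu uT ax xM ae eM].
  rewrite subrr mulr0 /ip (_ : (fun _ => _) = cst 0) ?Rintegral_cst ?mul0r//.
  by apply/funext => w; rewrite /incr subrr !mulr0.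
have cT : 0 <= c <= T by rewrite c0 (le_trans (ltW cu)).
have me := adapted_to_measurable brW cP cT ae.
have mx := adapted_to_measurable brW cP cT ax.
have si := sqint_incr brW cP c0 (ltW cu) uT.
have sx := @sqint_bounded _ _ _ P _ _ mx xM; have se := @sqint_bounded _ _ _ P _ _ me eM.
transitivity (Rintegral P setT (fun w => (xi w * eta w) * (incr W c u w) ^+ 2)).
  by congr Rintegral; apply/funext => w; ring.
rewrite Rintegral_indepM.
- congr (_ * _); have := nsq_incr brW cP c0 (ltW cu) uT.
  by rewrite /nsq /Rintegral => ->.
- exact: measurable_funM.
- by case: si => mi _; exact: measurable_funX.
- move=> A B mA mB; apply: (@incr_indep _ _ _ (fun x => x ^+ 2)) => //.
  exact: adapted_toM.
- exact: integrable_ip.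
- exact: (integrable_ip si si).
- have := integrable_ip (sqint_Mbounded mx xM si) (sqint_Mbounded me eM si).
  by apply: eq_integrable => // w _; congr EFin; ring.
Qed.

End Increments.

(** * Ito's isometry for elementary integrands *)

Section Atoms.
Context {R : realType} {d : measure_display} {Om : measurableType d}.
Variables (P : probability Om R) (W : Om -> R -> R) (T : R).
Hypotheses (brW : is_brownian P W T) (cP : measure_is_complete P).
Local Notation lam := (@lebesgue_measure R).
Local Notation PL := (P \x lam)%E.
Implicit Types (a b c s u M : R) (eta zeta xi theta : Om -> R).

Definition atom a b xi (p : Om * measurableTypeR R) : R :=
  xi p.1 * (a < p.2 <= b)%R%:R.

Let indE a b (r : R) : (a < r <= b)%R%:R = \1_(`]a, b]%classic) r :> R.
Proof. by rewrite indicE mem_setE in_itv. Qed.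

Lemma measurable_atom a b xi : measurable_fun setT xi -> measurable_fun setT (atom a b xi).
Proof.
move=> mxi; apply: measurable_funM; first exact: (measurableT_comp mxi).
have -> : (fun p : Om * measurableTypeR R => (a < p.2 <= b)%R%:R : R) = \1_(`]a, b]%classic) \o snd.
  by apply/funext => p; rewrite indE.
by apply: measurableT_comp => //; exact: measurable_indic.
Qed.

Let integral_ind a b (k : R) : a <= b ->
  (\int[lam]_r (k * (a < r <= b)%R%:R)%:E = (k * (b - a))%:E)%E.
Proof.
move=> ab; transitivity (\int[lam]_(r in `]a, b]) k%:E)%E.
  rewrite [RHS]integral_mkcond; apply: eq_integral => r _.
  rewrite patchE mem_setE in_itv/=; case: ifP; rewrite ?mulr1 ?mulr0//.
rewrite integral_cst// [X in (_ * X)%E](_ : _ = (b - a)%:E) ?EFinM//.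
rewrite [LHS]lebesgue_measure_itv/= lte_fin.
by move: ab; rewrite le_eqVlt => /predU1P[->|->//]; rewrite ltxx subrr.
Qed.

Lemma sqint_atom a b xi M : a <= b -> measurable_fun setT xi ->
  (forall w, `|xi w| <= M) -> sqint PL (atom a b xi).
Proof.
move=> ab mxi xiM; split; first exact: measurable_atom.
rewrite /nsq fubini_tonelli1; first last.
- by move=> p; rewrite lee_fin sqr_ge0.
- by apply: measurable_sqr_EFin; exact: measurable_atom.
apply: (@le_lt_trans _ _ (\int[P]_w (M ^+ 2 * (b - a))%:E)%E); last first.
  by rewrite integral_probability_cst ltry.
apply: le_lower_integral => w.
  by apply: integral_ge0 => r _; rewrite lee_fin sqr_ge0.
rewrite /fubini_F -integral_ind//; apply: le_lower_integral => r.
  by rewrite lee_fin sqr_ge0.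
rewrite lee_fin /atom /= exprMn.
have -> : ((a < r <= b)%R%:R : R) ^+ 2 = (a < r <= b)%R%:R.
  by case: (_ && _); rewrite ?expr1n ?expr0n.
rewrite ler_wpM2r//.
by rewrite -real_normK ?num_real// ler_sqr ?nnegrE// (le_trans _ (xiM w)).
Qed.

(** ]k, l] is the intersection of the two time intervals; an empty intersection is passed with k =
    l. *)
Let ip_atom_fubini a b c e xi eta M M' k l : a <= b -> c <= e -> k <= l ->
  measurable_fun setT xi -> (forall w, `|xi w| <= M) ->
  measurable_fun setT eta -> (forall w, `|eta w| <= M') ->
  (forall r, (a < r <= b) && (c < r <= e) = (k < r <= l)) ->
  ip PL (atom a b xi) (atom c e eta) = ip P xi eta * (l - k).
Proof.
move=> ab ce kl mx xM me eM H.
have sx := sqint_atom ab mx xM; have se := sqint_atom ce me eM.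
have sx' := @sqint_bounded _ _ _ P _ _ mx xM.
have se' := @sqint_bounded _ _ _ P _ _ me eM.
rewrite /ip /Rintegral -integral12_prod_meas1; last exact: integrable_ip.
rewrite -[RHS]/(fine _ * fine (l - k)%:E) -fineM//; last first.
  exact: integrable_fin_num (integrable_ip sx' se').
rewrite muleC -integralZl//; last exact: integrable_ip.
congr fine; apply: eq_integral => w _; rewrite /fubini_F/=.
rewrite -EFinM mulrC -integral_ind//; apply: eq_integral => r _.
rewrite /atom /= -H; congr EFin.
by case: (_ && _); case: (_ && _); rewrite /= ?mulr0 ?mulr1 ?mul0r.
Qed.

(** If b <= c, the first integral is F_c-measurable, hence orthogonal to the second, and the product
    of the integrands is null. Otherwise let m = min(b, e). Cut ]a, b] at c and m, and ]c, e] at m: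
    pieces over disjoint intervals are orthogonal by [ip_adapted_incr], and the common piece ]c, m]
    is left. *)
Let ip_atom_le a b c e xi eta M M' : 0 <= a -> a <= b -> b <= T ->
  a <= c -> c <= e -> e <= T ->
  adapted_to P W a xi -> (forall w, `|xi w| <= M) ->
  adapted_to P W c eta -> (forall w, `|eta w| <= M') ->
  ip P (fun w => xi w * incr W a b w) (fun w => eta w * incr W c e w) =
  ip PL (atom a b xi) (atom c e eta).
Proof.
move=> a0 ab bT ac ce eT ax xM ae eM.
have c0 : 0 <= c := le_trans a0 ac.
have aT : 0 <= a <= T by rewrite a0 (le_trans ab).
have cT : 0 <= c <= T by rewrite c0 (le_trans ce).
have mx := adapted_to_measurable brW cP aT ax.
have me := adapted_to_measurable brW cP cT ae.
have axc := adapted_toS ac ax.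
have sxi p q (p0 : 0 <= p) (pq : p <= q) (qT : q <= T) := sqint_adaptedM brW cP p0 pq qT mx xM.
have sei p q (p0 : 0 <= p) (pq : p <= q) (qT : q <= T) := sqint_adaptedM brW cP p0 pq qT me eM.
have am p q : 0 <= p -> p <= q -> adapted_to P W q (incr W p q).
  move=> p0 pq; apply: adapted_toB; apply: adapted_to_W => //; exact: le_trans pq.
have [bc|cb] := leP b c.
  rewrite (ip_adapted_incr brW cP c0 ce eT _ (sxi _ _ a0 ab bT) ae eM).
    rewrite (@ip_atom_fubini _ _ _ _ _ _ _ _ c c ab ce (lexx c) mx xM me eM) ?subrr ?mulr0//.
    by move=> r; apply/idP/idP; lra.
  apply: adapted_toM => //; exact: (adapted_toS bc (am _ _ a0 ab)).
have m0 : c <= Num.min b e by rewrite le_min (ltW cb).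
have mb : Num.min b e <= b by rewrite ge_min lexx.
have me' : Num.min b e <= e by rewrite ge_min lexx orbT.
have mT : Num.min b e <= T by exact: le_trans bT.
have m00 : 0 <= Num.min b e by exact: le_trans m0.
rewrite (@ip_atom_fubini _ _ _ _ _ _ _ _ c (Num.min b e) ab ce m0 mx xM me eM); last first.
  move=> r; rewrite le_min; apply/idP/idP; lra.
rewrite -(ip_incr_sqr brW cP c0 m0 mT axc xM ae eM).
set m := Num.min b e.
have -> : (fun w => xi w * incr W a b w) =
  (fun w => xi w * incr W a c w + (xi w * incr W c m w + xi w * incr W m b w)).
  by apply/funext => w; rewrite /incr; ring.
have s1 := sxi _ _ a0 ac (le_trans ce eT).
have s2 := sxi _ _ c0 m0 mT.
have s3 := sxi _ _ m00 mb bT.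
have e1 := sei _ _ c0 ce eT.
have e2 := sei _ _ c0 m0 mT.
have e3 := sei _ _ m00 me' eT.
rewrite (ipDl s1 (sqintD s2 s3) e1) (ipDl s2 s3 e1).
rewrite (ip_adapted_incr brW cP c0 ce eT _ s1 ae eM) ?add0r; last first.
  by apply: adapted_toM => //; exact: am.
have -> : (fun w => eta w * incr W c e w) =
  (fun w => eta w * incr W c m w + eta w * incr W m e w).
  by apply/funext => w; rewrite /incr; ring.
rewrite !(ipDr e2 e3)//.
rewrite (ip_adapted_incr brW cP m00 me' eT _ s2 (adapted_toS m0 ae) eM) ?addr0; last first.
  by apply: adapted_toM; [exact: adapted_toS axc|exact: am].
rewrite (ipC P (fun w => xi w * incr W m b w) (fun w => eta w * incr W c m w)).
rewrite (ip_adapted_incr brW cP m00 mb bT _ e2 (adapted_toS m0 axc) xM); last first.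
  by apply: adapted_toM; [exact: adapted_toS ae|exact: am].
(* One of the last pieces ]m, b] and ]m, e] is empty, because m is b or e. *)
rewrite add0r /m; have [be|eb] := leP b e.
  rewrite [X in _ + X](_ : _ = 0) ?addr0// /ip (_ : (fun _ => _) = cst 0) ?Rintegral_cst ?mul0r//.
  by apply/funext => w; rewrite /incr subrr mulr0 mul0r.
rewrite [X in _ + X](_ : _ = 0) ?addr0// /ip (_ : (fun _ => _) = cst 0) ?Rintegral_cst ?mul0r//.
by apply/funext => w; rewrite /incr subrr !mulr0.
Qed.

Lemma ip_atom a b c e xi eta M M' : 0 <= a -> a <= b -> b <= T ->
  0 <= c -> c <= e -> e <= T ->
  adapted_to P W a xi -> (forall w, `|xi w| <= M) ->
  adapted_to P W c eta -> (forall w, `|eta w| <= M') ->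
  ip P (fun w => xi w * incr W a b w) (fun w => eta w * incr W c e w) =
  ip PL (atom a b xi) (atom c e eta).
Proof.
move=> a0 ab bT c0 ce eT ax xM ae eM.
have [ac|/ltW ca] := leP a c; first exact: ip_atom_le xM _ eM.
by rewrite ipC [RHS]ipC; exact: ip_atom_le eM _ xM.
Qed.

End Atoms.

Section Elementary.
Context {R : realType} {d : measure_display} {Om : measurableType d}.
Variables (P : probability Om R) (W : Om -> R -> R) (T : R).
Hypotheses (brW : is_brownian P W T) (cP : measure_is_complete P).
Local Notation lam := (@lebesgue_measure R).
Local Notation PL := (P \x lam)%E.
Variable t : R.
Hypothesis tT : 0 <= t <= T.

(* [elementary S I]: the step process S has stochastic integral I from t. *)
Inductive elementary :
    (Om * measurableTypeR R -> R) -> (Om -> R -> R) -> Prop :=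
| elementary0 : elementary (fun=> 0) (fun _ _ => 0)
| elementaryD a b xi M S I : t <= a -> a <= b -> b <= T ->
    adapted_to P W a xi -> (forall w, `|xi w| <= M) -> elementary S I ->
    elementary (fun p => atom a b xi p + S p)
      (fun w s => xi w * incr W (Num.min s a) (Num.min s b) w + I w s).

Let t0 : 0 <= t. Proof. by case/andP: tT. Qed.

(** The atoms of both processes are put together; their time intervals may overlap, so no common
    grid is formed. *)
Lemma elementary_lincomb c S I S' I' : elementary S I -> elementary S' I' ->
  elementary (fun p => c * S p + S' p) (fun w s => c * I w s + I' w s).
Proof.
move=> + e'; elim=> [|a b xi M {}S {}I ta ab bT axi xiM _ IH].
  have -> : (fun p => c * 0 + S' p) = S' by apply/funext => p; ring.
  have -> // : (fun w s => c * 0 + I' w s) = I'.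
  by apply/funext => w; apply/funext => s; ring.
have cM w : `|c * xi w| <= `|c| * M by rewrite normrM ler_wpM2l.
have ac : adapted_to P W a (fun w => c * xi w).
  by apply: adapted_toM => //; exact: adapted_to_cst.
have := elementaryD ta ab bT ac cM IH.
rewrite (_ : (fun p => _) = (fun p => c * (atom a b xi p + S p) + S' p)).
  rewrite (_ : (fun w s => _) = (fun w s => c * (xi w *
    incr W (Num.min s a) (Num.min s b) w + I w s) + I' w s)) //.
  by apply/funext => w; apply/funext => s; ring.
by apply/funext => p; rewrite /atom; ring.
Qed.

Lemma elementary_sqint_integrand S I : elementary S I -> sqint PL S.
Proof.
elim=> [|a b xi M {}S {}I ta ab bT axi xiM _ IH]; first exact: sqint0.
apply: sqintD => //; apply: sqint_atom xiM => //.
have aT : 0 <= a <= T by rewrite (le_trans t0 ta) (le_trans ab).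
exact: (adapted_to_measurable brW cP aT axi).
Qed.

Lemma elementary_sqint_integral S I s : t <= s <= T -> elementary S I ->
  sqint P (I ^~ s).
Proof.
move=> /andP[ts sT]; elim=> [|a b xi M {}S {}I ta ab bT axi xiM _ IH].
  exact: sqint0.
apply: sqintD => //.
have aT : 0 <= a <= T by rewrite (le_trans t0 ta) (le_trans ab).
have a0 := le_trans t0 ta; have s0 := le_trans t0 ts.
apply: (sqint_adaptedM brW cP _ _ _ _ xiM).
- by rewrite le_min s0.
- by rewrite le_min !ge_min lexx ab orbT.
- by rewrite ge_min sT.
- exact: (adapted_to_measurable brW cP aT axi).
Qed.

Lemma elementary_start S I : elementary S I -> forall w, I w t = 0.
Proof.
elim=> [|a b xi M {}S {}I ta ab bT axi xiM _ IH] w //.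
by rewrite IH !min_l ?(le_trans ta)// /incr subrr mulr0 addr0.
Qed.

Lemma elementary_end a b : a <= b -> b <= T -> Num.min T a = a /\ Num.min T b = b.
Proof. by move=> ab bT; rewrite !min_r// (le_trans ab). Qed.

(** Both sides are bilinear, and induction on the atoms of each argument reduces them to [ip_atom].
    The polarized form is what makes the double induction possible. *)
Lemma elementary_isometry S I S' I' : elementary S I -> elementary S' I' ->
  ip P (I ^~ T) (I' ^~ T) = ip PL S S'.
Proof.
have TT : t <= T <= T by case/andP: tT => _ ->; rewrite lexx.
have z0 dd (U : measurableType dd) (mu : {measure set U -> \bar R}) (f : U -> R) :
    ip mu (fun=> 0) f = 0.
  rewrite /ip (_ : (fun _ => _) = cst 0) ?Rintegral_cst ?mul0r//.
  by apply/funext => w; rewrite mul0r.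
move=> + e'; elim=> [|a b xi M {}S {}I ta ab bT axi xiM e IH]; first by rewrite !z0.
have sI := elementary_sqint_integral TT e; have sI' := elementary_sqint_integral TT e'.
have sS := elementary_sqint_integrand e; have sS' := elementary_sqint_integrand e'.
have [-> ->] := elementary_end ab bT.
have aT : 0 <= a <= T by rewrite (le_trans t0 ta) (le_trans ab).
have mxi := adapted_to_measurable brW cP aT axi.
have sa := sqint_atom P ab mxi xiM.
have si := sqint_adaptedM brW cP (le_trans t0 ta) ab bT mxi xiM.
rewrite (ipDl si sI sI') (ipDl sa sS sS') IH; congr (_ + _).
move: e' {IH sI' sS'}.
elim=> [|c k eta M' {}S' {}I' tc ck kT aeta etaM e' IH]; first by rewrite ipC z0 ipC z0.
have sI' := elementary_sqint_integral TT e'.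
have sS' := elementary_sqint_integrand e'.
have [-> ->] := elementary_end ck kT.
have cT : 0 <= c <= T by rewrite (le_trans t0 tc) (le_trans ck).
have meta := adapted_to_measurable brW cP cT aeta.
have sa' := sqint_atom P ck meta etaM.
have si' := sqint_adaptedM brW cP (le_trans t0 tc) ck kT meta etaM.
rewrite (ipDr si' sI' si) (ipDr sa' sS' sa) IH; congr (_ + _).
exact: (ip_atom brW cP (le_trans t0 ta) ab bT (le_trans t0 tc) ck kT axi xiM aeta etaM).
Qed.

Lemma elementary_orthogonal S I s u zeta : t <= s -> s <= u -> u <= T ->
  adapted_to P W s zeta -> sqint P zeta -> elementary S I ->
  ip P zeta (fun w => I w u - I w s) = 0.
Proof.
move=> ts su uT az sz.
have z0 : ip P zeta (fun=> 0) = 0.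
  rewrite /ip (_ : (fun _ => _) = cst 0) ?Rintegral_cst ?mul0r//.
  by apply/funext => w; rewrite mulr0.
elim=> [|a b xi M {}S {}I ta ab bT axi xiM e IH].
  by rewrite -[RHS]z0; congr ip; apply/funext => w; rewrite subrr.
(* [x] and [y] are the projections of a and b on [s, u]: between the times s and u, the atom
   contributes [xi] times the increment of W from [x] to [y]. *)
set x := Num.max s (Num.min u a); set y := Num.max s (Num.min u b).
have -> : (fun w => xi w * incr W (Num.min u a) (Num.min u b) w + I w u -
    (xi w * incr W (Num.min s a) (Num.min s b) w + I w s)) =
    (fun w => xi w * incr W x y w + (I w u - I w s)).
  apply/funext => w; have H v : W w (Num.min u v) - W w (Num.min s v) =
      W w (Num.max s (Num.min u v)) - W w s.
    have [sv|vs] := leP s v.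
      by rewrite max_r// le_min su.
    by rewrite min_r ?(le_trans (ltW vs))// max_l ?subrr// ltW.
  have -> : incr W x y w = incr W (Num.min u a) (Num.min u b) w
      - incr W (Num.min s a) (Num.min s b) w.
    by have Ha := H a; have Hb := H b; rewrite /incr /x /y; lra.
  ring.
have s0 := le_trans t0 ts; have a0 := le_trans t0 ta.
have x0 : 0 <= x by rewrite le_max s0.
have xy : x <= y.
  rewrite /x /y ge_max le_max lexx/= le_max ge_min.
  by rewrite le_min ge_min lexx/= ge_min ab !orbT.
have yT : y <= T by rewrite ge_max (le_trans su)// ge_min uT.
have aT : 0 <= a <= T by rewrite a0 (le_trans ab).
have mxi := adapted_to_measurable brW cP aT axi.
have si := sqint_adaptedM brW cP x0 xy yT mxi xiM.
have uu : t <= u <= T by rewrite uT (le_trans ts).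
have ss : t <= s <= T by rewrite ts (le_trans su).
have sI := sqintB (elementary_sqint_integral uu e) (elementary_sqint_integral ss e).
rewrite (ipDr si sI sz) IH addr0.
(* If u <= a then x = y and the increment is null; otherwise x >= a and x >= s, so that [xi] and
   [zeta] are both F_x-measurable. *)
have [ua|au] := leP u a.
  rewrite -[RHS]z0; congr ip; apply/funext => w.
  by rewrite /x /y !min_l ?(le_trans ua)// /incr subrr mulr0.
have sx : s <= x by rewrite le_max lexx.
have ax : a <= x by rewrite le_max le_min lexx (ltW au) orbT.
apply: (ip_adapted_incr brW cP x0 xy yT _ sz _ xiM).
  exact: adapted_toS az.
exact: adapted_toS axi.
Qed.

End Elementary.

Section Predictable.
Context {R : realType} {d : measure_display} {Om : measurableType d}.
Variables (P : probability Om R) (W : Om -> R -> R) (T : R).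
Hypotheses (brW : is_brownian P W T) (cP : measure_is_complete P).
Variable t : R.
Hypothesis tT : 0 <= t <= T.

Let t0 : 0 <= t. Proof. by case/andP: tT. Qed.

Definition slab : set (Om * measurableTypeR R) := setT `*` `[t, T]%classic.

Lemma measurable_slab : measurable slab.
Proof. exact: measurableX. Qed.

Lemma predictable_measurable eta : predictable P W t T eta ->
  measurable_fun slab (fun p => eta p.1 p.2).
Proof.
move=> peta _ B mB; have := peta B mB; apply: smallest_sub => /=.
  split; first exact: measurable0.
  - by move=> A mA; apply: measurableD => //; exact: measurable_slab.
  - by move=> F mF; exact: bigcupT_measurable.
move=> E [[A FA <-]|[s [u [A [ts uT FA ->]]]]].
  apply: measurableX => //; exact: (brownian_filtration_measurable brW cP tT FA).
have [su|us] := ltP s u; last first.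
  by rewrite set_itv_ge ?setX0//; rewrite bnd_simp -leNgt.
apply: measurableX => //.
apply: (brownian_filtration_measurable brW cP _ FA).
by rewrite (le_trans t0 ts) (le_trans (ltW su)).
Qed.

(** A generator A x {t} has section A at time t, and a generator A x ]s, u] has an empty one since s
    >= t. Applied to Y, this makes Y(t) orthogonal to M(T) - M(t) in the backward estimates. *)
Lemma predictable_start eta : predictable P W t T eta -> adapted_to P W t (eta ^~ t).
Proof.
move=> peta B mB; have := peta B mB.
have [n0 nC nU] := smallest_sigma_algebra setT (natural_filtration W t `|` P.-negligible).
pose G (E : set (Om * R)) := brownian_filtration P W t [set w | E (w, t)].
have : G ((setT `*` `[t, T]) `&` (fun p => eta p.1 p.2) @^-1` B) ->
    events (filtration_space P W t) (points (filtration_space P W t) `&` eta^~ t @^-1` B).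
  rewrite /G /=; congr (brownian_filtration P W t _); apply/seteqP; split => w /=.
    by case=> _ ?.
  by case=> _ ?; do 2 split => //=; rewrite in_itv/= lexx; case/andP: tT.
move=> + h; apply; move: h; apply: smallest_sub => /=.
  split.
  - exact: n0.
  - move=> A GA; rewrite /G.
    rewrite (_ : [set w | _] = setT `\` [set w | A (w, t)]); first exact: nC.
    apply/seteqP; split => w /=; first by case.
    by case=> _ ?; split => //; split => //=; rewrite in_itv/= lexx; case/andP: tT.
  - move=> F GF; rewrite /G.
    rewrite (_ : [set w | _] = \bigcup_k [set w | F k (w, t)]); first exact: nU.
    by apply/seteqP; split => w /= [k _ ?]; exists k.
move=> E [[A FA <-]|[s [u [A [ts uT FA ->]]]]]; rewrite /G.
  rewrite (_ : [set w | _] = A)//; apply/seteqP; split => w /=; first by case.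
  by move=> ?; split.
rewrite (_ : [set w | _] = set0)//; apply/seteqP; split => w //= [_].
by rewrite in_itv/= ltNge ts.
Qed.

Lemma slab_section_measurable (f : Om * measurableTypeR R -> R) s : t <= s <= T ->
  measurable_fun slab f -> measurable_fun setT (fun w => f (w, s)).
Proof.
move=> sT mf; apply: (@measurable_comp _ _ _ _ _ _ slab f setT (fun w => (w, s))) => //.
- exact: measurable_slab.
- by move=> _ [w _ <-]; split => //=; rewrite in_itv.
Qed.

End Predictable.

(** * Square-mean limits of elementary integrals *)

Section ItoPair.
Context {R : realType} {d : measure_display} {Om : measurableType d}.
Variables (P : probability Om R) (W : Om -> R -> R) (T : R).
Hypotheses (brW : is_brownian P W T) (cP : measure_is_complete P).
Local Notation lam := (@lebesgue_measure R).
Local Notation PL := (P \x lam)%E.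
Variable t : R.
Hypothesis tT : 0 <= t <= T.

Let t0 : 0 <= t. Proof. by case/andP: tT. Qed.

(** The square-mean content of [is_ito_integral]. The integrand is measurable on the whole product
    space and elementary processes replace simple ones, so that the class is stable under linear
    combinations. *)
Definition ito_pair (H : Om * measurableTypeR R -> R) (J : Om -> R -> R) :=
  [/\ measurable_fun setT H,
      forall s, t <= s <= T -> adapted_to P W s (J ^~ s) &
      exists S I, [/\ forall n, elementary P W T t (S n) (I n),
        (fun n => nsq PL (fun p => S n p - H p)) @ \oo --> 0%E &
        forall s, t <= s <= T ->
          (fun n => nsq P (fun w => I n w s - J w s)) @ \oo --> 0%E]].

Let measurable_J (J : Om -> R -> R) s : t <= s <= T -> adapted_to P W s (J ^~ s) ->
  measurable_fun setT (J ^~ s).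
Proof.
move=> /andP[ts sT] aJ; have sT0 : 0 <= s <= T by rewrite (le_trans t0).
exact: (adapted_to_measurable brW cP sT0 aJ).
Qed.

Lemma ito_sqint_integrand H J : ito_pair H J -> sqint PL H.
Proof.
move=> [mH _ [S [I [e cS _]]]]; apply: (sqint_lim _ mH cS) => n.
exact: (elementary_sqint_integrand brW cP tT (e n)).
Qed.

Lemma ito_sqint_integral H J s : t <= s <= T -> ito_pair H J -> sqint P (J ^~ s).
Proof.
move=> sT [_ aJ [S [I [e _ cI]]]].
apply: (sqint_lim _ (measurable_J sT (aJ s sT)) (cI s sT)) => n.
exact: (elementary_sqint_integral brW cP tT sT (e n)).
Qed.

Lemma ito_isometry H J : ito_pair H J -> nsq P (J ^~ T) = nsq PL H.
Proof.
move=> ij; have TT : t <= T <= T by case/andP: tT => _ ->; rewrite lexx.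
have sJ := ito_sqint_integral TT ij; have sH := ito_sqint_integrand ij.
rewrite -!ip_self//; congr EFin.
have [mH aJ [S [I [e cS cI]]]] := ij.
have sS n := elementary_sqint_integrand brW cP tT (e n).
have sI n := elementary_sqint_integral brW cP tT TT (e n).
have cJ := cvg_ip_self sI (measurable_J TT (aJ T TT)) (cI T TT).
rewrite -(cvg_lim (@Rhausdorff R) cJ); apply: (cvg_lim (@Rhausdorff R)).
have cH := cvg_ip_self sS mH cS.
rewrite (_ : (fun n => _) = (fun n => ip PL (S n) (S n))) //.
by apply/funext => n; exact: (elementary_isometry brW cP tT (e n) (e n)).
Qed.

Lemma ito_start H J : ito_pair H J -> nsq P (J ^~ t) = 0%E.
Proof.
move=> ij; have TT : t <= t <= T by case/andP: tT => _ ->; rewrite lexx.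
have sJ := ito_sqint_integral TT ij.
rewrite -!ip_self//; congr EFin.
have [mH aJ [S [I [e cS cI]]]] := ij.
have sI n := elementary_sqint_integral brW cP tT TT (e n).
have cJ := cvg_ip_self sI (measurable_J TT (aJ t TT)) (cI t TT).
rewrite -(cvg_lim (@Rhausdorff R) cJ); apply: (cvg_lim (@Rhausdorff R)).
rewrite (_ : (fun n => _) = cst 0); first exact: cvg_cst.
apply/funext => n; rewrite /ip (_ : (fun _ => _) = cst 0) ?Rintegral_cst ?mul0r//.
by apply/funext => w; rewrite (elementary_start (e n)) mul0r.
Qed.

(** The martingale property. It passes from elementary integrals to the limit because inner products
    with the fixed variable [zeta] converge. *)
Lemma ito_orthogonal H J s u zeta : t <= s -> s <= u -> u <= T ->
  adapted_to P W s zeta -> sqint P zeta -> ito_pair H J ->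
  ip P zeta (fun w => J w u - J w s) = 0.
Proof.
move=> ts su uT az sz ij.
have ss : t <= s <= T by rewrite ts (le_trans su).
have uu : t <= u <= T by rewrite uT (le_trans ts).
have sJs := ito_sqint_integral ss ij; have sJu := ito_sqint_integral uu ij.
rewrite (ipBr sJu sJs sz).
have [mH aJ [S [I [e cS cI]]]] := ij.
have sIs n := elementary_sqint_integral brW cP tT ss (e n).
have sIu n := elementary_sqint_integral brW cP tT uu (e n).
have cs := cvg_ip sIs (measurable_J ss (aJ s ss)) (cI s ss) sz.
have cu := cvg_ip sIu (measurable_J uu (aJ u uu)) (cI u uu) sz.
rewrite !(ipC _ zeta).
rewrite -(cvg_lim (@Rhausdorff R) (cvgB cu cs)); apply: (cvg_lim (@Rhausdorff R)).
apply: cvg_near_cst; apply: nearW => n; rewrite !fctE -(ipBl (sIu n) (sIs n) sz) ipC.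
exact: (elementary_orthogonal brW cP tT ts su uT az sz (e n)).
Qed.

Lemma ito_lincomb c H J H' J' : ito_pair H J -> ito_pair H' J' ->
  ito_pair (fun p => c * H p + H' p) (fun w s => c * J w s + J' w s).
Proof.
move=> [mH aJ [S [I [e cS cI]]]] [mH' aJ' [S' [I' [e' cS' cI']]]]; split.
- by apply: measurable_funD => //; exact: measurable_funM.
- move=> s sT; apply: adapted_toD; last exact: aJ'.
  by apply: adapted_toM; [exact: adapted_to_cst|exact: aJ].
(* The squared error of the combination is at most 2 c^2 times the first one plus twice the second;
   this serves for the integrands on the product space and for the integrals at each time. *)
have key dd (U : measurableType dd) (mu : {measure set U -> \bar R}) (f f' : U -> R)
    (g g' : nat -> U -> R) : measurable_fun setT f -> measurable_fun setT f' ->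
    (forall n, measurable_fun setT (g n)) -> (forall n, measurable_fun setT (g' n)) ->
    (fun n => nsq mu (fun x => g n x - f x)) @ \oo --> 0%E ->
    (fun n => nsq mu (fun x => g' n x - f' x)) @ \oo --> 0%E ->
    (fun n => nsq mu (fun x => c * g n x + g' n x - (c * f x + f' x))) @ \oo --> 0%E.
  move=> mf mf' mg mg' cg cg'.
  have h : (fun n => (2 * c ^+ 2)%:E * nsq mu (fun x => (g n x - f x)%R) +
      2%:E * nsq mu (fun x => (g' n x - f' x)%R))%E @ \oo --> 0%E.
    rewrite -[X in _ --> X]adde0 -[X in _ --> (X + _)%E](mule0 (2 * c ^+ 2)%:E).
    rewrite -[X in _ --> (_ + X)%E](mule0 2%:E).
    by apply: cvgeD; [rewrite !mule0|exact: cvgeMl|exact: cvgeMl].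
  apply: (squeeze_cvge _ (cvg_cst 0%E) h); near=> n; rewrite nsq_ge0/=.
  apply: nsq_le_comb => //; try exact: measurable_funB.
    by rewrite mulr_ge0// sqr_ge0.
  move=> x; have := sqr_ge0 (c * (g n x - f x) - (g' n x - f' x)); nra.
exists (fun n p => c * S n p + S' n p), (fun n w s => c * I n w s + I' n w s); split.
- by move=> n; exact: elementary_lincomb.
- apply: key => // n.
    by case: (elementary_sqint_integrand brW cP tT (e n)).
  by case: (elementary_sqint_integrand brW cP tT (e' n)).
- move=> s sT; apply: key.
  + exact: measurable_J (aJ s sT).
  + exact: measurable_J (aJ' s sT).
  + by move=> n; case: (elementary_sqint_integral brW cP tT sT (e n)).
  + by move=> n; case: (elementary_sqint_integral brW cP tT sT (e' n)).
  + exact: cI.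
  + exact: cI'.
Unshelve. all: by end_near. Qed.

End ItoPair.

Section ItoIntegral.
Context {R : realType} {d : measure_display} {Om : measurableType d}.
Variables (P : probability Om R) (W : Om -> R -> R) (T : R).
Hypotheses (brW : is_brownian P W T) (cP : measure_is_complete P).
Local Notation lam := (@lebesgue_measure R).
Local Notation PL := (P \x lam)%E.
Variable t : R.
Hypothesis tT : 0 <= t <= T.

Lemma simple_elementary S : is_simple P W t T S ->
  elementary P W T t (fun p => sp_value S p.1 p.2) (sp_integral W S).
Proof.
move=> [tau0 tauT tauS coefS].
have mono i j : (i <= j)%N -> (j <= sp_size S)%N -> sp_time S i <= sp_time S j.
  move=> ij; elim: j ij => [|j IH]; first by rewrite leqn0 => /eqP ->.
  rewrite leq_eqVlt => /predU1P[->//|ij] jn.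
  by apply: (le_trans (IH ij (ltnW jn))); exact: tauS.
suff H k : (k <= sp_size S)%N -> elementary P W T t
    (fun p => \sum_(i < k) sp_coef S i p.1 * (sp_time S i < p.2 <= sp_time S i.+1)%R%:R)
    (fun w s => \sum_(i < k) sp_coef S i w * (W w (Num.min s (sp_time S i.+1)) -
       W w (Num.min s (sp_time S i)))) by exact: H (leqnn _).
elim: k => [_|k IH kn].
  have := elementary0 P W T t; congr elementary.
    by apply/funext => p; rewrite big_ord0.
  by apply/funext => w; apply/funext => s; rewrite big_ord0.
have [ak [M kM]] := coefS k kn.
have := elementaryD (le_trans tau0 (mono _ _ (leq0n k) (ltnW kn))) (tauS k kn)
  (le_trans (mono _ _ kn (leqnn _)) tauT) ak kM (IH (ltnW kn)).
congr elementary.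
  by apply/funext => p; rewrite big_ord_recr /= addrC.
by apply/funext => w; apply/funext => s; rewrite big_ord_recr /= addrC.
Qed.

Lemma sp_value_outside S w r : is_simple P W t T S -> ~ (t <= r <= T) ->
  sp_value S w r = 0.
Proof.
move=> [tau0 tauT tauS _] ntr.
have mono i j : (i <= j)%N -> (j <= sp_size S)%N -> sp_time S i <= sp_time S j.
  move=> ij; elim: j ij => [|j IH]; first by rewrite leqn0 => /eqP ->.
  rewrite leq_eqVlt => /predU1P[->//|ij] jn.
  by apply: (le_trans (IH ij (ltnW jn))); exact: tauS.
apply: big1 => i _; case: (boolP (sp_time S i < r <= sp_time S i.+1)) => [/andP[ir ri]|_];
  last by rewrite mulr0.
case: ntr; apply/andP; split.
  by apply: (le_trans tau0); apply: (le_trans _ (ltW ir)); apply: mono => //; exact: ltnW.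
by apply: (le_trans ri); apply: (le_trans _ tauT); exact: mono.
Qed.

(** The predictable version of the integrand is extended by 0 outside [t, T]. Simple processes
    vanish there as well, so the distance over all real times is the one over [t, T] of the
    definition. *)
Lemma ito_integral_pair (H J : Om -> R -> R) : is_ito_integral P W t T H J ->
  exists Hm, [/\ ito_pair P W T t Hm J,
    forall p, ~ (t <= p.2 <= T) -> Hm p = 0 &
    {ae PL, forall p : Om * R, t <= p.2 <= T -> H p.1 p.2 = Hm p}].
Proof.
move=> [aJ cJ [H' [pH' HH' [S [sS cS cI]]]]].
have mH' := predictable_measurable brW cP tT pH'.
pose Hm := (fun p : Om * measurableTypeR R => H' p.1 p.2) \_ (slab T t).
have HmE w r : t <= r <= T -> Hm (w, r) = H' w r.
  by move=> tr; rewrite /Hm patchE mem_set//; split => //=; rewrite in_itv.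
have Hm0 p : ~ (t <= p.2 <= T) -> Hm p = 0.
  by move=> tr; rewrite /Hm patchE memNset// => -[_] /=; rewrite in_itv.
exists Hm; split => //; last first.
  by apply: (ae_imply HH') => -[w r] /= h tr; rewrite HmE// h.
have mHm : measurable_fun setT Hm.
  exact: (measurable_restrictT _ (@measurable_slab R d Om T t)).1 mH'.
split => //; exists (fun n p => sp_value (S n) p.1 p.2), (fun n => sp_integral W (S n)).
have eS n := simple_elementary (sS n).
split => //.
suff E n : nsq PL (fun p => sp_value (S n) p.1 p.2 - Hm p) =
    (\int[P]_w \int[lam]_(r in `[t, T]) ((sp_value (S n) w r - H' w r) ^+ 2)%:E)%E.
  by under eq_fun do rewrite E.
rewrite /nsq fubini_tonelli1; first last.
- by move=> p; rewrite lee_fin sqr_ge0.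
- apply: measurable_sqr_EFin; apply: measurable_funB => //.
  by case: (elementary_sqint_integrand brW cP tT (eS n)).
apply: eq_integral => w _; rewrite [RHS]integral_mkcond.
apply: eq_integral => r _ /=; rewrite patchE mem_setE in_itv/=.
case: ifPn => [tr|/negP ntr]; first by rewrite HmE.
by rewrite Hm0// (sp_value_outside _ (sS n) ntr) subrr expr0n.
Qed.

End ItoIntegral.

(** * Doob's inequality *)

Section RunningMaximum.
Context {R : realType}.

Fixpoint runmax (x : nat -> R) n : R :=
  if n is k.+1 then Num.max (runmax x k) `|x n| else `|x 0%N|.

Lemma runmax_ge0 x n : 0 <= runmax x n.
Proof. by case: n => [|n] /=; rewrite ?le_max normr_ge0 ?orbT. Qed.

Lemma le_runmax x n i : (i <= n)%N -> `|x i| <= runmax x n.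
Proof.
elim: n => [|n IH]; first by rewrite leqn0 => /eqP ->.
rewrite leq_eqVlt => /predU1P[->|/IH h] /=; rewrite le_max ?lexx ?orbT//.
by rewrite h.
Qed.

(* A pathwise form of Doob's inequality: the sum is, in mean, nonnegative for a
   martingale. *)
Lemma runmax_sqr_le x n :
  (runmax x n) ^+ 2 <= 4 * (x n) ^+ 2 -
    4 * \sum_(i < n) runmax x i * Num.sg (x i) * (x i.+1 - x i).
Proof.
(* A discrete integration by parts: from n to n + 1 the gap between the two sides grows by 2
   (|x_{n+1}| - m)^2 at a new maximum, m being the previous one, and by 0 otherwise. The lemma
   follows from 4 m |x_n| <= m^2 + 4 x_n^2. *)
have H : 2 * (runmax x n) ^+ 2 + 4 * (\sum_(i < n) runmax x i * (`|x i.+1| - `|x i|)) <=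
    4 * (runmax x n) * `|x n|.
  elim: n => [|n IH]; first by rewrite big_ord0 /= expr2; nra.
  rewrite big_ord_recr /=.
  set m := runmax x n in IH *; set m' := Num.max m _.
  set s := \sum_(i < n) _ in IH *.
  have m0 : 0 <= m by exact: runmax_ge0.
  have := normr_ge0 (x n.+1); have := normr_ge0 (x n).
  rewrite /m'; have [h|h] := leP m `|x n.+1|; last by nra.
  have := sqr_ge0 (`|x n.+1| - m); nra.
have S : \sum_(i < n) runmax x i * Num.sg (x i) * (x i.+1 - x i) <=
    \sum_(i < n) runmax x i * (`|x i.+1| - `|x i|).
  apply: ler_sum => i _; rewrite -mulrA ler_wpM2l ?runmax_ge0//.
  rewrite mulrBr -normrEsg lerD2r.
  rewrite (le_trans (ler_norm _))// normrM ler_piMl// normr_sg.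
  by case: (_ != _); rewrite ?ler01 ?lexx.
have -> : (x n) ^+ 2 = `|x n| ^+ 2 by rewrite real_normK ?num_real.
have := sqr_ge0 (runmax x n - 2 * `|x n|).
nra.
Qed.

Lemma runmax_le x n M : (forall i, (i <= n)%N -> `|x i| <= M) -> runmax x n <= M.
Proof.
elim: n => [|n IH] H /=; first exact: H.
by rewrite ge_max H// IH// => i ni; apply: H; exact: leq_trans ni _.
Qed.

Lemma runmax_attained x n : exists i, runmax x n = `|x i|.
Proof.
elim: n => [|n [i IH]] /=; first by exists 0%N.
by rewrite /Order.max; case: ifP => _; [exists n.+1|exists i].
Qed.

Lemma runmaxS x n : runmax x n <= runmax x n.+1.
Proof. by rewrite /= le_max lexx. Qed.

End RunningMaximum.

(** * Suprema over a dense set of times *)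

Section DenseSupremum.
Context {R : realType} {d : measure_display} {Om : measurableType d}.
Variables (t T : R).
Hypothesis tT : t <= T.
Implicit Types (N : Om -> R -> R).

(** The rationals projected on [t, T]; natural numbers that code no rational give the projection of
    0. *)
Definition dense_time (k : nat) : R :=
  Num.max t (Num.min T (ratr (odflt 0 (unpickle k : option rat)))).

Lemma dense_time_itv k : t <= dense_time k <= T.
Proof. by rewrite le_max lexx /= ge_max tT ge_min lexx. Qed.

Lemma dense_time_near s (e : R) : t <= s <= T -> 0 < e ->
  exists k, `|dense_time k - s| < e.
Proof.
move=> /andP[ts sT] e0.
have [q] : exists q : rat, ratr q \in `]s - e, s + e[.
  by apply: rat_in_itvoo; lra.
rewrite in_itv/= => /andP[q1 q2].
exists (pickle q); rewrite /dense_time pickleK /=.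
rewrite ltr_distl; apply/andP; split.
  by rewrite lt_max lt_min q1 (lt_le_trans _ sT) ?orbT// ltrBlDr ltrDl.
by rewrite gt_max gt_min q2 orbT andbT (le_lt_trans ts)// ltrDl.
Qed.

Definition dense_sup_n N n w : \bar R :=
  ((runmax (fun k => N w (dense_time k)) n) ^+ 2)%:E.

(** A limit of finite maxima, hence measurable in w when each N(s) is; for a continuous path it is
    the supremum of N^2 over [t, T]. The maxima follow the enumeration, not the order of the
    times. *)
Definition dense_sup N w : \bar R := limn (fun n => dense_sup_n N n w).

Let dense_sup_n_nd N w : nondecreasing_seq (fun n => dense_sup_n N n w).
Proof.
apply/nondecreasing_seqP => n; rewrite lee_fin.
by rewrite ler_sqr ?nnegrE ?runmax_ge0// runmaxS.
Qed.

Let dense_sup_cvg N w : cvgn (fun n => dense_sup_n N n w).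
Proof. exact: ereal_nondecreasing_is_cvgn. Qed.

Lemma dense_sup_n_le N n w : (dense_sup_n N n w <= dense_sup N w)%E.
Proof.
apply: lime_ge => //; near=> m; apply: dense_sup_n_nd.
by near: m; exact: nbhs_infty_ge.
Unshelve. all: by end_near. Qed.

Lemma dense_sup_ge0 N w : (0 <= dense_sup N w)%E.
Proof. by apply: le_trans (dense_sup_n_le N 0 w); rewrite lee_fin sqr_ge0. Qed.

Lemma dense_sup_ge N k w : (((N w (dense_time k)) ^+ 2)%:E <= dense_sup N w)%E.
Proof.
apply: le_trans (dense_sup_n_le N k w); rewrite lee_fin -real_normK ?num_real//.
by rewrite ler_sqr ?nnegrE ?runmax_ge0//; exact: (@le_runmax _ (fun k => N w (dense_time k))).
Qed.

Lemma dense_sup_le N w M :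
  (forall k, (((N w (dense_time k)) ^+ 2)%:E <= M)%E) -> (dense_sup N w <= M)%E.
Proof.
move=> H; apply: lime_le => //; apply: nearW => n; rewrite /dense_sup_n.
have [i ->] := runmax_attained (fun k => N w (dense_time k)) n.
by rewrite real_normK ?num_real.
Qed.

Lemma dense_sup_continuous N w s : {within `[t, T], continuous (N w)} ->
  t <= s <= T -> (((N w s) ^+ 2)%:E <= dense_sup N w)%E.
Proof.
move=> cN sT.
have ts : [set` `[t, T]] s by rewrite /= in_itv.
have /subspace_continuousP /(_ s ts) cs := cN.
(* If N^2 exceeded the countable supremum at s, it would do so on a neighbourhood of s in [t, T],
   which contains a dense time. *)
rewrite leNgt; apply/negP => lt.
have [M MS] : exists M, dense_sup N w = M%:E.
  exists (fine (dense_sup N w)); rewrite fineK// ge0_fin_numE ?dense_sup_ge0//.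
  by rewrite (lt_trans lt) ?ltry.
have M0 : 0 <= M by rewrite -lee_fin -MS dense_sup_ge0.
move: lt; rewrite MS lte_fin => lt.
have c2 : (fun r => (N w r) ^+ 2) @ within [set` `[t, T]] (nbhs s) --> (N w s) ^+ 2.
  by apply: cvgM.
have e0 : 0 < (N w s) ^+ 2 - M by rewrite subr_gt0.
move/cvgrPdist_lt : c2 => /(_ _ e0) [e /= ep ball].
have [k ke] := dense_time_near sT ep.
have := ball (dense_time k); rewrite /= distrC => /(_ ke).
have := dense_time_itv k; rewrite in_itv /= => kT /(_ kT).
have := dense_sup_ge N k w; rewrite MS lee_fin => kM.
by rewrite ltr_distl => /andP[_]; lra.
Qed.

Lemma measurable_dense_sup N :
  (forall s, t <= s <= T -> measurable_fun setT (N ^~ s)) ->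
  measurable_fun setT (dense_sup N).
Proof.
move=> mN.
have mr n : measurable_fun setT (fun w => runmax (fun k => N w (dense_time k)) n).
  elim: n => [|n IH] /=.
    by apply: measurableT_comp => //; exact: mN (dense_time_itv 0).
  apply: measurable_maxr => //; apply: measurableT_comp => //.
  exact: mN (dense_time_itv n.+1).
apply: (@emeasurable_fun_cvg _ _ _ _ (fun n w => dense_sup_n N n w)) => [n|w _].
  exact: measurable_sqr_EFin.
exact: dense_sup_cvg.
Qed.

End DenseSupremum.

Section Doob.
Context {R : realType} {d : measure_display} {Om : measurableType d}.
Variables (P : probability Om R) (W : Om -> R -> R) (T : R).
Hypotheses (brW : is_brownian P W T) (cP : measure_is_complete P).
Variable t : R.
Hypothesis tT : 0 <= t <= T.
Variable N : Om -> R -> R.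
Hypothesis aN : forall s, t <= s <= T -> adapted_to P W s (N ^~ s).
Hypothesis sN : forall s, t <= s <= T -> sqint P (N ^~ s).
(** The martingale property, as orthogonality of the increments to the past. *)
Hypothesis oN : forall s u zeta, t <= s -> s <= u -> u <= T ->
  adapted_to P W s zeta -> sqint P zeta -> ip P zeta (fun w => N w u - N w s) = 0.

Section FiniteTimes.
Variable tau : nat -> R.
Hypotheses (tauT : forall i, t <= tau i <= T) (tauS : forall i, tau i <= tau i.+1).

Let m n w := runmax (fun i => N w (tau i)) n.

Let am n : adapted_to P W (tau n) (m n).
Proof.
have ab i : adapted_to P W (tau i) (fun w => `|N w (tau i)|).
  by apply: (@adapted_to_comp _ _ _ _ _ _ _ Num.norm) => //; exact: aN.
elim: n => [|n IH]; first exact: ab.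
apply: adapted_to_max; last exact: ab.
exact: adapted_toS IH.
Qed.

Let tau0T i : 0 <= tau i <= T.
Proof. by have := tauT i; move: tT => /andP[t0 _] /andP[h ->]; rewrite (le_trans t0). Qed.

Let sm n : sqint P (m n).
Proof.
have mm n' : measurable_fun setT (m n').
  exact: (adapted_to_measurable brW cP (tau0T n') (@am n')).
elim: n => [|n [_ IH]]; split => //.
  have [_] := sN (tauT 0); apply: le_lt_trans.
  by apply: le_lower_integral => w; rewrite lee_fin ?sqr_ge0//= real_normK ?num_real.
have [mN N2] := sN (tauT n.+1).
apply: (@le_lt_trans _ _ (1%:E * nsq P (m n) + 1%:E * nsq P (N ^~ (tau n.+1)))%E).
  apply: nsq_le_comb => // w; rewrite !mul1r /m /=.
  rewrite -(@real_normK _ (N w (tau n.+1))) ?num_real//.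
  by rewrite /Order.max; case: ifP => _; rewrite ?lerDr ?lerDl sqr_ge0.
by rewrite !mul1e; apply: lte_add_pinfty.
Qed.

Let xi i w := m i w * Num.sg (N w (tau i)).

Let axi i : adapted_to P W (tau i) (xi i).
Proof.
apply: adapted_toM; first exact: am.
apply: (@adapted_to_comp _ _ _ _ _ _ _ Num.sg); last exact: aN.
rewrite (_ : Num.sg = (fun x : R => (0 < x)%R%:R - (x < 0)%R%:R)).
  apply: measurable_funB.
    rewrite (_ : (fun x : R => _) = \1_(`]0, +oo[%classic)); first exact: measurable_indic.
    by apply/funext => x; rewrite indicE mem_setE in_itv/= andbT.
  rewrite (_ : (fun x : R => _) = \1_(`]-oo, 0[%classic)); first exact: measurable_indic.
  by apply/funext => x; rewrite indicE mem_setE in_itv.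
apply/funext => x; have [h|h|->] := ltgtP x 0; last by rewrite sgr0 subrr.
  by rewrite ltr0_sg// sub0r.
by rewrite gtr0_sg// subr0.
Qed.

Let sxi i : sqint P (xi i).
Proof.
split; first exact: (adapted_to_measurable brW cP (tau0T i) (@axi i)).
have [_] := sm i; apply: le_lt_trans; apply: le_lower_integral => w.
  by rewrite lee_fin sqr_ge0.
rewrite lee_fin /xi exprMn ler_piMr ?sqr_ge0// -real_normK ?num_real// normr_sg.
by case: (_ != _); rewrite ?expr1n ?expr0n.
Qed.

Let L n w := \sum_(i < n) xi i w * (N w (tau i.+1) - N w (tau i)).

(** The sum in [runmax_sqr_le] has mean zero: the weight [xi i] is square-integrable and measurable
    at time [tau i], hence orthogonal to the next increment. *)
Let LP n : P.-integrable setT (EFin \o L n) /\ Rintegral P setT (L n) = 0.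
Proof.
elim: n => [|n [iL RL]].
  have -> : L 0 = cst 0 by apply/funext => w; rewrite /L big_ord0.
  split; last by rewrite Rintegral_cst// mul0r.
  exact: integrable0.
have sd : sqint P (fun w => N w (tau n.+1) - N w (tau n)).
  by apply: sqintB; exact: sN.
have -> : L n.+1 = (fun w => L n w + xi n w * (N w (tau n.+1) - N w (tau n))).
  by apply/funext => w; rewrite /L big_ord_recr.
have ix := integrable_ip (sxi n) sd.
split.
  have := integrableD measurableT iL ix.
  by apply: eq_integrable.
rewrite RintegralD// RL add0r; apply: oN => //.
- by case/andP: (tauT n).
- by case/andP: (tauT n.+1).
Qed.

Lemma doob_finite n : (nsq P (m n) <= 4%:E * nsq P (N ^~ (tau n)))%E.
Proof.
have sNn := sN (tauT n).
rewrite -(ip_self (sm n)) -(ip_self sNn) -EFinM lee_fin.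
have [iL RL] := LP n.
have i4 : P.-integrable setT (EFin \o (fun w => 4 * (N w (tau n) * N w (tau n)))).
  by have := integrableZl measurableT 4 (integrable_ip sNn sNn).
have iL4 : P.-integrable setT (EFin \o (fun w => 4 * L n w)).
  by have := integrableZl measurableT 4 iL.
have -> : 4 * ip P (N ^~ (tau n)) (N ^~ (tau n)) =
    Rintegral P setT (fun w => 4 * (N w (tau n) * N w (tau n)) - 4 * L n w).
  rewrite RintegralB// !RintegralZl ?RL ?mulr0 ?subr0//.
  exact: integrable_ip.
apply: le_Rintegral => //.
- exact: (integrable_ip (sm n) (sm n)).
- by have := integrableB measurableT i4 iL4; apply: eq_integrable.
- move=> w _; have := runmax_sqr_le (fun i => N w (tau i)) n.
  by rewrite !expr2.
Qed.

End FiniteTimes.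

Let tT' : t <= T. Proof. by case/andP: tT. Qed.

Lemma doob : (\int[P]_w dense_sup t T N w <= 4%:E * nsq P (N ^~ T))%E.
Proof.
pose p := dense_time t T.
have mN s : t <= s <= T -> measurable_fun setT (N ^~ s) by move=> /sN[].
have mD n : measurable_fun setT (dense_sup_n t T N n).
  apply: measurable_sqr_EFin; elim: n => [|n IH] /=.
    by apply: measurableT_comp => //; exact: mN (dense_time_itv tT' 0).
  apply: measurable_maxr => //; apply: measurableT_comp => //.
  exact: mN (dense_time_itv tT' n.+1).
rewrite /dense_sup monotone_convergence//; last 2 first.
- by move=> n w _; rewrite lee_fin sqr_ge0.
- move=> w _; apply/nondecreasing_seqP => n; rewrite lee_fin.
  by rewrite ler_sqr ?nnegrE ?runmax_ge0// runmaxS.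
apply: lime_le.
  apply: ereal_nondecreasing_is_cvgn; apply/nondecreasing_seqP => n.
  apply: ge0_le_integral => //.
  - by move=> w _; rewrite lee_fin sqr_ge0.
  - move=> w _; rewrite lee_fin.
    by rewrite ler_sqr ?nnegrE ?runmax_ge0// runmaxS.
apply: nearW => n.
(* [doob_finite] needs increasing times, while the dense times come in the order of an enumeration,
   so they are sorted. Reading the list past its end gives T, so that the last time [tau (size l)]
   is T. *)
pose l := sort <=%R [seq p i | i <- iota 0 n.+1].
pose tau i := nth T l i.
have lT x : x \in l -> t <= x <= T.
  by rewrite mem_sort => /mapP[k _ ->]; exact: dense_time_itv.
have tauT i : t <= tau i <= T.
  have [h|h] := ltnP i (size l); first by apply: lT; exact: mem_nth.
  by rewrite /tau nth_default// tT' lexx.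
have tauS i : tau i <= tau i.+1.
  have [h|h] := ltnP i.+1 (size l); last first.
    by rewrite {2}/tau nth_default//; case/andP: (tauT i).
  have : sorted <=%R l by apply: sort_sorted; exact: le_total.
  by move=> /(sortedP T) /(_ i h).
have := doob_finite tauT tauS (size l); rewrite {2}/tau nth_default//.
apply: le_trans; apply: le_lower_integral => w; first by rewrite lee_fin sqr_ge0.
rewrite lee_fin ler_sqr ?nnegrE ?runmax_ge0//.
apply: runmax_le => i ni.
have pl : p i \in l by rewrite mem_sort; apply: map_f; rewrite mem_iota.
have E : tau (index (p i) l) = p i by exact: nth_index.
rewrite -[dense_time t T i]/(p i) -E.
apply: (@le_runmax _ (fun i => N w (tau i))).
by rewrite ltnW// index_mem.
Qed.

End Doob.

(** * Forward and backward estimates *)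

Section NonnegLinear.
Context {d : measure_display} {T : measurableType d} {R : realType}.
Variable mu : {measure set T -> \bar R}.
Local Open Scope ereal_scope.

Lemma integral_comb2 (a b : R) (f g : T -> \bar R) : (0 <= a)%R -> (0 <= b)%R ->
  (forall x, 0 <= f x) -> (forall x, 0 <= g x) ->
  measurable_fun setT f -> measurable_fun setT g ->
  \int[mu]_x (a%:E * f x + b%:E * g x) = a%:E * \int[mu]_x f x + b%:E * \int[mu]_x g x.
Proof.
move=> a0 b0 f0 g0 mf mg; rewrite ge0_integralD//.
- by rewrite !ge0_integralZl.
- by move=> x _; rewrite mule_ge0 ?lee_fin.
- exact: measurable_funeM.
- by move=> x _; rewrite mule_ge0 ?lee_fin.
- exact: measurable_funeM.
Qed.

Lemma measurable_comb2 (a b : R) (f g : T -> \bar R) :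
  measurable_fun setT f -> measurable_fun setT g ->
  measurable_fun setT (fun x => a%:E * f x + b%:E * g x).
Proof. by move=> mf mg; apply: emeasurable_funD; exact: measurable_funeM. Qed.

Lemma comb2_ge0 (a b : R) (x y : \bar R) : (0 <= a)%R -> (0 <= b)%R ->
  0 <= x -> 0 <= y -> 0 <= a%:E * x + b%:E * y.
Proof. by move=> a0 b0 x0 y0; rewrite adde_ge0// mule_ge0 ?lee_fin. Qed.

End NonnegLinear.

Section CoreEstimate.
Context {R : realType} {d : measure_display} {Om : measurableType d}.
Variables (P : probability Om R) (W : Om -> R -> R) (T : R).
Hypotheses (brW : is_brownian P W T) (cP : measure_is_complete P).
Local Notation lam := (@lebesgue_measure R).
Local Notation PL := (P \x lam)%E.
Variable t : R.
Hypothesis tT : 0 <= t <= T.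

Let tT' : t <= T. Proof. by case/andP: tT. Qed.

Lemma ito_doob H J : ito_pair P W T t H J ->
  (\int[P]_w dense_sup t T J w <= 4%:E * nsq PL H)%E.
Proof.
move=> ij; rewrite -(ito_isometry brW cP tT ij); apply: (doob brW cP tT).
- by case: ij.
- by move=> s sT; exact: (ito_sqint_integral brW cP tT sT ij).
- by move=> s u z ts su uT az sz; exact: (ito_orthogonal brW cP tT ts su uT az sz ij).
Qed.

Lemma ito_measurable_dense_sup H J : ito_pair P W T t H J ->
  measurable_fun setT (dense_sup t T J).
Proof.
move=> ij; apply: measurable_dense_sup => // s sT.
by case: (ito_sqint_integral brW cP tT sT ij).
Qed.

(** The drift enters through [q], a bound of its square that is uniform in time and measurable in w,
    so that nothing is asked of the dependence of [B] on w. *)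
Lemma forward_estimate (U B J : Om -> R -> R) H u0 (q : Om -> \bar R) :
  ito_pair P W T t H J -> (forall w, 0 <= q w)%E -> measurable_fun setT q ->
  {ae P, forall w, forall s, t <= s <= T ->
     U w s = u0 + B w s + J w s /\ (((B w s) ^+ 2)%:E <= q w)%E} ->
  (\int[P]_w dense_sup t T U w <=
    (3 * u0 ^+ 2)%:E + (3%:E * \int[P]_w q w + 12%:E * nsq PL H))%E.
Proof.
move=> ij q0 mq aeU.
have mJ := ito_measurable_dense_sup ij.
have J0 := dense_sup_ge0 t T J.
have k0 : 0 <= 3 * u0 ^+ 2 by rewrite mulr_ge0// sqr_ge0.
apply: (@le_trans _ _ (\int[P]_w ((3 * u0 ^+ 2)%:E +
    (3%:E * q w + 3%:E * dense_sup t T J w)))%E).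
  apply: ae_le_lower_integral.
  - exact: dense_sup_ge0.
  - by move=> w; rewrite adde_ge0 ?lee_fin// comb2_ge0.
  - by apply: emeasurable_funD => //; exact: measurable_comb2.
  - apply: (ae_imply aeU) => w Uw; apply: dense_sup_le => k.
    have kT := dense_time_itv tT' k; have [-> Bq] := Uw _ kT.
    set s := dense_time t T k in kT Bq *.
    apply: (@le_trans _ _ ((3 * u0 ^+ 2)%:E +
      (3%:E * ((B w s) ^+ 2)%:E + 3%:E * ((J w s) ^+ 2)%:E))%E).
      rewrite -!EFinM -!EFinD lee_fin.
      have := sqr_ge0 (u0 - B w s); have := sqr_ge0 (u0 - J w s).
      have := sqr_ge0 (B w s - J w s); nra.
    apply: leeD2l; apply: leeD; apply: lee_wpmul2l => //.
    exact: dense_sup_ge.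
rewrite ge0_integralD//; first last.
- exact: measurable_comb2.
- by move=> w _; rewrite comb2_ge0.
rewrite integral_probability_cst integral_comb2//.
apply: leeD2l; apply: leeD2l.
rewrite (_ : 12%:E = 3%:E * 4%:E)%E; last by rewrite -EFinM; congr EFin; ring.
by rewrite -muleA; apply: lee_wpmul2l => //; exact: ito_doob.
Qed.

Section Backward.
Variables (V G M : Om -> R -> R) (gam : Om -> R) (H : Om * measurableTypeR R -> R).
Variables (qg qf : Om -> \bar R).
Hypotheses (ij : ito_pair P W T t H M).
Hypotheses (qg0 : forall w, (0 <= qg w)%E) (qf0 : forall w, (0 <= qf w)%E).
Hypotheses (mqg : measurable_fun setT qg) (mqf : measurable_fun setT qf).
Hypotheses (aV : adapted_to P W t (V ^~ t)) (sV : sqint P (V ^~ t)).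
Hypothesis aeV : {ae P, forall w, (((gam w) ^+ 2)%:E <= qg w)%E /\
  forall s, t <= s <= T -> [/\ V w s = gam w + G w s - (M w T - M w s),
    (((G w s) ^+ 2)%:E <= qf w)%E & (((G w t - G w s) ^+ 2)%:E <= qf w)%E]}.

Let TT : t <= T <= T. Proof. by rewrite tT' lexx. Qed.
Let tt : t <= t <= T. Proof. by rewrite tT' lexx. Qed.

(** The martingale part of V started at time t: V(s) = N(s) - (G(t) - G(s)), and N(T) = gam +
    G(t). *)
Let N w s := V w t + (M w s - M w t).

Let sM s : t <= s <= T -> sqint P (M ^~ s).
Proof. by move=> sT; exact: (ito_sqint_integral brW cP tT sT ij). Qed.

Let sN s : t <= s <= T -> sqint P (N ^~ s).
Proof. by move=> sT; apply: sqintD => //; apply: sqintB; exact: sM. Qed.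

Let nsqN : (nsq P (N ^~ T) <= 2%:E * \int[P]_w qg w + 2%:E * \int[P]_w qf w)%E.
Proof.
rewrite -integral_comb2//; apply: ae_le_lower_integral.
- by move=> w; rewrite lee_fin sqr_ge0.
- by move=> w; rewrite comb2_ge0.
- exact: measurable_comb2.
- apply: (ae_imply aeV) => w [gq Vw]; have [Vt Gt _] := Vw _ tt.
  apply: (@le_trans _ _ (2%:E * ((gam w) ^+ 2)%:E + 2%:E * ((G w t) ^+ 2)%:E)%E).
    rewrite -!EFinM -!EFinD lee_fin (_ : N w T = gam w + G w t).
      have := sqr_ge0 (gam w - G w t); nra.
    rewrite /N Vt; ring.
  by apply: leeD; apply: lee_wpmul2l.
Qed.

Let oM s u zeta : t <= s -> s <= u -> u <= T ->
  adapted_to P W s zeta -> sqint P zeta -> ip P zeta (fun w => M w u - M w s) = 0.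
Proof. by move=> ts su uT az sz; exact: (ito_orthogonal brW cP tT ts su uT az sz ij). Qed.

(** V(t) is orthogonal to M(T) - M(t), and M(t) = 0 almost surely. Hence E N(T)^2 = E V(t)^2 + E
    M(T)^2, where the first term is dropped. *)
Lemma backward_integrand_estimate :
  (nsq PL H <= 2%:E * \int[P]_w qg w + 2%:E * \int[P]_w qf w)%E.
Proof.
apply: le_trans nsqN; rewrite -(ito_isometry brW cP tT ij).
have sMT := sM TT; have sMt := sM tt; have sD := sqintB sMT sMt.
rewrite -(ip_self sMT) -(ip_self (sN TT)) lee_fin.
have o := oM (lexx t) tT' (lexx T) aV sV.
rewrite (ipDl sV sD (sN TT)) (ipDr sV sD sV) (ipDr sV sD sD) o.
rewrite (ipC _ _ (V ^~ t)) o addr0 add0r.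
rewrite (ipBl sMT sMt sD) !(ipBr sMT sMt)//.
have z : ip P (M ^~ t) (M ^~ t) = 0.
  by apply: EFin_inj; rewrite (ip_self sMt) (ito_start brW cP tT ij).
have z2 : ip P (M ^~ T) (M ^~ t) = 0.
  have := cauchy_schwarz_ip sMT sMt; rewrite z mulr0 => h.
  by apply/eqP; rewrite -sqrf_eq0 eq_le h sqr_ge0.
rewrite (ipC P (M ^~ t) (M ^~ T)) z z2.
have := ip_ge0 P (V ^~ t); lra.
Qed.

Lemma backward_estimate : (\int[P]_w dense_sup t T V w <=
  10%:E * \int[P]_w qg w + 15%:E * \int[P]_w qf w)%E.
Proof.
have aN s : t <= s <= T -> adapted_to P W s (N ^~ s).
  have [_ aM _] := ij; move=> /andP[ts sT]; apply: adapted_toD.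
    exact: adapted_toS aV.
  apply: adapted_toB; first by apply: aM; rewrite ts.
  apply: (adapted_toS ts); exact: aM.
have D : (\int[P]_w dense_sup t T N w <= 4%:E * nsq P (N ^~ T))%E.
  apply: (doob brW cP tT) => // s u z ts su uT az sz.
  rewrite -[RHS](oM ts su uT az sz); congr ip; apply/funext => w; rewrite /N; ring.
have mN : measurable_fun setT (dense_sup t T N).
  by apply: measurable_dense_sup => // s /sN[].
have N0 := dense_sup_ge0 t T N.
(* The inequality (p - q)^2 <= 5/4 p^2 + 5 q^2 is applied with p = N(s) and q = G(t) - G(s). Doob's
   inequality then gives 5/4 * 4 * 2 = 10 in front of both data, and the drift gets 10 + 5 = 15. *)
apply: (@le_trans _ _ (\int[P]_w ((5/4)%:E * dense_sup t T N w + 5%:E * qf w))%E).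
  apply: ae_le_lower_integral.
  - exact: dense_sup_ge0.
  - by move=> w; rewrite comb2_ge0.
  - exact: measurable_comb2.
  - apply: (ae_imply aeV) => w [_ Vw]; apply: dense_sup_le => k.
    have kT := dense_time_itv tT' k; have [Vs _ Gs] := Vw _ kT.
    have [Vt _ _] := Vw _ tt.
    set s := dense_time t T k in kT Vs Gs *.
    apply: (@le_trans _ _ ((5/4)%:E * ((N w s) ^+ 2)%:E + 5%:E * ((G w t - G w s) ^+ 2)%:E)%E).
      rewrite -!EFinM -!EFinD lee_fin.
      have -> : V w s = N w s - (G w t - G w s) by rewrite /N Vt Vs; ring.
      have := sqr_ge0 (N w s + 4 * (G w t - G w s)); nra.
    by apply: leeD; apply: lee_wpmul2l => //; exact: dense_sup_ge.
rewrite integral_comb2//.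
apply: (@le_trans _ _ ((5/4)%:E * (4%:E * (2%:E * \int[P]_w qg w + 2%:E * \int[P]_w qf w))
    + 5%:E * \int[P]_w qf w)%E).
  apply: leeD2r; apply: lee_wpmul2l => //; apply: (le_trans D).
  exact: lee_wpmul2l.
have g0 : (0 <= \int[P]_w qg w)%E by exact: integral_ge0.
have f0 : (0 <= \int[P]_w qf w)%E by exact: integral_ge0.
move: g0 f0; case: (integral _ _ qg) => [a| |] //; case: (integral _ _ qf) => [b| |] // a0 b0.
- by rewrite -!(EFinM, EFinD) lee_fin; move: a0 b0; rewrite !lee_fin; lra.
- by rewrite [leRHS](_ : _ = +oo)%E ?leey// gt0_muley ?lte_fin// addey// -EFinM.
- by rewrite [leRHS](_ : _ = +oo)%E ?leey// gt0_muley ?lte_fin// addye// -EFinM.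
- by rewrite [leRHS](_ : _ = +oo)%E ?leey// !gt0_muley ?lte_fin.
Qed.

End Backward.
End CoreEstimate.

(** * Delayed paths *)

Section Translation.
Context {R : realType}.
Local Notation lam := (@lebesgue_measure R).

Let addl (a : R) : measurableTypeR R -> measurableTypeR R := fun x => x + a.

Let measurable_addl a : measurable_fun setT (addl a).
Proof. exact: measurable_funD. Qed.

Lemma lebesgue_measure_shift a (A : set R) : measurable A ->
  pushforward lam (addl a) A = lam A.
Proof.
move=> mA; apply/esym/lebesgue_measure_unique => //= _ [[b c]] _ <-.
rewrite /pushforward (_ : _ @^-1` _ = `]b - a, c - a]%classic); last first.
  by apply/seteqP; split => x /=; rewrite !in_itv/= ltrBlDr lerBrDr.
by rewrite !lebesgue_measure_itv/= !lte_fin ltrD2r -!EFinB opprB addrA subrK.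
Qed.

Lemma ge0_integral_shift (a : R) (f : R -> \bar R) : measurable_fun setT f ->
  (forall x, 0 <= f x)%E -> (\int[lam]_x f (x + a)%R = \int[lam]_x f x)%E.
Proof.
move=> mf f0.
have f0' : {in [set: measurableTypeR R], forall y, 0 <= f y}%E by [].
have mf' : measurable_fun [set: measurableTypeR R] (f : measurableTypeR R -> \bar R) by [].
rewrite -[LHS](@ge0_integral_pushforward _ _ (measurableTypeR R)
  (measurableTypeR R) R (addl a) (measurable_addl a) lam setT f measurableT mf' f0').
by apply: eq_measure_integral => A mA _; exact: lebesgue_measure_shift.
Qed.

End Translation.

Section Delay.
Context {R : realType}.
Local Notation lam := (@lebesgue_measure R).
Variables (alpha : probability (measurableTypeR R) R).
Local Open Scope ereal_scope.

Lemma measurable_delay (f : R -> \bar R) : measurable_fun setT f ->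
  measurable_fun setT (fun p : measurableTypeR R * measurableTypeR R => f (p.1 + p.2)%R).
Proof.
move=> mf; apply: (measurableT_comp mf).
have : measurable_fun [set: measurableTypeR R * measurableTypeR R]
  (fun p => (p.1 : R) + (p.2 : R))%R.
  apply: measurable_funD; [exact: measurable_fst|exact: measurable_snd].
by [].
Qed.

(** Tonelli's theorem and translation invariance in r: averaging over delays by a probability does
    not increase the integral. Thus the delayed Z costs no more than the integral of Z^2. *)
Lemma delay_integral_le (f : R -> \bar R) (A E : set R) :
  measurable_fun setT f -> (forall x, 0 <= f x) -> measurable A -> measurable E ->
  \int[lam]_(r in A) \int[alpha]_(th in E) f (r + th)%R <= \int[lam]_r f r.
Proof.
move=> mf f0 mA mE; have md := measurable_delay mf.
pose F (p : measurableTypeR R * measurableTypeR R) := f (p.1 + p.2)%R.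
have F0 p : 0 <= F p by exact: f0.
have mFr (r : R) : measurable_fun setT (fun th : measurableTypeR R => f (r + th)%R).
  exact: (measurableT_comp md (measurable_pair1 r)).
apply: (@le_trans _ _ (\int[lam]_r \int[alpha]_th f (r + th)%R)).
  rewrite integral_mkcond; apply: le_lower_integral => r.
    by rewrite patchE; case: ifP => _ //; exact: integral_ge0.
  rewrite patchE; case: ifP => _; last by exact: integral_ge0.
  apply: ge0_subset_integral => //.
rewrite -[leLHS]/(\int[lam]_r fubini_F alpha F r).
rewrite /fubini_F (@fubini_tonelli _ _ _ _ _ lam alpha F md F0).
rewrite (eq_integral (fun=> \int[lam]_r f r)); last first.
  by move=> th _; exact: (ge0_integral_shift th mf f0).
rewrite integral_cst//.
by rewrite [X in _ * X](_ : _ = 1) ?mule1//; exact: probability_setT.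
Qed.

End Delay.

Section Paths.
Context {R : realType}.
Local Notation lam := (@lebesgue_measure R).
Variables (t T : R).
Hypothesis tT : 0 <= t <= T.

Let t0 : 0 <= t. Proof. by case/andP: tT. Qed.
Let tT' : t <= T. Proof. by case/andP: tT. Qed.

Definition clip (r : R) : R := Num.max t (Num.min T r).

Lemma clip_itv r : t <= clip r <= T.
Proof. by rewrite le_max lexx /= ge_max tT' ge_min lexx. Qed.

Lemma clip_id r : t <= r <= T -> clip r = r.
Proof. by move=> /andP[tr rT]; rewrite /clip min_r// max_r. Qed.

Lemma continuous_clip : continuous clip.
Proof.
move=> r; apply: (@continuous_max _ _ (cst t) (fun r => Num.min T r)).
  exact: cvg_cst.
apply: (@continuous_min _ _ (cst T) id); first exact: cvg_cst.
exact: cvg_id.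
Qed.

(** The convention for s < t, path by path: on [-T, T] such a path is [u \o clip], which is
    continuous on the whole line, so that its segments are measurable and bounded. *)
Definition frozen_path (u : R -> R) :=
  {within `[t, T], continuous u} /\ forall s, - T <= s < t -> u s = u t.

Lemma frozen_path_clip u s : frozen_path u -> - T <= s <= T -> u s = u (clip s).
Proof.
move=> [_ uf] /andP[Ts sT]; have [ts|st] := leP t s.
  by rewrite clip_id// ts.
rewrite uf ?Ts// /clip min_r// max_l//; exact: ltW.
Qed.

Lemma frozen_path_continuous u : frozen_path u -> continuous (u \o clip).
Proof.
move=> [uc _] r.
have /subspace_continuousP /(_ (clip r)) := uc.
rewrite /= in_itv/= => /(_ (clip_itv r)) h.
apply: cvg_comp h => B wB.
have cB : \forall x \near r, [set` `[t, T]] (clip x) -> B (clip x).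
  exact: continuous_clip wB.
change (\forall x \near r, B (clip x)); apply: filterS cB => x; apply.
rewrite /= in_itv/=; exact: clip_itv.
Qed.

Lemma segment_itv r th : t <= r <= T -> - T <= th <= 0 -> - T <= r + th <= T.
Proof. move=> /andP[tr rT] /andP[Tth th0]; have := t0; lra. Qed.

Lemma frozen_path_Linfty u r : frozen_path u -> t <= r <= T -> Linfty T (segment u r).
Proof.
move=> fu rT; have cu := frozen_path_continuous fu.
have mu : measurable_fun setT (u \o clip) by exact: continuous_measurable_fun.
have E th : - T <= th <= 0 -> segment u r th = (u \o clip) (r + th).
  by move=> h; rewrite /segment (frozen_path_clip fu)//; exact: segment_itv.
split.
  apply: (@eq_measurable_fun _ _ _ _ _ (fun th => (u \o clip) (r + th))).
    by move=> th; rewrite inE /= in_itv/= => h; rewrite E.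
  apply: measurable_funTS; apply: (measurableT_comp mu); exact: measurable_funD.
have [uc _] := fu.
have nuc : {within `[t, T], continuous (fun s => `|u s|)}.
  by move=> s; apply: cvg_norm; exact: uc.
have [c _ cM] := EVT_max tT' nuc.
exists `|u c| => th; rewrite in_itv/= => h; rewrite E//=.
by apply: cM; rewrite in_itv/= clip_itv.
Qed.

Definition cut (z : R -> R) : R -> R := z \_ `[t, T]%classic.

Lemma cutE z r : t <= r <= T -> cut z r = z r.
Proof. by move=> h; rewrite /cut patchE mem_set//= in_itv. Qed.

Lemma cut0 z r : ~ (t <= r <= T) -> cut z r = 0.
Proof. by move=> h; rewrite /cut patchE memNset//= in_itv. Qed.

(** On [-T, T] such a path agrees with [cut z], which is measurable on the whole line, so that
    translations and Tonelli's theorem apply to it. *)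
Definition null_before_path (z : R -> R) :=
  [/\ measurable_fun `[t, T] z, forall s, - T <= s < t -> z s = 0 &
      (nsq lam (cut z) < +oo)%E].

Lemma measurable_cut z : measurable_fun `[t, T] z -> measurable_fun setT (cut z).
Proof. by move=> mz; apply/(measurable_restrictT z). Qed.

Let measurable_cut2 z : measurable_fun `[t, T] z ->
  measurable_fun setT (fun r => ((cut z r) ^+ 2)%:E).
Proof.
move=> /measurable_cut mz; apply/measurable_EFinP; exact: measurable_funX.
Qed.

Lemma null_before_path_cut z s : null_before_path z -> - T <= s <= T -> z s = cut z s.
Proof.
move=> [_ z0 _] /andP[Ts sT]; have [ts|st] := leP t s.
  by rewrite cutE// ts.
by rewrite z0 ?Ts// cut0// leNgt st.
Qed.

Lemma null_before_path_L2 z r : null_before_path z -> t <= r <= T -> L2 T (segment z r).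
Proof.
move=> nz rT; have [mz _ z2] := nz.
have E th : - T <= th <= 0 -> segment z r th = cut z (r + th).
  by move=> h; rewrite /segment (null_before_path_cut nz)//; exact: segment_itv.
split.
  apply: (@eq_measurable_fun _ _ _ _ _ (fun th => cut z (r + th))).
    by move=> th; rewrite inE /= in_itv/= => h; rewrite E.
  apply: measurable_funTS; apply: (measurableT_comp (measurable_cut mz)); exact: measurable_funD.
apply: le_lt_trans z2.
have f0 s : (0 <= ((cut z s) ^+ 2)%:E)%E by rewrite lee_fin sqr_ge0.
rewrite /nsq -(ge0_integral_shift r (measurable_cut2 mz) f0).
rewrite integral_mkcond; apply: le_lower_integral => th; rewrite patchE; case: ifPn.
- by move=> _; rewrite lee_fin sqr_ge0.
- by [].
- by rewrite inE/= in_itv/= => h; rewrite E// addrC.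
- by move=> _; rewrite lee_fin sqr_ge0.
Qed.

End Paths.

Section DelayBounds.
Context {R : realType}.
Local Notation lam := (@lebesgue_measure R).
Variables (alpha : probability (measurableTypeR R) R) (t T : R).
Hypothesis tT : 0 <= t <= T.

Let t0 : 0 <= t. Proof. by case/andP: tT. Qed.
Let tT' : t <= T. Proof. by case/andP: tT. Qed.
Let T0 : 0 <= T. Proof. exact: le_trans tT'. Qed.

Variables (u v z : R -> R) (a b : \bar R).
Hypotheses (fu : frozen_path t T u) (fv : frozen_path t T v).
Hypothesis (nz : null_before_path t T z).
Hypotheses (ua : forall s, t <= s <= T -> (((u s) ^+ 2)%:E <= a)%E).
Hypotheses (vb : forall s, t <= s <= T -> (((v s) ^+ 2)%:E <= b)%E).

Let a0 : (0 <= a)%E.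
Proof. by apply: le_trans (ua (s := t) _); rewrite ?lee_fin ?sqr_ge0// lexx. Qed.

Let b0 : (0 <= b)%E.
Proof. by apply: le_trans (vb (s := t) _); rewrite ?lee_fin ?sqr_ge0// lexx. Qed.

Let ua' s : - T <= s <= T -> (((u s) ^+ 2)%:E <= a)%E.
Proof. by move=> sT; rewrite (frozen_path_clip fu sT); apply: ua; exact: clip_itv. Qed.

Let vb' s : - T <= s <= T -> (((v s) ^+ 2)%:E <= b)%E.
Proof. by move=> sT; rewrite (frozen_path_clip fv sT); apply: vb; exact: clip_itv. Qed.

Let integral_alpha_cst (c : \bar R) : (0 <= c)%E ->
  (\int[alpha]_(th in `[(- T)%R, 0%R]) c <= c)%E.
Proof.
move=> c0; rewrite integral_cst//.
by rewrite -[leRHS]mule1; apply: lee_wpmul2l => //; exact: probability_le1.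
Qed.

Let mz2 : measurable_fun setT (fun r => ((cut t T z r) ^+ 2)%:E).
Proof.
by case: nz => mz _ _; apply/measurable_EFinP/measurable_funX; exact: measurable_cut.
Qed.

Definition delay1 r := (\int[alpha]_(th in `[(- T)%R, 0%R]) (`|u (r + th)%R| ^+ 2)%:E)%E.

Definition delay2 r :=
  (\int[alpha]_(th in `[(- T)%R, 0%R]) (`|u (r + th)%R| ^+ 2 + `|v (r + th)%R| ^+ 2)%:E)%E.

Definition delay3 r :=
  (\int[alpha]_(th in `[(- T)%R, 0%R])
    (`|u (r + th)%R| ^+ 2 + `|v (r + th)%R| ^+ 2 + `|z (r + th)%R| ^+ 2)%:E)%E.

Lemma delay1_ge0 r : (0 <= delay1 r)%E.
Proof. by apply: integral_ge0 => th _; rewrite lee_fin sqr_ge0. Qed.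

Lemma delay2_ge0 r : (0 <= delay2 r)%E.
Proof. by apply: integral_ge0 => th _; rewrite lee_fin !addr_ge0// sqr_ge0. Qed.

Lemma delay3_ge0 r : (0 <= delay3 r)%E.
Proof. by apply: integral_ge0 => th _; rewrite lee_fin !addr_ge0// sqr_ge0. Qed.

Lemma delay1_le r : t <= r <= T -> (delay1 r <= a)%E.
Proof.
move=> rT; apply: le_trans (integral_alpha_cst a0).
apply: le_lower_integral_set => th /=; rewrite in_itv/= => h.
  by rewrite lee_fin sqr_ge0.
by rewrite real_normK ?num_real//; exact/ua'/(segment_itv tT).
Qed.

Lemma delay2_le r : t <= r <= T -> (delay2 r <= a + b)%E.
Proof.
move=> rT; apply: le_trans (integral_alpha_cst (adde_ge0 a0 b0)).
apply: le_lower_integral_set => th /=; rewrite in_itv/= => h.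
  by rewrite lee_fin addr_ge0// sqr_ge0.
rewrite !real_normK ?num_real// EFinD.
by apply: leeD; [exact/ua'/(segment_itv tT)|exact/vb'/(segment_itv tT)].
Qed.

(** Unlike u and v, the path z has no pointwise bound: its delayed contribution is kept as a
    function of r and controlled only after integration, by [delay_integral_le]. *)
Let zeta r := (\int[alpha]_(th in `[(- T)%R, 0%R]) ((cut t T z (r + th)%R) ^+ 2)%:E)%E.

Let zeta0 r : (0 <= zeta r)%E.
Proof. by apply: integral_ge0 => th _; rewrite lee_fin sqr_ge0. Qed.

Let measurable_zeta : measurable_fun setT zeta.
Proof.
pose F (p : measurableTypeR R * measurableTypeR R) : \bar R :=
  ((fun p => ((cut t T z (p.1 + p.2)%R) ^+ 2)%:E) \_ (setT `*` `[(- T)%R, 0%R : R]%classic)) p.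
have mF : measurable_fun setT F.
  have mD : measurable (setT `*` `[(- T)%R, 0%R]%classic
      : set (measurableTypeR R * measurableTypeR R)) by exact: measurableX.
  apply: (measurable_restrictT _ mD).1; apply: measurable_funTS.
  exact: (measurable_delay mz2).
have F0 p : (0 <= F p)%E.
  by rewrite /F patchE; case: ifP => // _; rewrite lee_fin sqr_ge0.
have := @measurable_fun_fubini_tonelli_F _ _ _ _ _ alpha F mF F0.
congr measurable_fun; apply/funext => r; rewrite /fubini_F /zeta [RHS]integral_mkcond.
apply: eq_integral => th _; rewrite /F !patchE in_setX/= in_setT/=.
by case: ifP.
Qed.

Let integral_zeta_le : (\int[lam]_(r in `[t, T]) zeta r <= nsq lam (cut t T z))%E.
Proof.
apply: (@delay_integral_le _ alpha (fun r => ((cut t T z r) ^+ 2)%:E)) => // r.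
by rewrite lee_fin sqr_ge0.
Qed.

Let delay3_le r : t <= r <= T -> (delay3 r <= a + b + zeta r)%E.
Proof.
move=> rT.
apply: (@le_trans _ _ (\int[alpha]_(th in `[(- T)%R, 0%R])
   (a + b + ((cut t T z (r + th)%R) ^+ 2)%:E))%E).
  apply: le_lower_integral_set => th /=; rewrite in_itv/= => h.
    by rewrite lee_fin !addr_ge0// sqr_ge0.
  rewrite !real_normK ?num_real// 2!EFinD.
  have rh := segment_itv tT rT h; apply: leeD.
    by apply: leeD; [exact/ua'|exact/vb'].
  by rewrite (null_before_path_cut nz rh).
rewrite ge0_integralD//.
- apply: leeD2r; apply: integral_alpha_cst; exact: adde_ge0.
- by move=> th _; exact: adde_ge0.
- by move=> th _; rewrite lee_fin sqr_ge0.
- apply: measurable_funTS.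
  exact: (measurableT_comp (measurable_delay mz2) (measurable_pair1 r)).
Qed.

Let T_itv : (lam `[t, T]%classic <= T%:E)%E.
Proof.
rewrite lebesgue_measure_itv/= lte_fin; case: ifP => _; last by rewrite lee_fin.
by rewrite -EFinB lee_fin gerBl.
Qed.

Let integral_lam_cst (c : \bar R) : (0 <= c)%E ->
  (\int[lam]_(r in `[t, T]) c <= T%:E * c)%E.
Proof.
move=> c0; rewrite integral_cst// muleC; apply: lee_wpmul2r => //; exact: T_itv.
Qed.

Lemma ae_le_integral_slab (f g : R -> \bar R) :
  (forall r, 0 <= f r)%E -> (forall r, 0 <= g r)%E -> measurable_fun `[t, T] g ->
  {ae lam, forall r, t <= r <= T -> (f r <= g r)%E} ->
  (\int[lam]_(r in `[t, T]) f r <= \int[lam]_(r in `[t, T]) g r)%E.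
Proof.
move=> f0 g0 mg fg; rewrite integral_mkcond [leRHS]integral_mkcond.
apply: ae_le_lower_integral.
- by move=> r; rewrite patchE; case: ifP.
- by move=> r; rewrite patchE; case: ifP.
- exact/(measurable_restrictT g).
- apply: (ae_imply fg) => r h; rewrite !patchE; case: ifPn => //.
  by rewrite inE /= in_itv; exact: h.
Qed.

Section Drift.
Variables (c : R) (p : R -> \bar R).
Hypotheses (c0 : 0 <= c) (p0 : forall r, (0 <= p r)%E) (mp : measurable_fun `[t, T] p).

Lemma diffusion_bound (phi : R -> R) :
  {ae lam, forall r, t <= r <= T -> (((phi r) ^+ 2)%:E <= c%:E * delay2 r + p r)%E} ->
  (\int[lam]_(r in `[t, T]) ((phi r) ^+ 2)%:E <=
    (c * T)%:E * (a + b) + \int[lam]_(r in `[t, T]) p r)%E.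
Proof.
move=> H.
apply: (@le_trans _ _ (\int[lam]_(r in `[t, T]) (c%:E * (a + b) + p r))%E).
  apply: ae_le_integral_slab.
  - by move=> r; rewrite lee_fin sqr_ge0.
  - by move=> r; rewrite adde_ge0// mule_ge0 ?lee_fin// adde_ge0.
  - by apply: emeasurable_funD.
  - apply: (ae_imply H) => r h rT; apply: (le_trans (h rT)); apply: leeD2r.
    by apply: lee_wpmul2l; rewrite ?lee_fin//; exact: delay2_le.
rewrite ge0_integralD//; last first.
  by move=> r _; rewrite mule_ge0 ?lee_fin// adde_ge0.
apply: leeD2r; rewrite mulrC EFinM -muleA; apply: integral_lam_cst.
by rewrite mule_ge0 ?lee_fin// adde_ge0.
Qed.

(** The bounded paths u and v cost the length of the interval, at most T; the part of z costs no
    factor T. *)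
Lemma drift_sqr_bound (phi : R -> R) :
  {ae lam, forall r, t <= r <= T -> (((phi r) ^+ 2)%:E <= c%:E * delay3 r + p r)%E} ->
  (\int[lam]_(r in `[t, T]) ((phi r) ^+ 2)%:E <=
    (c * T)%:E * (a + b) + c%:E * nsq lam (cut t T z) + \int[lam]_(r in `[t, T]) p r)%E.
Proof.
move=> H.
apply: (@le_trans _ _ (\int[lam]_(r in `[t, T]) (c%:E * (a + b) + c%:E * zeta r + p r))%E).
  apply: ae_le_integral_slab.
  - by move=> r; rewrite lee_fin sqr_ge0.
  - by move=> r; rewrite !adde_ge0// mule_ge0 ?lee_fin// adde_ge0.
  - apply: emeasurable_funD => //; apply: emeasurable_funD => //.
    by apply: measurable_funeM; exact: measurable_funTS.
  - apply: (ae_imply H) => r h rT; apply: (le_trans (h rT)); apply: leeD2r.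
    rewrite -ge0_muleDr//; last exact: adde_ge0.
    by apply: lee_wpmul2l; rewrite ?lee_fin//; exact: delay3_le.
have ab0 : (0 <= c%:E * (a + b))%E by rewrite mule_ge0 ?lee_fin// adde_ge0.
have cz0 r : (0 <= c%:E * zeta r)%E by rewrite mule_ge0 ?lee_fin.
have mcz : measurable_fun `[t, T] (fun r => c%:E * zeta r)%E.
  by apply: measurable_funeM; exact: measurable_funTS.
rewrite ge0_integralD//; last 2 first.
- by move=> r _; rewrite adde_ge0.
- exact: emeasurable_funD.
rewrite ge0_integralD//.
apply: leeD2r; apply: leeD.
  by rewrite mulrC EFinM -muleA; exact: integral_lam_cst.
rewrite ge0_integralZl//; last exact: measurable_funTS.
apply: lee_wpmul2l; first by rewrite lee_fin.
exact: integral_zeta_le.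
Qed.

End Drift.
End DelayBounds.

Section RealIntegral.
Context {R : realType}.
Local Notation lam := (@lebesgue_measure R).
Variables (t T : R).
Hypotheses (tT : 0 <= t <= T) (T0 : 0 < T).

Let t0 : 0 <= t. Proof. by case/andP: tT. Qed.
Let tT' : t <= T. Proof. by case/andP: tT. Qed.

(** The Cauchy-Schwarz inequality against the indicator of [t, T]. The bound does not depend on [I],
    so that it serves all subintervals at once; if the right-hand side is infinite it is trivial. *)
Lemma sqr_Rintegral_le (phi : R -> R) (I : set R) :
  lam.-integrable `[t, T] (EFin \o phi) -> measurable I -> I `<=` `[t, T] ->
  (((Rintegral lam I phi) ^+ 2)%:E <=
    T%:E * \int[lam]_(r in `[t, T]) ((phi r) ^+ 2)%:E)%E.
Proof.
move=> iphi mI It.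
have /measurable_EFinP mphi := measurable_int lam iphi.
set Q := (\int[lam]_(r in `[t, T]) _)%E.
have Q0 : (0 <= Q)%E by apply: integral_ge0 => r _; rewrite lee_fin sqr_ge0.
have [Qoo|Qfin] := eqVneq Q +oo%E.
  by rewrite Qoo gt0_muley ?lte_fin// leey.
pose f := phi \_ I; pose g : R -> R := \1_(`[t, T]%classic).
have mf : measurable_fun setT f.
  by apply/(measurable_restrictT phi) => //; exact: measurable_funS mphi.
have fQ : (nsq lam f <= Q)%E.
  rewrite /nsq /Q [leRHS]integral_mkcond; apply: le_lower_integral => r.
    by rewrite lee_fin sqr_ge0.
  rewrite /f !patchE; case: ifPn => [/set_mem/It h|_]; first by rewrite mem_set.
  by rewrite expr0n; case: ifP => _; rewrite lee_fin// sqr_ge0.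
have sf : sqint lam f by split => //; apply: (le_lt_trans fQ); rewrite ltey.
have gE r : (g r) ^+ 2 = g r by rewrite /g indicE; case: (_ \in _); rewrite ?expr1n ?expr0n.
have gT : (nsq lam g <= T%:E)%E.
  rewrite /nsq (_ : (fun x => _) = (fun r => (\1_(`[t, T]%classic) r)%:E)); last first.
    by apply/funext => r; rewrite gE.
  rewrite integral_indic//= setIT lebesgue_measure_itv/= lte_fin.
  case: ifP => _; last by rewrite lee_fin ltW.
  by rewrite -EFinB lee_fin gerBl.
have sg : sqint lam g.
  by split; [exact: measurable_indic|apply: (le_lt_trans gT); rewrite ltry].
have -> : Rintegral lam I phi = ip lam f g.
  rewrite /ip Rintegral_mkcond; congr Rintegral; apply/funext => r.
  rewrite /f /g patchE indicE; case: ifPn => [/set_mem/It h|_]; last by rewrite mul0r.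
  by rewrite mem_set// mulr1.
apply: (@le_trans _ _ ((ip lam f f * ip lam g g)%:E)).
  by rewrite lee_fin cauchy_schwarz_ip.
rewrite EFinM muleC !ip_self//.
by apply: lee_pmul => //; exact: nsq_ge0.
Qed.

Lemma Rintegral_split (phi : R -> R) s :
  lam.-integrable `[t, T] (EFin \o phi) -> t <= s <= T ->
  Rintegral lam `[t, T] phi = Rintegral lam `[t, s] phi + Rintegral lam `[s, T] phi.
Proof.
move=> iphi /andP[ts sT].
have is_ : lam.-integrable `]s, T] (EFin \o phi).
  by apply: integrableS iphi => //; apply: subset_itvr; rewrite bnd_simp.
have := @Rintegral_itvB _ phi (BLeft t) (BRight T) s iphi.
rewrite !bnd_simp => /(_ ts sT) => h.
rewrite -(@Rintegral_itv_obnd_cbnd _ s (BRight T)).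
  by rewrite -h addrC subrK.
exact: is_.
Qed.

Lemma Rintegral_right_continuous (phi : R -> R) :
  lam.-integrable `[t, T] (EFin \o phi) ->
  {within `[t, T], continuous (fun s => Rintegral lam `[s, T] phi)}.
Proof.
move=> iphi.
have cl := parameterized_integral_continuous tT' iphi.
have : {within `[t, T], continuous (fun s =>
    Rintegral lam `[t, T] phi - Rintegral lam `[t, s] phi)}.
  by move=> s; apply: cvgB; [exact: cvg_cst|exact: cl].
apply: subspace_eq_continuous => s; rewrite inE /= in_itv/= => sT.
rewrite /from_subspace (Rintegral_split iphi sT); ring.
Qed.

End RealIntegral.

Section Product.
Context {R : realType} {d : measure_display} {Om : measurableType d}.
Variables (P : probability Om R).
Local Notation lam := (@lebesgue_measure R).
Local Notation PL := (P \x lam)%E.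

Lemma ae_sections (Q : Om * R -> Prop) : {ae PL, forall p, Q p} ->
  {ae P, forall w, {ae lam, forall r, Q (w, r)}}.
Proof.
move=> [N [mN N0 QN]].
have mphi := measurable_fun_xsection lam mN.
have : {ae P, forall w, lam (xsection N w) = 0%E}.
  have i0 : (\int[P]_w `|(lam \o xsection N) w| = 0)%E.
    rewrite -[RHS]N0; apply: eq_integral => w _; rewrite gee0_abs//.
  have /ae_eq_integral_abs := i0 => /(_ measurableT mphi).
  by move=> h; apply: (ae_imply h) => w; apply.
move=> h; apply: (ae_imply h) => w Nw.
exists (xsection N w); split => //; first exact: measurable_xsection.
by move=> r /= nQ; rewrite /xsection /= inE; exact: QN.
Qed.

Lemma measurable_slab_integral (t T : R) (p : Om * measurableTypeR R -> \bar R) :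
  (forall x, 0 <= p x)%E -> measurable_fun (slab T t) p ->
  measurable_fun setT (fun w => \int[lam]_(r in `[t, T]) p (w, r))%E /\
  (\int[PL]_x ((p \_ (slab T t)) x) = \int[P]_w \int[lam]_(r in `[t, T]) p (w, r))%E.
Proof.
move=> p0 mp.
have mF : measurable_fun setT (p \_ (slab T t)).
  exact: (measurable_restrictT _ (@measurable_slab R d Om T t)).1 mp.
have F0 x : (0 <= (p \_ (slab T t)) x)%E by rewrite patchE; case: ifP.
have E w : fubini_F lam (p \_ (slab T t)) w = (\int[lam]_(r in `[t, T]) p (w, r))%E.
  rewrite /fubini_F [RHS]integral_mkcond; apply: eq_integral => r _.
  by rewrite !patchE /slab in_setX in_setT.
split.
  have := @measurable_fun_fubini_tonelli_F _ _ _ _ _ lam _ mF F0.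
  by congr measurable_fun; apply/funext => w; exact: E.
rewrite fubini_tonelli1//; apply: eq_integral => w _; exact: E.
Qed.

End Product.

(** * The delayed system *)

Section DelayedEstimate.
Context {R : realType} {d : measure_display} {Om : measurableType d}.
Variables (P : probability Om R) (W : Om -> R -> R) (T : R).
Hypotheses (brW : is_brownian P W T) (cP : measure_is_complete P).
Local Notation lam := (@lebesgue_measure R).
Local Notation PL := (P \x lam)%E.
Variables (alpha : probability (measurableTypeR R) R) (t : R).
Hypotheses (tT : 0 <= t <= T) (T0 : 0 < T).

Let tT' : t <= T. Proof. by case/andP: tT. Qed.
Let TT : t <= T <= T. Proof. by rewrite tT' lexx. Qed.
Let tt : t <= t <= T. Proof. by rewrite tT' lexx. Qed.

Variables (U V Z : Om -> R -> R).
Hypotheses (fU : {ae P, forall w, frozen_path t T (U w)}).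
Hypotheses (fV : {ae P, forall w, frozen_path t T (V w)}).
Hypotheses (mU : forall s, t <= s <= T -> measurable_fun setT (U ^~ s)).
Hypotheses (mV : forall s, t <= s <= T -> measurable_fun setT (V ^~ s)).

Variables (c kappa : R).
(** [c] is the Lipschitz constant after Young's inequality. The terminal value costs c, the noise
    and the Z-part of the drifts cost c T, the remaining part of the drifts costs c T^2; [kappa]
    dominates all of them. *)
Hypotheses (c0 : 0 <= c) (cT1 : c * T <= kappa) (c1 : c <= kappa) (cT2 : c * T ^+ 2 <= kappa).

Let kappa0 : 0 <= kappa. Proof. exact: le_trans c1. Qed.

Let a w := dense_sup t T U w.
Let v w := dense_sup t T V w.
Let A := (\int[P]_w a w)%E.
Let B := (\int[P]_w v w)%E.

Let a0 w : (0 <= a w)%E. Proof. exact: dense_sup_ge0. Qed.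
Let v0 w : (0 <= v w)%E. Proof. exact: dense_sup_ge0. Qed.
Let ma : measurable_fun setT a. Proof. exact: measurable_dense_sup. Qed.
Let mv : measurable_fun setT v. Proof. exact: measurable_dense_sup. Qed.
Let A0 : (0 <= A)%E. Proof. exact: integral_ge0. Qed.
Let B0 : (0 <= B)%E. Proof. exact: integral_ge0. Qed.

Let ua w s : frozen_path t T (U w) -> t <= s <= T -> (((U w s) ^+ 2)%:E <= a w)%E.
Proof. by move=> [cU _]; exact: dense_sup_continuous. Qed.

Let va w s : frozen_path t T (V w) -> t <= s <= T -> (((V w s) ^+ 2)%:E <= v w)%E.
Proof. by move=> [cV _]; exact: dense_sup_continuous. Qed.

Lemma diffusion_nsq (H : Om * measurableTypeR R -> R) (ps : Om * measurableTypeR R -> \bar R) :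
  measurable_fun setT H -> (forall p, ~ (t <= p.2 <= T) -> H p = 0) ->
  (forall p, 0 <= ps p)%E -> measurable_fun (slab T t) ps ->
  {ae P, forall w, {ae lam, forall r, t <= r <= T ->
    (((H (w, r)) ^+ 2)%:E <= c%:E * delay2 alpha T (U w) (V w) r + ps (w, r))%E}} ->
  (nsq PL H <= kappa%:E * (A + B) + \int[P]_w \int[lam]_(r in `[t, T]) ps (w, r))%E.
Proof.
move=> mH H0 ps0 mps HH.
have [mips _] := measurable_slab_integral P ps0 mps.
have ips0 w : (0 <= \int[lam]_(r in `[t, T]) ps (w, r))%E by exact: integral_ge0.
rewrite /nsq fubini_tonelli1; first last.
- by move=> p; rewrite lee_fin sqr_ge0.
- exact: measurable_sqr_EFin.
rewrite /A /B -ge0_integralD// -ge0_integralZl ?lee_fin//; last 2 first.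
- exact: emeasurable_funD.
- by move=> w _; exact: adde_ge0.
rewrite -ge0_integralD//; last 2 first.
- by move=> w _; rewrite mule_ge0 ?lee_fin// adde_ge0.
- by apply: measurable_funeM; exact: emeasurable_funD.
apply: ae_le_lower_integral.
- by move=> w; apply: integral_ge0 => r _; rewrite lee_fin sqr_ge0.
- by move=> w; rewrite adde_ge0// mule_ge0 ?lee_fin// adde_ge0.
- apply: emeasurable_funD => //; apply: measurable_funeM; exact: emeasurable_funD.
apply: (ae_imply2 (ae_and fU fV) HH) => w [fUw fVw] Hw.
have mpw : measurable_fun `[t, T] (fun r => ps (w, r)).
  apply: (@measurable_comp _ _ _ _ _ _ (slab T t) ps `[t, T] (fun r => (w, r))) => //.
  - exact: measurable_slab.
  - by move=> _ [r rT <-].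
  - exact: measurable_funTS (measurable_pair1 w).
have := @diffusion_bound R alpha t T tT (U w) (V w) (a w) (v w) fUw fVw
  (fun s => ua fUw) (fun s => va fVw) c (fun r => ps (w, r)) c0 (fun r => ps0 _) mpw
  (fun r => H (w, r)) Hw.
have E : (\int[lam]_r ((H (w, r)) ^+ 2)%:E = \int[lam]_(r in `[t, T]) ((H (w, r)) ^+ 2)%:E)%E.
  rewrite [RHS]integral_mkcond; apply: eq_integral => r _; rewrite patchE mem_setE in_itv/=.
  by case: ifPn => // /negP ntr; rewrite H0// expr0n.
rewrite /fubini_F E.
move=> h; apply: (le_trans h); apply: leeD2r; apply: lee_wpmul2r.
  exact: adde_ge0.
by rewrite lee_fin.
Qed.

Hypothesis mZ : measurable_fun (slab T t) (fun p => Z p.1 p.2).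
Hypothesis Z0 : forall w s, - T <= s < t -> Z w s = 0.

Let D w := nsq lam (cut t T (Z w)).

Hypothesis D_fin : (\int[P]_w nsq lam (cut t T (Z w)) < +oo)%E.

Let D0 w : (0 <= D w)%E. Proof. exact: nsq_ge0. Qed.

Let mZ2 : measurable_fun (slab T t) (fun p => ((Z p.1 p.2) ^+ 2)%:E).
Proof. by apply/measurable_EFinP; exact: measurable_funX. Qed.

Let DE : D = (fun w => \int[lam]_(r in `[t, T]) ((Z w r) ^+ 2)%:E)%E.
Proof.
apply/funext => w; rewrite /D /nsq [RHS]integral_mkcond; apply: eq_integral => r _.
rewrite /cut !patchE; case: ifPn => //; by rewrite expr0n.
Qed.

Let Z20 (p : Om * measurableTypeR R) : (0 <= ((Z p.1 p.2) ^+ 2)%:E :> \bar R)%E.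
Proof. by rewrite lee_fin sqr_ge0. Qed.

Let mD : measurable_fun setT D.
Proof. by rewrite DE; have [] := measurable_slab_integral P Z20 mZ2. Qed.

Lemma ae_null_before_path : {ae P, forall w, null_before_path t T (Z w)}.
Proof.
have iD : P.-integrable setT D.
  apply/integrableP; split => //; apply: le_lt_trans D_fin.
  by apply: le_lower_integral_set => w _; rewrite ?gee0_abs.
apply: (ae_imply (integrable_ae measurableT iD)) => w fw; split.
- apply: (@measurable_comp _ _ _ _ _ _ (slab T t)
      (fun p => Z p.1 p.2) `[t, T] (fun r => (w, r))) => //.
  + exact: measurable_slab.
  + by move=> _ [r rT <-].
  + exact: measurable_funTS (measurable_pair1 w).
- exact: Z0.
- by rewrite ltey_eq fw.
Qed.

Let iD := (\int[P]_w D w)%E.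

Let iD0 : (0 <= iD)%E. Proof. exact: integral_ge0. Qed.

(** One random variable [q] bounds the squared integrals over all time sets, which gives the
    uniformity in time of the forward and backward estimates. The factor T of [sqr_Rintegral_le]
    times the c T of [drift_sqr_bound] is the origin of c T^2. *)
Lemma delayed_drift (beta : Om -> R -> R) (pb : Om * measurableTypeR R -> \bar R) :
  (forall p, 0 <= pb p)%E -> measurable_fun (slab T t) pb ->
  {ae P, forall w, lam.-integrable `[t, T] (EFin \o beta w)} ->
  {ae P, forall w, {ae lam, forall r, t <= r <= T ->
    (((beta w r) ^+ 2)%:E <= c%:E * delay3 alpha T (U w) (V w) (Z w) r + pb (w, r))%E}} ->
  exists q, [/\ measurable_fun setT q, forall w, (0 <= q w)%E,
    (\int[P]_w q w = kappa%:E * (A + B + iD) +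
       T%:E * \int[P]_w \int[lam]_(r in `[t, T]) pb (w, r))%E &
    {ae P, forall w, forall I : set R, measurable I -> I `<=` `[t, T] ->
      (((Rintegral lam I (beta w)) ^+ 2)%:E <= q w)%E}].
Proof.
move=> pb0 mpb ib Hb.
have [mipb _] := measurable_slab_integral P pb0 mpb.
have ipb0 w : (0 <= \int[lam]_(r in `[t, T]) pb (w, r))%E by exact: integral_ge0.
have T0' : 0 <= T by exact: ltW.
have avD0 w : (0 <= a w + v w + D w)%E by exact: (adde_ge0 (adde_ge0 (a0 w) (v0 w)) (D0 w)).
have mavD : measurable_fun setT (fun w => a w + v w + D w)%E.
  by apply: emeasurable_funD => //; exact: emeasurable_funD.
exists (fun w => kappa%:E * (a w + v w + D w) + T%:E * \int[lam]_(r in `[t, T]) pb (w, r))%E.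
split.
- exact: measurable_comb2.
- by move=> w; exact: comb2_ge0.
- rewrite integral_comb2//; congr (_ * _ + _)%E.
  rewrite ge0_integralD//; last 2 first.
  + by move=> w _; exact: adde_ge0.
  + exact: emeasurable_funD.
  by rewrite ge0_integralD.
apply: (ae_imply2 (ae_and (ae_and fU fV) (ae_and ae_null_before_path ib)) Hb).
move=> w [[fUw fVw] [nZw ibw]] Hw I mI It.
apply: (le_trans (sqr_Rintegral_le tT T0 ibw mI It)).
have mpw : measurable_fun `[t, T] (fun r => pb (w, r)).
  apply: (@measurable_comp _ _ _ _ _ _ (slab T t) pb `[t, T] (fun r => (w, r))) => //.
  - exact: measurable_slab.
  - by move=> _ [r rT <-].
  - exact: measurable_funTS (measurable_pair1 w).
have h := @drift_sqr_bound R alpha t T tT (U w) (V w) (Z w) (a w) (v w) fUw fVw nZw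
  (fun s => ua fUw) (fun s => va fVw) c (fun r => pb (w, r)) c0 (fun r => pb0 _) mpw
  (beta w) Hw.
apply: (@le_trans _ _ (T%:E * ((c * T)%:E * (a w + v w) + c%:E * D w +
  \int[lam]_(r in `[t, T]) pb (w, r))))%E.
  by apply: lee_wpmul2l; rewrite ?lee_fin.
have cT0 : 0 <= c * T by exact: mulr_ge0.
have x0 := adde_ge0 (a0 w) (v0 w).
have y0 : (0 <= (c * T)%:E * (a w + v w))%E by rewrite mule_ge0 ?lee_fin.
have z0 : (0 <= c%:E * D w)%E by rewrite mule_ge0 ?lee_fin.
have yz0 := adde_ge0 y0 z0.
rewrite (@ge0_muleDr _ T%:E _ _ yz0 (ipb0 w)) (@ge0_muleDr _ T%:E _ _ y0 z0).
rewrite (@ge0_muleDr _ kappa%:E _ _ x0 (D0 w)) !muleA -!EFinM; apply: leeD2r.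
apply: leeD; apply: lee_wpmul2r => //; rewrite lee_fin.
- by rewrite (_ : T * (c * T) = c * T ^+ 2)//; ring.
- by rewrite mulrC.
Qed.

Variables (J M : Om -> R -> R) (HJ HZ : Om * measurableTypeR R -> R).
Hypotheses (ijJ : ito_pair P W T t HJ J) (ijM : ito_pair P W T t HZ M).
Hypothesis HJ0 : forall p, ~ (t <= p.2 <= T) -> HJ p = 0.
Hypothesis HZ0 : forall p, ~ (t <= p.2 <= T) -> HZ p = 0.
Hypothesis aeZ : {ae PL, forall p : Om * R, t <= p.2 <= T -> Z p.1 p.2 = HZ p}.

(** Ties Ito's isometry, which speaks of [HZ], to the process Z, which equals [HZ] only almost
    everywhere on [t, T]. *)
Lemma nsq_integrandE : nsq PL HZ = (\int[P]_w nsq lam (cut t T (Z w)))%E.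
Proof.
have [mHZ _ _] := ijM.
rewrite -[RHS]/(\int[P]_w D w)%E DE.
have [_ <-] := measurable_slab_integral P Z20 mZ2.
apply: ge0_ae_eq_integral => //.
- exact: measurable_sqr_EFin.
- exact: (measurable_restrictT _ (@measurable_slab R d Om T t)).1 mZ2.
- by move=> p _; rewrite lee_fin sqr_ge0.
- by move=> p _; rewrite patchE; case: ifP.
- apply: (ae_imply aeZ) => p h _; rewrite patchE; case: ifPn.
    by rewrite inE /slab /= in_itv/= => -[_ /h ->].
  rewrite notin_setE /slab /= in_itv/= => np; rewrite HZ0 ?expr0n// => h'.
  exact: np.
Qed.

Lemma delayed_estimate (beta phi : Om -> R -> R) (gam : Om -> R) (u0 : R)
    (pb pf ps : Om * measurableTypeR R -> \bar R) (pg : Om -> \bar R)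
    (nb nf ns ng : R) :
  44 * kappa <= 8 / 9 ->
  (\int[P]_w dense_sup t T U w < +oo)%E -> (\int[P]_w dense_sup t T V w < +oo)%E ->
  adapted_to P W t (V ^~ t) ->
  (forall p, 0 <= pb p)%E -> measurable_fun (slab T t) pb ->
  (forall p, 0 <= pf p)%E -> measurable_fun (slab T t) pf ->
  (forall p, 0 <= ps p)%E -> measurable_fun (slab T t) ps ->
  (forall w, 0 <= pg w)%E -> measurable_fun setT pg ->
  (\int[P]_w \int[lam]_(r in `[t, T]) pb (w, r) <= nb%:E)%E ->
  (\int[P]_w \int[lam]_(r in `[t, T]) pf (w, r) <= nf%:E)%E ->
  (\int[P]_w \int[lam]_(r in `[t, T]) ps (w, r) <= ns%:E)%E ->
  (\int[P]_w pg w <= ng%:E)%E ->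
  {ae P, forall w, lam.-integrable `[t, T] (EFin \o beta w)} ->
  {ae P, forall w, lam.-integrable `[t, T] (EFin \o phi w)} ->
  {ae P, forall w, {ae lam, forall r, t <= r <= T ->
    (((beta w r) ^+ 2)%:E <= c%:E * delay3 alpha T (U w) (V w) (Z w) r + pb (w, r))%E}} ->
  {ae P, forall w, {ae lam, forall r, t <= r <= T ->
    (((phi w r) ^+ 2)%:E <= c%:E * delay3 alpha T (U w) (V w) (Z w) r + pf (w, r))%E}} ->
  {ae P, forall w, {ae lam, forall r, t <= r <= T ->
    (((HJ (w, r)) ^+ 2)%:E <= c%:E * delay2 alpha T (U w) (V w) r + ps (w, r))%E}} ->
  {ae P, forall w, (((gam w) ^+ 2)%:E <= c%:E * delay1 alpha T (U w) T + pg w)%E} ->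
  {ae P, forall w, forall s, t <= s <= T ->
    U w s = u0 + Rintegral lam `[t, s] (beta w) + J w s /\
    V w s = gam w + Rintegral lam `[s, T] (phi w) - (M w T - M w s)} ->
  (\int[P]_w dense_sup t T U w + \int[P]_w dense_sup t T V w + nsq PL HZ <=
    (9 * (3 * u0 ^+ 2 + 3 * T * nb + 17 * T * nf + 12 * ns + 12 * ng))%:E)%E.
Proof.
move=> k44 Afin Bfin aVt pb0 mpb pf0 mpf ps0 mps pg0 mpg Nb Nf Ns Ng ib iphi Hb Hf Hs Hg eqUV.
have [qb [mqb qb0 qbE Bq]] := delayed_drift pb0 mpb ib Hb.
have [qf [mqf qf0 qfE Fq]] := delayed_drift pf0 mpf iphi Hf.
have [mHJ _ _] := ijJ.
have sJ := diffusion_nsq mHJ HJ0 ps0 mps Hs.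
have subI (s s' : R) : t <= s -> s' <= T -> `[s, s']%classic `<=` `[t, T]%classic.
  move=> ts sT x /=; rewrite !in_itv/= => /andP[sx xs].
  by rewrite (le_trans ts sx) (le_trans xs sT).
have eU := @forward_estimate _ _ _ P W T brW cP t tT U
  (fun w s => Rintegral lam `[t, s] (beta w)) J HJ u0 qb ijJ qb0 mqb.
have {}eU := eU (ae_imply2 eqUV Bq _).
have /eU {}eU : forall w, (forall s, t <= s <= T ->
    U w s = u0 + Rintegral lam `[t, s] (beta w) + J w s /\
    V w s = gam w + Rintegral lam `[s, T] (phi w) - (M w T - M w s)) ->
    (forall I : set R, measurable I -> I `<=` `[t, T] ->
      (((Rintegral lam I (beta w)) ^+ 2)%:E <= qb w)%E) ->
    forall s, t <= s <= T -> U w s = u0 + Rintegral lam `[t, s] (beta w) + J w s /\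
      (((Rintegral lam `[t, s] (beta w)) ^+ 2)%:E <= qb w)%E.
  move=> w h1 h2 s sT; split; first by case: (h1 s sT).
  by apply: h2 => //; apply: subI => //; case/andP: sT.
pose qg w := (kappa%:E * a w + 1%:E * pg w)%E.
have qg0 w : (0 <= qg w)%E by exact: comb2_ge0.
have mqg : measurable_fun setT qg by exact: measurable_comb2.
have qgE : (\int[P]_w qg w = kappa%:E * A + 1%:E * \int[P]_w pg w)%E by exact: integral_comb2.
have sVt : sqint P (V ^~ t).
  split; first exact: mV.
  apply: le_lt_trans Bfin; apply: ae_le_lower_integral => //.
  - by move=> w; rewrite lee_fin sqr_ge0.
  - by apply: (ae_imply fV) => w fVw; exact: va.
have aeB : {ae P, forall w, (((gam w) ^+ 2)%:E <= qg w)%E /\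
  forall s, t <= s <= T -> [/\ V w s = gam w + Rintegral lam `[s, T] (phi w) - (M w T - M w s),
    (((Rintegral lam `[s, T] (phi w)) ^+ 2)%:E <= qf w)%E &
    (((Rintegral lam `[t, T] (phi w) - Rintegral lam `[s, T] (phi w)) ^+ 2)%:E <= qf w)%E]}.
  apply: (ae_imply2 (ae_and (ae_and fU Hg) (ae_and eqUV iphi)) Fq).
  move=> w [[fUw gw] [ew iw]] Fw; split.
    apply: (le_trans gw); rewrite /qg mul1e; apply: leeD2r.
    have h : (delay1 alpha T (U w) T <= a w)%E.
      by apply: (@delay1_le R alpha t T tT (U w) (a w) fUw (fun s => ua fUw)).
    apply: (@le_trans _ _ (c%:E * a w)%E).
      by apply: lee_wpmul2l; rewrite ?lee_fin.
    by apply: lee_wpmul2r => //; rewrite lee_fin.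
  move=> s sT; have /andP[ts sT'] := sT; split.
  - by case: (ew s sT).
  - by apply: Fw => //; exact: subI.
  - rewrite (Rintegral_split iw sT) addrK.
    by apply: Fw => //; exact: subI.
have eZ := backward_integrand_estimate brW cP tT ijM qg0 qf0 mqg mqf aVt sVt aeB.
have eV := backward_estimate brW cP tT ijM qg0 qf0 mqg mqf aVt sVt aeB.
rewrite nsq_integrandE in eZ *.
rewrite -[X in (X + _ + _)%E]/A -[X in (_ + X + _)%E]/B -[X in (_ + _ + X)%E]/iD.
(* Absorption subtracts a part of the unknown from both sides, so its three terms are first turned
   into real numbers. *)
have [rA EA] : exists r, A = r%:E by exists (fine A); rewrite fineK// ge0_fin_numE.
have [rB EB] : exists r, B = r%:E by exists (fine B); rewrite fineK// ge0_fin_numE.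
have [rD ED] : exists r, iD = r%:E by exists (fine iD); rewrite fineK// ge0_fin_numE.
have rA0 : 0 <= rA by rewrite -lee_fin -EA.
have rB0 : 0 <= rB by rewrite -lee_fin -EB.
have rD0 : 0 <= rD by rewrite -lee_fin -ED.
pose S := rA + rB + rD.
have Eqb : (\int[P]_w qb w <= (kappa * S + T * nb)%:E)%E.
  rewrite qbE EA EB ED -!EFinD -EFinM EFinD; apply: leeD2l.
  by rewrite EFinM; apply: lee_wpmul2l => //; rewrite lee_fin ltW.
have Eqf : (\int[P]_w qf w <= (kappa * S + T * nf)%:E)%E.
  rewrite qfE EA EB ED -!EFinD -EFinM EFinD; apply: leeD2l.
  by rewrite EFinM; apply: lee_wpmul2l => //; rewrite lee_fin ltW.
have Eqg : (\int[P]_w qg w <= (kappa * rA + ng)%:E)%E.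
  by rewrite qgE EA mul1e -EFinM EFinD; apply: leeD2l.
have Esj : (nsq PL HJ <= (kappa * (rA + rB) + ns)%:E)%E.
  apply: (le_trans sJ); rewrite EA EB -EFinD -EFinM EFinD; exact: leeD2l.
have {}eU : rA <= 3 * u0 ^+ 2 + (3 * (kappa * S + T * nb) + 12 * (kappa * (rA + rB) + ns)).
  rewrite -lee_fin -EA; apply: (le_trans eU); rewrite [leRHS]EFinD; apply: leeD2l.
  by rewrite [leRHS]EFinD !(EFinM 3) !(EFinM 12); apply: leeD; apply: lee_wpmul2l.
have {}eZ : rD <= 2 * (kappa * rA + ng) + 2 * (kappa * S + T * nf).
  rewrite -lee_fin -ED; apply: (le_trans eZ).
  by rewrite [leRHS]EFinD !(EFinM 2); apply: leeD; apply: lee_wpmul2l.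
have {}eV : rB <= 10 * (kappa * rA + ng) + 15 * (kappa * S + T * nf).
  rewrite -lee_fin -EB; apply: (le_trans eV).
  by rewrite [leRHS]EFinD !(EFinM 10) !(EFinM 15); apply: leeD; apply: lee_wpmul2l.
(* The three bounds add up to S <= data + 44 kappa S. In the data, 17 = 2 + 15 for the backward
   drift and 12 = 2 + 10 for the terminal value; the factor 9 is 1 / (1 - 8/9). *)
have S0 : 0 <= S by rewrite !addr_ge0.
have k1 : kappa * rA <= kappa * S by rewrite ler_wpM2l// /S; lra.
have k2 : kappa * (rA + rB) <= kappa * S by rewrite ler_wpM2l// /S; lra.
have k3 : 44 * kappa * S <= 8 / 9 * S by rewrite ler_wpM2r.
rewrite EA EB ED -!EFinD lee_fin -/S.
have ES : S = rA + rB + rD by [].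
lra.
Qed.

End DelayedEstimate.

(** * Coefficients at the null trajectory and along paths *)

Section Sections.
Context {R : realType}.

(** The sets whose section at [y] is an event form a sigma-algebra that contains the rectangles.
    Fixing null trajectories one at a time, this makes the data phi(t, 0) measurable. *)
Lemma smeasurable_section (X Y : Type) (S : sspace X) (S' : sspace Y)
    (f : X * Y -> R) y :
  sigma_algebra (points S) (events S) -> points S' y ->
  smeasurable (sprod S S') f -> smeasurable S (fun x => f (x, y)).
Proof.
move=> [S0 SC SU] Sy mf B mB; have := mf B mB.
have : points S `&` (fun x => f (x, y)) @^-1` B =
    [set x | (points (sprod S S') `&` f @^-1` B) (x, y)].
  by apply/seteqP; split => x /=; [move=> [? ?]|move=> [[? _] ?]].
move=> -> h; move: h; set E := (_ `&` _).
suff H : events (sprod S S') `<=` [set E | events S [set x | E (x, y)]] by apply: H.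
apply: smallest_sub.
  split => /=.
  - exact: S0.
  - move=> F hF; rewrite (_ : [set x | _] = points S `\` [set x | F (x, y)]); first exact: SC.
    by apply/seteqP; split => x /=; [move=> [[? _] ?]|move=> [? ?]].
  - move=> F hF; rewrite (_ : [set x | _] = \bigcup_k [set x | F k (x, y)]); first exact: SU.
    by apply/seteqP; split => x /= [k ? ?]; exists k.
move=> _ [A SA [C SC' <-]] /=.
have [Cy|nCy] := pselect (C y).
  rewrite (_ : [set x | _] = A)//; apply/seteqP; split => x /=; first by case.
  by split.
rewrite (_ : [set x | _] = set0)//; apply/seteqP; split => x //=; by case.
Qed.

Lemma sigma_algebra_sprod (X Y : Type) (S : sspace X) (S' : sspace Y) :
  sigma_algebra (points (sprod S S')) (events (sprod S S')).
Proof. exact: smallest_sigma_algebra. Qed.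

Context {d : measure_display} {Om : measurableType d}.

Lemma smeasurable_time (T : R) (F : Om * R -> R) : 0 < T ->
  smeasurable (sprod (SSpace setT (@measurable _ Om)) (time_space T)) F ->
  measurable_fun (slab T 0) (F : Om * measurableTypeR R -> R).
Proof.
move=> T0 mF _ B mB.
have := mF B mB; set E := (_ `&` _).
have -> : slab T 0 `&` F @^-1` B = slab T 0 `&` E.
  apply/seteqP; split => -[w r] /= [[_ rT] h]; last by case: h.
  split; split => //; split => //=; move: rT; rewrite /= !in_itv/= => /andP[r0 ->].
  by rewrite andbT (le_trans _ r0)// oppr_le0 ltW.
move=> hE; apply: measurableI; first exact: measurable_slab.
move: hE; move: E; apply: smallest_sub => /=.
  split; first exact: measurable0.
  - move=> A mA; apply: measurableD => //; exact: measurableX.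
  - by move=> A mA; exact: bigcupT_measurable.
by move=> _ [A mA [C [mC _] <-]]; exact: measurableX.
Qed.

Lemma null_path_Linfty (T : R) : Linfty T (@null_path R).
Proof. by split; [exact: measurable_cst|exists 0 => r _; rewrite normr0]. Qed.

Lemma null_path_L2 (T : R) : L2 T (@null_path R).
Proof.
split; first exact: measurable_cst.
rewrite (eq_integral (fun=> 0%E)); first by rewrite integral0 ltry.
by move=> r _; rewrite expr0n.
Qed.

Variables (P : probability Om R) (W : Om -> R -> R) (T : R).
Variables (alpha : probability (measurableTypeR R) R) (K : R).
Hypothesis T0 : 0 < T.

Lemma coef3_null_measurable (phi : @coef3 R d Om) : assumption_A1 P W T alpha K phi ->
  measurable_fun (slab T 0) (fun p : Om * measurableTypeR R =>
    phi p.1 p.2 (@null_path R) (@null_path R) (@null_path R)).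
Proof.
move=> [[m _] _ _ _].
apply: (smeasurable_time T0).
have h1 := smeasurable_section (S' := L2_space T alpha) (y := @null_path R)
  (sigma_algebra_sprod _ _) (null_path_L2 T) m.
have h2 := smeasurable_section (S' := Linfty_space T) (y := @null_path R)
  (sigma_algebra_sprod _ _) (null_path_Linfty T) h1.
exact: (smeasurable_section (S' := Linfty_space T) (y := @null_path R)
  (sigma_algebra_sprod _ _) (null_path_Linfty T) h2).
Qed.

Lemma coef2_null_measurable (sigma : @coef2 R d Om) : assumption_A2 P W T alpha K sigma ->
  measurable_fun (slab T 0) (fun p : Om * measurableTypeR R =>
    sigma p.1 p.2 (@null_path R) (@null_path R)).
Proof.
move=> [[m _] _ _ _].
apply: (smeasurable_time T0).
have h2 := smeasurable_section (S' := Linfty_space T) (y := @null_path R)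
  (sigma_algebra_sprod _ _) (null_path_Linfty T) m.
exact: (smeasurable_section (S' := Linfty_space T) (y := @null_path R)
  (sigma_algebra_sprod _ _) (null_path_Linfty T) h2).
Qed.

Hypotheses (brW : is_brownian P W T) (cP : measure_is_complete P).

Lemma coef1_null_measurable (g : @coef1 R d Om) : assumption_A3 P W T alpha K g ->
  measurable_fun setT (g ^~ (@null_path R)).
Proof.
move=> [m _].
have TT : 0 <= T <= T by rewrite lexx ltW.
apply: (adapted_to_measurable brW cP TT).
apply: (smeasurable_section (S' := L2_space T alpha) (y := @null_path R) _
  (null_path_L2 T) m).
exact: smallest_sigma_algebra.
Qed.

Variable t : R.
Hypothesis tT : 0 <= t <= T.
Local Notation lam := (@lebesgue_measure R).

(** With this as its second term, [ito_lincomb] yields the multiples of a single pair. *)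
Lemma ito_pair0 : ito_pair P W T t (fun=> 0) (fun _ _ => 0).
Proof.
split => //; first by move=> s _; exact: adapted_to_cst.
have z dd (U : measurableType dd) (mu : {measure set U -> \bar R}) :
    nsq mu (fun=> 0 - 0) = 0%E :> \bar R.
  by rewrite /nsq (eq_integral (fun=> 0%E)) ?integral0// => x _; rewrite subrr expr0n.
exists (fun _ _ => 0), (fun _ _ _ => 0); split.
- by move=> n; exact: elementary0.
- by under eq_fun do rewrite z; exact: cvg_cst.
- by move=> s _; under eq_fun do rewrite z; exact: cvg_cst.
Qed.

(** The exceptional set of (w, r) in (A1) does not depend on the paths, so that paths depending on w
    can be put in afterwards. *)
Lemma coef3_lipschitz (phi : @coef3 R d Om) : assumption_A1 P W T alpha K phi ->
  {ae P, forall w, {ae lam, forall r, t <= r <= T ->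
    forall u v z u' v' z', frozen_path t T u -> frozen_path t T v -> null_before_path t T z ->
      frozen_path t T u' -> frozen_path t T v' -> null_before_path t T z' ->
    (((phi w r (segment u r) (segment v r) (segment z r) -
       phi w r (segment u' r) (segment v' r) (segment z' r)) ^+ 2)%:E <=
     K%:E * delay3 alpha T (fun s => u s - u' s)%R (fun s => v s - v' s)%R
       (fun s => z s - z' s)%R r)%E}}.
Proof.
move=> [_ lip _ _].
apply: (ae_imply (ae_sections lip)) => w lw; apply: (ae_imply lw) => r /= h rT.
move=> u v z u' v' z' fu fv nz fu' fv' nz'.
have r0T : 0 <= r <= T by case/andP: tT rT => t0 _ /andP[tr ->]; rewrite (le_trans t0).
have := h r0T _ _ _ _ _ _ (frozen_path_Linfty tT fu rT) (frozen_path_Linfty tT fv rT)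
  (null_before_path_L2 tT nz rT) (frozen_path_Linfty tT fu' rT) (frozen_path_Linfty tT fv' rT)
  (null_before_path_L2 tT nz' rT).
by rewrite real_normK ?num_real.
Qed.

Lemma coef2_lipschitz (phi : @coef2 R d Om) : assumption_A2 P W T alpha K phi ->
  {ae P, forall w, {ae lam, forall r, t <= r <= T ->
    forall u v u' v', frozen_path t T u -> frozen_path t T v ->
      frozen_path t T u' -> frozen_path t T v' ->
    (((phi w r (segment u r) (segment v r) - phi w r (segment u' r) (segment v' r)) ^+ 2)%:E <=
     K%:E * delay2 alpha T (fun s => u s - u' s)%R (fun s => v s - v' s)%R r)%E}}.
Proof.
move=> [_ lip _ _].
apply: (ae_imply (ae_sections lip)) => w lw; apply: (ae_imply lw) => r /= h rT.
move=> u v u' v' fu fv fu' fv'.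
have r0T : 0 <= r <= T by case/andP: tT rT => t0 _ /andP[tr ->]; rewrite (le_trans t0).
have := h r0T _ _ _ _ (frozen_path_Linfty tT fu rT) (frozen_path_Linfty tT fv rT)
  (frozen_path_Linfty tT fu' rT) (frozen_path_Linfty tT fv' rT).
by rewrite real_normK ?num_real.
Qed.

(** The Lipschitz bound of g is stated for square-integrable paths, while the segments of frozen
    paths are obtained as bounded ones. *)
Lemma Linfty_L2 h : Linfty T h -> L2 T h.
Proof.
move=> [mh [M hM]]; split => //.
apply: (@le_lt_trans _ _ (\int[lam]_(r in `[(- T)%R, 0%R]) (M ^+ 2)%:E)%E).
  apply: le_lower_integral_set => r rT; rewrite lee_fin ?sqr_ge0//.
  have := hM r rT; rewrite -(@real_normK _ (h r)) ?num_real// => h'.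
  by rewrite ler_sqr ?nnegrE// (le_trans _ h').
rewrite integral_cst//= lebesgue_measure_itv/= lte_fin oppr_lt0 T0.
by rewrite -EFinB -EFinM ltry.
Qed.

Lemma coef1_lipschitz (g : @coef1 R d Om) w u u' : assumption_A3 P W T alpha K g ->
  frozen_path t T u -> frozen_path t T u' ->
  (((g w (segment u T) - g w (segment u' T)) ^+ 2)%:E <=
    K%:E * delay1 alpha T (fun s => u s - u' s)%R T)%E.
Proof.
move=> [_ lip] fu fu'.
have TT : t <= T <= T by case/andP: tT => _ ->; rewrite lexx.
have := lip w _ _ (Linfty_L2 (frozen_path_Linfty tT fu TT))
  (Linfty_L2 (frozen_path_Linfty tT fu' TT)).
by rewrite real_normK ?num_real.
Qed.

End Sections.

(** * Pathwise properties of solutions *)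

Section SolutionFacts.
Context {R : realType} {d : measure_display} {Om : measurableType d}.
Variables (P : probability Om R) (W : Om -> R -> R) (T : R).
Hypotheses (brW : is_brownian P W T) (cP : measure_is_complete P).
Local Notation lam := (@lebesgue_measure R).
Local Notation PL := (P \x lam)%E.
Variables (t beta : R).
Hypotheses (tT : 0 <= t <= T) (T0 : 0 < T) (beta0 : 0 <= beta).

Let tT' : t <= T. Proof. by case/andP: tT. Qed.
Let t0 : 0 <= t. Proof. by case/andP: tT. Qed.

Lemma nsq0_ae (f : Om -> R) : measurable_fun setT f -> nsq P f = 0%E ->
  {ae P, forall w, f w = 0}.
Proof.
move=> mf f0.
have i0 : (\int[P]_w `|((f w) ^+ 2)%:E| = 0)%E.
  by rewrite -[RHS]f0; apply: eq_integral => w _; rewrite gee0_abs// lee_fin sqr_ge0.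
have /ae_eq_integral_abs := i0 => /(_ measurableT (measurable_sqr_EFin mf)) h.
by apply: (ae_imply h) => w /(_ Logic.I) [] /eqP; rewrite sqrf_eq0 => /eqP.
Qed.

Lemma S2_dense_sup X : S2 P W t T beta X -> (\int[P]_w dense_sup t T X w < +oo)%E.
Proof.
move=> [_]; apply: le_lt_trans; apply: le_lower_integral => w.
  exact: dense_sup_ge0.
apply: dense_sup_le => k; have /andP[tk kT] := dense_time_itv tT' k.
have k0 : 0 <= dense_time t T k by exact: le_trans tk.
set r := dense_time t T k in tk kT k0 *.
apply: (@le_trans _ _ (expR (beta * r) * `|X w r| ^+ 2)%:E).
  rewrite lee_fin -(@real_normK _ (X w _)) ?num_real// ler_peMl ?sqr_ge0//.
  by rewrite -expR0 ler_expR mulr_ge0.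
by apply: ereal_sup_ubound; exists r => //=; rewrite in_itv/= k0.
Qed.

Lemma S2_measurable X s : S2 P W t T beta X -> t <= s <= T -> measurable_fun setT (X ^~ s).
Proof.
move=> [pX _] sT.
exact: (slab_section_measurable sT (predictable_measurable brW cP tT pX)).
Qed.

Lemma H2_nsq Z : H2 P W t T beta Z -> (\int[P]_w nsq lam (cut t T (Z w)) < +oo)%E.
Proof.
move=> [_]; apply: le_lt_trans; apply: le_lower_integral => w; first exact: nsq_ge0.
rewrite /nsq [leRHS]integral_mkcond; apply: le_lower_integral => s.
  by rewrite lee_fin sqr_ge0.
rewrite patchE; case: ifPn.
  rewrite inE/= in_itv/= => /andP[s0 sT].
  rewrite /cut patchE; case: ifPn => _; last first.
    by rewrite expr0n lee_fin mulr_ge0// ?sqr_ge0// expR_ge0.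
  rewrite lee_fin -(@real_normK _ (Z w _)) ?num_real// ler_peMl ?sqr_ge0//.
  by rewrite -expR0 ler_expR mulr_ge0.
rewrite notin_setE/= in_itv/= => ns; rewrite cut0 ?expr0n// => /andP[ts sT].
by apply: ns; rewrite sT (le_trans t0).
Qed.

Variables (b f : @coef3 R d Om) (sigma : @coef2 R d Om) (g : @coef1 R d Om).
Variables (x eps : R).

(** What the estimates use of a solution: the equations on [t, T], with the stochastic integrals
    named and their integrands extended by 0 to all times. *)
Record solution_facts (X Y Z J M : Om -> R -> R) (Hs Hz : Om * measurableTypeR R -> R) : Prop := {
  sf_X : {ae P, forall w, frozen_path t T (X w)} ;
  sf_Y : {ae P, forall w, frozen_path t T (Y w)} ;
  sf_mX : forall s, t <= s <= T -> measurable_fun setT (X ^~ s) ;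
  sf_mY : forall s, t <= s <= T -> measurable_fun setT (Y ^~ s) ;
  sf_aY : adapted_to P W t (Y ^~ t) ;
  sf_mZ : measurable_fun (slab T t) (fun p : Om * measurableTypeR R => Z p.1 p.2) ;
  sf_Z0 : forall w s, - T <= s < t -> Z w s = 0 ;
  sf_Xfin : (\int[P]_w dense_sup t T X w < +oo)%E ;
  sf_Yfin : (\int[P]_w dense_sup t T Y w < +oo)%E ;
  sf_Zfin : (\int[P]_w nsq lam (cut t T (Z w)) < +oo)%E ;
  sf_J : ito_pair P W T t Hs J ;
  sf_M : ito_pair P W T t Hz M ;
  sf_Hs0 : forall p, ~ (t <= p.2 <= T) -> Hs p = 0 ;
  sf_Hz0 : forall p, ~ (t <= p.2 <= T) -> Hz p = 0 ;
  sf_Hs : {ae PL, forall p : Om * R, t <= p.2 <= T -> along2 sigma X Y p.1 p.2 = Hs p} ;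
  sf_Hz : {ae PL, forall p : Om * R, t <= p.2 <= T -> Z p.1 p.2 = Hz p} ;
  sf_b : {ae P, forall w, lam.-integrable `[t, T] (EFin \o along3 b X Y Z w)} ;
  sf_f : {ae P, forall w, lam.-integrable `[t, T] (EFin \o along3 f X Y Z w)} ;
  sf_eq : {ae P, forall w, forall s, t <= s <= T ->
    X w s = x + Rintegral lam `[t, s] (along3 b X Y Z w) + Num.sqrt eps * J w s /\
    Y w s = g w (segment (X w) T) + Rintegral lam `[s, T] (along3 f X Y Z w)
            - (M w T - M w s)}
}.

(** Continuity of X and Y on [t, T] is read off the equations, whose drift and stochastic integrals
    have continuous paths. *)
Lemma fbsde_solution_facts X Y Z : fbsde_solution P W T b f sigma g beta t x eps X Y Z ->
  exists J M Hs Hz, solution_facts X Y Z J M Hs Hz.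
Proof.
move=> [[sX sY hZ] pre ibf [J [M [itoJ itoM eqXY]]]].
have [Hs [ijJ Hs0 aeHs]] := ito_integral_pair brW cP tT itoJ.
have [Hz [ijM Hz0 aeHz]] := ito_integral_pair brW cP tT itoM.
have [_ cJ _] := itoJ; have [_ cM _] := itoM.
have ib := ae_imply ibf (fun w h => proj1 h).
have if_ := ae_imply ibf (fun w h => proj2 h).
have eqs : {ae P, forall w, forall s, t <= s <= T ->
    X w s = x + Rintegral lam `[t, s] (along3 b X Y Z w) + Num.sqrt eps * J w s /\
    Y w s = g w (segment (X w) T) + Rintegral lam `[s, T] (along3 f X Y Z w)
            - (M w T - M w s)}.
  apply: (ae_imply eqXY) => w h s /andP[ts sT].
  have s0T : 0 <= s <= T by rewrite sT (le_trans t0).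
  by have := h s s0T; rewrite max_l.
(* With J(t) = 0 almost surely the equation gives X(t) = x, so that the prescribed value before t is
   the value at t. *)
have J0 : {ae P, forall w, J w t = 0}.
  apply: nsq0_ae; last exact: (ito_start brW cP tT ijJ).
  by have tt : t <= t <= T; [rewrite lexx|case: (ito_sqint_integral brW cP tT tt ijJ)].
exists J, M, Hs, Hz; split => //.
- apply: (ae_imply2 (ae_and (ae_and eqs J0) ib) cJ) => w [[h Jt] iw] cw; split.
    have cl := parameterized_integral_continuous tT' iw.
    have : {within `[t, T], continuous (fun s =>
        x + Rintegral lam `[t, s] (along3 b X Y Z w) + Num.sqrt eps * J w s)}.
      move=> s; apply: cvgD; last by apply: cvgMr; exact: cw.
      by apply: cvgD; [exact: cvg_cst|exact: cl].
    apply: subspace_eq_continuous => s; rewrite inE /= in_itv/= => sT.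
    by rewrite /from_subspace; have [-> _] := h s sT.
  move=> s sT; have [-> _ _] := pre w s sT.
  have tt : t <= t <= T by rewrite lexx.
  by have [-> _] := h t tt; rewrite set_itv1 Rintegral_set1 Jt mulr0 !addr0.
- apply: (ae_imply2 (ae_and eqs if_) cM) => w [h iw] cw; split.
    have cl := Rintegral_right_continuous tT iw.
    have : {within `[t, T], continuous (fun s =>
        g w (segment (X w) T) + Rintegral lam `[s, T] (along3 f X Y Z w) - (M w T - M w s))}.
      move=> s; apply: cvgB; last by apply: cvgB; [exact: cvg_cst|exact: cw].
      by apply: cvgD; [exact: cvg_cst|exact: cl].
    apply: subspace_eq_continuous => s; rewrite inE /= in_itv/= => sT.
    by rewrite /from_subspace; have [_ ->] := h s sT.
  by move=> s sT; have [_ -> _] := pre w s sT.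
- by move=> s; exact: S2_measurable.
- by move=> s; exact: S2_measurable.
- have [pY _] := sY; exact: (predictable_start tT pY).
- have [pZ _] := hZ; exact: (predictable_measurable brW cP tT pZ).
- by move=> w s sT; case: (pre w s sT).
- exact: S2_dense_sup.
- exact: S2_dense_sup.
- exact: H2_nsq.
Qed.

End SolutionFacts.

(** * A priori bound *)

Section Constants.
Context {R : realType}.
Variables (K T : R).
Hypotheses (K0 : 0 < K) (T0 : 0 < T).
Hypothesis small : (33 + 144 * K) * K * expR 1 * Num.max 1 (T ^+ 2) < 1.

Definition kappa : R := 3 / 2 * K * Num.max 1 (T ^+ 2).

Let m := Num.max 1 (T ^+ 2).

Let m1 : 1 <= m. Proof. by rewrite le_max lexx. Qed.
Let mT2 : T ^+ 2 <= m. Proof. by rewrite le_max lexx orbT. Qed.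
Let mT : T <= m.
Proof.
have [h|h] := leP T 1; first exact: le_trans m1.
by apply: le_trans mT2; rewrite expr2 ler_peMl// ltW.
Qed.

Let Km0 : 0 <= K * m. Proof. by rewrite mulr_ge0 ?(ltW K0)// (le_trans ler01). Qed.

(** The inequality exp(1/2) >= 3/2, squared. *)
Let e94 : 9 / 4 <= expR 1 :> R.
Proof.
rewrite (_ : 1 = 2%:R * 2^-1); last by rewrite divff// pnatr_eq0.
rewrite expRM_natl; have := expR_ge1Dx (2^-1 : R); rewrite expr2.
have : (0 : R) < 2^-1 by rewrite invr_gt0.
nra.
Qed.

Let Km : 33 * (K * m) * (9 / 4) < 1.
Proof.
apply: le_lt_trans small; rewrite -/m.
rewrite [leRHS](_ : _ = (33 + 144 * K) * (K * m) * expR 1); last by ring.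
apply: ler_pM => //; first by rewrite mulr_ge0.
by rewrite ler_wpM2r// lerDl mulr_ge0// ltW.
Qed.

Lemma kappa_T : 3 / 2 * K * T <= kappa.
Proof. by rewrite /kappa ler_wpM2l// mulr_ge0// ltW. Qed.

Lemma kappa_1 : 3 / 2 * K <= kappa.
Proof. by rewrite /kappa ler_peMr// mulr_ge0// ltW. Qed.

Lemma kappa_T2 : 3 / 2 * K * T ^+ 2 <= kappa.
Proof. by rewrite /kappa ler_wpM2l// mulr_ge0// ltW. Qed.

(** With m = max(1, T^2), [Km] says that K m < 4/297; then 44 * 3/2 = 66 and 66 * 4/297 = 8/9. *)
Lemma kappa_small : 44 * kappa <= 8 / 9.
Proof. by rewrite /kappa -/m -mulrA; move: Km; lra. Qed.

Lemma kappa_le1 : kappa <= 1.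
Proof. by have := kappa_small; lra. Qed.

(** T <= m, since T <= 1 or T <= T^2, and K m <= 1. This replaces T by 1/K in the constants. *)
Lemma horizon_le : T <= K^-1.
Proof.
rewrite -[K^-1]mul1r ler_pdivlMr// mulrC.
apply: (@le_trans _ _ (K * m)); first by rewrite ler_wpM2l// ltW.
by move: Km; lra.
Qed.

End Constants.

Section Young.
Context {R : realType}.

(** The sides differ by (p - 2 q)^2 / 2. The Lipschitz part is put in p: with the usual weight 2
    instead of 3/2 the total coefficient would be 88 K m, which K m < 4/297 does not keep below
    1. *)
Lemma sqrD_le_young (p q : R) : (p + q) ^+ 2 <= 3 / 2 * p ^+ 2 + 3 * q ^+ 2.
Proof. by have := sqr_ge0 (p - 2 * q); nra. Qed.

Lemma young_delay (K x y : R) (D : \bar R) : 0 < K ->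
  (((x - y) ^+ 2)%:E <= K%:E * D)%E -> (0 <= D)%E ->
  ((x ^+ 2)%:E <= (3 / 2 * K)%:E * D + (3 * y ^+ 2)%:E)%E.
Proof.
move=> K0 h D0; apply: (@le_trans _ _ ((3/2)%:E * ((x - y) ^+ 2)%:E + (3 * y ^+ 2)%:E)%E).
  by rewrite -EFinM -EFinD lee_fin -{1}(subrK y x) sqrD_le_young.
by apply: leeD2r; rewrite (EFinM (3 / 2) K) -muleA; apply: lee_wpmul2l => //; rewrite lee_fin.
Qed.

End Young.

Section APriori.
Context {R : realType} {d : measure_display} {Om : measurableType d}.
Variables (P : probability Om R) (W : Om -> R -> R) (T : R).
Hypotheses (brW : is_brownian P W T) (cP : measure_is_complete P).
Local Notation lam := (@lebesgue_measure R).
Local Notation PL := (P \x lam)%E.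
Variables (alpha : probability (measurableTypeR R) R) (t K : R).
Hypotheses (tT : 0 <= t <= T) (T0 : 0 < T) (K0 : 0 < K).
Variables (b f : @coef3 R d Om) (sigma : @coef2 R d Om) (g : @coef1 R d Om).
Hypotheses (A1b : assumption_A1 P W T alpha K b) (A1f : assumption_A1 P W T alpha K f).
Hypotheses (A2 : assumption_A2 P W T alpha K sigma) (A3 : assumption_A3 P W T alpha K g).
Hypothesis small : (33 + 144 * K) * K * expR 1 * Num.max 1 (T ^+ 2) < 1.
Variable x : R.

Local Notation facts := (solution_facts P W T t b f sigma g x).
Local Notation kap := (kappa K T).
Local Notation c := (3 / 2 * K).

Let t0 : 0 <= t. Proof. by case/andP: tT. Qed.
Let tT' : t <= T. Proof. by case/andP: tT. Qed.
Let c0 : 0 <= c. Proof. by rewrite mulr_ge0// ltW. Qed.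
Let TT : t <= T <= T. Proof. by rewrite tT' lexx. Qed.

Lemma frozen_null : frozen_path t T (@null_path R).
Proof. by split => // s; exact: cvg_cst. Qed.

Lemma null_before_null : null_before_path t T (@null_path R).
Proof.
split => //; first exact: measurable_cst.
rewrite (_ : cut t T _ = fun=> 0); first by case: (sqint0 lam).
by apply/funext => s; rewrite /cut patchE; case: ifP.
Qed.

Let sub_null (u : R -> R) : (fun s => u s - null_path s) = u.
Proof. by apply/funext => s; rewrite subr0. Qed.

Definition pert3 (phi : @coef3 R d Om) (p : Om * measurableTypeR R) : \bar R :=
  (3 * (phi p.1 p.2 (@null_path R) (@null_path R) (@null_path R)) ^+ 2)%:E.

Definition pert2 (phi : @coef2 R d Om) (p : Om * measurableTypeR R) : \bar R :=
  (3 * (phi p.1 p.2 (@null_path R) (@null_path R)) ^+ 2)%:E.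

Let slab_sub : slab T t `<=` (slab T 0 : set (Om * measurableTypeR R)).
Proof.
move=> -[w r] [_]; rewrite /= !in_itv/= => /andP[tr rT]; split => //=.
by rewrite in_itv/= rT (le_trans t0).
Qed.

Let pert_integral (h : Om * measurableTypeR R -> R) : measurable_fun (slab T 0) h ->
  measurable_fun (slab T t) (fun p => (3 * (h p) ^+ 2)%:E) /\
  (\int[P]_w \int[lam]_(r in `[t, T]) (3 * (h (w, r)) ^+ 2)%:E <=
   3%:E * \int[P]_w \int[lam]_(r in `[0%R, T]) (`|h (w, r)| ^+ 2)%:E)%E.
Proof.
move=> mh.
have m2 : measurable_fun (slab T 0) (fun p => (`|h p| ^+ 2)%:E).
  by apply/measurable_EFinP; apply: measurable_funX; exact: measurableT_comp.
have m3 : measurable_fun (slab T 0) (fun p => (3 * (h p) ^+ 2)%:E).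
  by apply/measurable_EFinP; apply: measurable_funM => //; exact: measurable_funX.
have p0 p : (0 <= (`|h p| ^+ 2)%:E :> \bar R)%E by rewrite lee_fin sqr_ge0.
have [mI _] := measurable_slab_integral P p0 m2.
split; first by apply: measurable_funS slab_sub m3; exact: measurable_slab.
rewrite -ge0_integralZl//; last by move=> w _; exact: integral_ge0.
apply: le_lower_integral => w.
  by apply: integral_ge0 => r _; rewrite lee_fin mulr_ge0// sqr_ge0.
rewrite -ge0_integralZl//; last first.
  apply: (@measurable_comp _ _ _ _ _ _ (slab T 0)
      (fun p => (`|h p| ^+ 2)%:E) `[0%R, T] (fun r => (w, r))) => //.
  - exact: measurable_slab.
  - by move=> _ [r rT <-].
  - exact: measurable_funTS (measurable_pair1 w).
rewrite [leLHS]integral_mkcond [leRHS]integral_mkcond; apply: le_lower_integral => r.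
  by rewrite patchE; case: ifP => // _; rewrite lee_fin mulr_ge0// sqr_ge0.
rewrite !patchE; case: ifPn => [|_].
  rewrite inE/= in_itv/= => /andP[tr rT].
  rewrite mem_set/= ?in_itv/= ?rT ?(le_trans t0)//.
  by rewrite real_normK ?num_real.
by case: ifP => // _; rewrite mule_ge0// lee_fin sqr_ge0.
Qed.

Lemma pert3P phi : assumption_A1 P W T alpha K phi ->
  measurable_fun (slab T t) (pert3 phi) /\
  (\int[P]_w \int[lam]_(r in `[t, T]) pert3 phi (w, r) <= (3 * fine (sqnorm3 P T phi))%:E)%E.
Proof.
move=> A1; have [_ _ _ fin] := A1.
have [m i] := pert_integral (coef3_null_measurable T0 A1); split => //.
apply: (le_trans i); rewrite EFinM; apply: lee_wpmul2l => //.
rewrite fineK// ge0_fin_numE//; apply: integral_ge0 => w _; apply: integral_ge0 => r _.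
by rewrite lee_fin sqr_ge0.
Qed.

Lemma pert2P phi : assumption_A2 P W T alpha K phi ->
  measurable_fun (slab T t) (pert2 phi) /\
  (\int[P]_w \int[lam]_(r in `[t, T]) pert2 phi (w, r) <= (3 * fine (sqnorm2 P T phi))%:E)%E.
Proof.
move=> A2'; have [_ _ _ fin] := A2'.
have [m i] := pert_integral (coef2_null_measurable T0 A2'); split => //.
apply: (le_trans i); rewrite EFinM; apply: lee_wpmul2l => //.
rewrite fineK// ge0_fin_numE//; apply: integral_ge0 => w _; apply: integral_ge0 => r _.
by rewrite lee_fin sqr_ge0.
Qed.

Section OneSolution.
Variables (eps : R) (X Y Z J M : Om -> R -> R) (Hs Hz : Om * measurableTypeR R -> R).
Hypothesis sf : facts eps X Y Z J M Hs Hz.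
Hypotheses (eps0 : 0 <= eps) (eps1 : eps <= 1).

Let nZ := ae_null_before_path (sf_mZ sf) (sf_Z0 sf) (sf_Zfin sf).

Let drift_young phi : assumption_A1 P W T alpha K phi ->
  {ae P, forall w, {ae lam, forall r, t <= r <= T ->
    (((along3 phi X Y Z w r) ^+ 2)%:E <=
      c%:E * delay3 alpha T (X w) (Y w) (Z w) r + pert3 phi (w, r))%E}}.
Proof.
move=> A1; have lip := coef3_lipschitz tT A1.
apply: (ae_imply2 (ae_and (ae_and (sf_X sf) (sf_Y sf)) nZ) lip) => w [[fX fY] fZ] lw.
apply: (ae_imply lw) => r h rT.
have := h rT _ _ _ _ _ _ fX fY fZ frozen_null frozen_null null_before_null.
rewrite !sub_null => h'; exact: young_delay K0 h' (delay3_ge0 _ _ _ _ _ _).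
Qed.

Let diffusion_young : {ae P, forall w, {ae lam, forall r, t <= r <= T ->
    (((Hs (w, r)) ^+ 2)%:E <=
      c%:E * delay2 alpha T (X w) (Y w) r + pert2 sigma (w, r))%E}}.
Proof.
have lip := coef2_lipschitz tT A2.
have aeH := ae_sections (sf_Hs sf).
apply: (ae_imply2 (ae_and (ae_and (sf_X sf) (sf_Y sf)) aeH) lip) => w [[fX fY] hw] lw.
apply: (ae_imply2 hw lw) => r /= hr h rT.
have := h rT _ _ _ _ fX fY frozen_null frozen_null.
rewrite !sub_null -(hr rT) => h'; exact: young_delay K0 h' (delay2_ge0 _ _ _ _ _).
Qed.

Let terminal_young : {ae P, forall w, (((g w (segment (X w) T)) ^+ 2)%:E <=
   c%:E * delay1 alpha T (X w) T + (3 * (g w (@null_path R)) ^+ 2)%:E)%E}.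
Proof.
apply: (ae_imply (sf_X sf)) => w fX.
have := coef1_lipschitz T0 tT w A3 fX frozen_null.
rewrite !sub_null => h'; exact: young_delay K0 h' (delay1_ge0 _ _ _ _).
Qed.

(** By the equation at time T, Y(T) = g(X_T), which is square-integrable since Y is in S^2; the
    Lipschitz bound leads from g(X_T) to g(0). *)
Lemma sqnorm1_fin : (sqnorm1 P g < +oo)%E.
Proof.
have mX := sf_mX sf; have mY := sf_mY sf.
have mdX := measurable_dense_sup tT' mX; have mdY := measurable_dense_sup tT' mY.
have fin : ((2 * K)%:E * \int[P]_w dense_sup t T X w +
    2%:E * \int[P]_w dense_sup t T Y w < +oo)%E.
  by apply: lte_add_pinfty; apply: lte_mul_pinfty;
    rewrite ?lee_fin ?mulr_ge0 ?(ltW K0)//; [exact: sf_Xfin sf|exact: sf_Yfin sf].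
apply: le_lt_trans fin.
have dX0 := dense_sup_ge0 t T X; have dY0 := dense_sup_ge0 t T Y.
have K20 : 0 <= 2 * K by rewrite mulr_ge0// ltW.
rewrite -integral_comb2//; apply: ae_le_lower_integral.
- by move=> w; rewrite lee_fin sqr_ge0.
- by move=> w; exact: comb2_ge0.
- exact: measurable_comb2.
- apply: (ae_imply2 (ae_and (sf_X sf) (sf_Y sf)) (sf_eq sf)) => w [fX fY] h.
  have [cX _] := fX; have [cY _] := fY.
  have lip := coef1_lipschitz T0 tT w A3 fX frozen_null.
  rewrite !sub_null in lip.
  have dX : (delay1 alpha T (X w) T <= dense_sup t T X w)%E.
    by apply: (@delay1_le R alpha t T tT (X w) _ fX) => // s; exact: dense_sup_continuous.
  have dY := dense_sup_continuous tT' cY TT.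
  have [_ YT] := h T TT.
  have {}YT : Y w T = g w (segment (X w) T).
    by rewrite YT set_itv1 Rintegral_set1 subrr subr0 addr0.
  rewrite YT in dY.
  apply: (@le_trans _ _ (2%:E * ((g w (segment (X w) T) - g w (@null_path R)) ^+ 2)%:E +
     2%:E * ((g w (segment (X w) T)) ^+ 2)%:E)%E).
    rewrite -!EFinM -EFinD lee_fin real_normK ?num_real//.
    have := sqr_ge0 (2 * g w (segment (X w) T) - g w (@null_path R)); nra.
  apply: leeD; last exact: lee_wpmul2l.
  rewrite (EFinM 2 K) -muleA; apply: lee_wpmul2l => //.
  apply: (le_trans lip); apply: lee_wpmul2l => //; by rewrite lee_fin ltW.
Qed.

(** The bound of [delayed_estimate] with each of the data carrying the factor 3 of Young's
    inequality and T replaced by 1/K: 9 = 3 * 3, 51 = 17 * 3 and 36 = 12 * 3. *)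
Definition a_priori_bound : R := 9 * (3 * x ^+ 2 + 9 * K^-1 * fine (sqnorm3 P T b) +
  51 * K^-1 * fine (sqnorm3 P T f) + 36 * fine (sqnorm2 P T sigma) + 36 * fine (sqnorm1 P g)).

Let fine3_ge0 phi : 0 <= fine (sqnorm3 P T phi).
Proof.
apply: fine_ge0; apply: integral_ge0 => w _; apply: integral_ge0 => r _.
by rewrite lee_fin sqr_ge0.
Qed.

Lemma a_priori_estimate :
  (\int[P]_w dense_sup t T X w + \int[P]_w dense_sup t T Y w + nsq PL Hz <=
    a_priori_bound%:E)%E.
Proof.
have [mb ib] := pert3P A1b; have [mf if_] := pert3P A1f; have [ms is_] := pert2P A2.
have kT := kappa_T K0 T0; have k1 := kappa_1 T K0; have kT2 := kappa_T2 T K0.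
have p3 phi p : (0 <= pert3 phi p)%E by rewrite lee_fin mulr_ge0// sqr_ge0.
have p2 phi p : (0 <= pert2 phi p)%E by rewrite lee_fin mulr_ge0// sqr_ge0.
have mg3 : measurable_fun setT (fun w => (3 * (g w (@null_path R)) ^+ 2)%:E).
  apply/measurable_EFinP; apply: measurable_funM => //; apply: measurable_funX.
  exact: (coef1_null_measurable T0 brW cP A3).
have ig : (\int[P]_w (3 * (g w (@null_path R)) ^+ 2)%:E <= (3 * fine (sqnorm1 P g))%:E)%E.
  rewrite EFinM fineK; last first.
    rewrite ge0_fin_numE ?sqnorm1_fin//.
    by apply: integral_ge0 => w _; rewrite lee_fin sqr_ge0.
  rewrite /sqnorm1 -ge0_integralZl//.
  - apply: le_lower_integral => w; first by rewrite lee_fin mulr_ge0// sqr_ge0.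
    by rewrite -EFinM lee_fin real_normK ?num_real.
  - apply/measurable_EFinP; apply: measurable_funX; apply: measurableT_comp => //.
    exact: (coef1_null_measurable T0 brW cP A3).
(* The factor sqrt(eps) is moved into the integrand; since eps <= 1, the bound on the square of [Hs]
   still holds. *)
have ijJ := ito_lincomb brW cP tT (Num.sqrt eps) (sf_J sf) (ito_pair0 P W T t).
have H0 p : ~ (t <= p.2 <= T) -> Num.sqrt eps * Hs p + 0 = 0.
  by move=> /(sf_Hs0 sf) ->; rewrite mulr0 addr0.
have Hyoung : {ae P, forall w, {ae lam, forall r, t <= r <= T ->
    (((Num.sqrt eps * Hs (w, r) + 0) ^+ 2)%:E <=
      c%:E * delay2 alpha T (X w) (Y w) r + pert2 sigma (w, r))%E}}.
  apply: (ae_imply diffusion_young) => w hw; apply: (ae_imply hw) => r h rT.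
  apply: le_trans (h rT); rewrite lee_fin addr0 exprMn sqr_sqrtr//.
  by rewrite ler_piMl ?sqr_ge0.
have eqXY : {ae P, forall w, forall s, t <= s <= T ->
    X w s = x + Rintegral lam `[t, s] (along3 b X Y Z w) + (Num.sqrt eps * J w s + 0) /\
    Y w s = g w (segment (X w) T) + Rintegral lam `[s, T] (along3 f X Y Z w)
            - (M w T - M w s)}.
  by apply: (ae_imply (sf_eq sf)) => w h s sT; rewrite addr0; exact: h.
have := delayed_estimate brW cP tT T0 (sf_X sf) (sf_Y sf) (sf_mX sf) (sf_mY sf)
  c0 kT k1 kT2 (sf_mZ sf) (sf_Z0 sf) (sf_Zfin sf) ijJ (sf_M sf) H0 (sf_Hz0 sf)
  (sf_Hz sf) (kappa_small K0 small) (sf_Xfin sf) (sf_Yfin sf) (sf_aY sf)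
  (p3 b) mb (p3 f) mf (p2 sigma) ms (fun w => _) mg3 ib if_ is_ ig
  (sf_b sf) (sf_f sf) (drift_young A1b) (drift_young A1f) Hyoung terminal_young eqXY.
move=> h; apply: le_trans (h _) _.
  by move=> w; rewrite lee_fin mulr_ge0// sqr_ge0.
rewrite lee_fin /a_priori_bound ler_wpM2l//.
have TK := horizon_le K0 T0 small.
have hb := ler_wpM2r (fine3_ge0 b) TK; have hf := ler_wpM2r (fine3_ge0 f) TK.
lra.
Qed.

(** [Hs] is sigma along the solution, without the factor sqrt(eps): the data of the difference
    system. The a priori estimate bounds the suprema, whose coefficient kappa is at most 1. *)
Lemma diffusion_estimate : (nsq PL Hs <= (a_priori_bound + 3 * fine (sqnorm2 P T sigma))%:E)%E.
Proof.
have [ms is_] := pert2P A2; have [mH _ _] := sf_J sf.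
have p2 p : (0 <= pert2 sigma p)%E by rewrite lee_fin mulr_ge0// sqr_ge0.
have kT := kappa_T K0 T0; have k1 := kappa_1 T K0; have kT2 := kappa_T2 T K0.
have h := diffusion_nsq tT (sf_X sf) (sf_Y sf) (sf_mX sf) (sf_mY sf) c0 kT k1
  mH (sf_Hs0 sf) p2 ms diffusion_young.
apply: (le_trans h); rewrite EFinD; apply: leeD => //.
apply: le_trans a_priori_estimate.
have k0 : 0 <= kap by apply: le_trans k1.
have S0 : (0 <= \int[P]_w dense_sup t T X w + \int[P]_w dense_sup t T Y w)%E.
  by apply: adde_ge0; apply: integral_ge0 => w _; exact: dense_sup_ge0.
rewrite -[leLHS]adde0; apply: leeD; last exact: nsq_ge0.
rewrite -[leRHS]mul1e; apply: lee_wpmul2r => //.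
by rewrite lee_fin (kappa_le1 K0 small).
Qed.

End OneSolution.
End APriori.

(** * Difference of two solutions *)

Section PathDifference.
Context {R : realType}.
Local Notation lam := (@lebesgue_measure R).
Variables (t T : R).
Hypothesis tT : t <= T.

Lemma frozen_pathB u v : frozen_path t T u -> frozen_path t T v ->
  frozen_path t T (fun s => u s - v s).
Proof.
move=> [cu fu] [cv fv]; split.
  by move=> s; apply: cvgB; [exact: cu|exact: cv].
by move=> s sT; rewrite fu// fv.
Qed.

Lemma dense_sup_subadditive {d : measure_display} {Om : measurableType d}
    (U V : Om -> R -> R) w :
  (dense_sup t T (fun w s => U w s - V w s)%R w <=
    2%:E * dense_sup t T U w + 2%:E * dense_sup t T V w)%E.
Proof.
apply: dense_sup_le => k; set r := dense_time t T k.
apply: (@le_trans _ _ (2%:E * ((U w r) ^+ 2)%:E + 2%:E * ((V w r) ^+ 2)%:E)%E).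
  rewrite -!EFinM -EFinD lee_fin; have := sqr_ge0 (U w r + V w r); nra.
by apply: leeD; apply: lee_wpmul2l => //; exact: dense_sup_ge.
Qed.

(** Finiteness of the unknown of the difference system, for the absorption; [nsq_cut_diff_fin] does
    the same for Z. *)
Lemma dense_sup_diff_fin {d : measure_display} {Om : measurableType d}
    (P : probability Om R) (U V : Om -> R -> R) :
  (forall s, t <= s <= T -> measurable_fun setT (U ^~ s)) ->
  (forall s, t <= s <= T -> measurable_fun setT (V ^~ s)) ->
  (\int[P]_w dense_sup t T U w < +oo)%E -> (\int[P]_w dense_sup t T V w < +oo)%E ->
  (\int[P]_w dense_sup t T (fun w s => U w s - V w s)%R w < +oo)%E.
Proof.
move=> mU mV fU fV.
apply: (@le_lt_trans _ _ (2%:E * \int[P]_w dense_sup t T U w +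
    2%:E * \int[P]_w dense_sup t T V w)%E); last first.
  by apply: lte_add_pinfty; exact: lte_mul_pinfty.
have U0 := dense_sup_ge0 t T U; have V0 := dense_sup_ge0 t T V.
have mU' := measurable_dense_sup tT mU; have mV' := measurable_dense_sup tT mV.
rewrite -integral_comb2//; apply: le_lower_integral => w.
  exact: dense_sup_ge0.
exact: dense_sup_subadditive.
Qed.

Lemma measurable_nsq_cut {d : measure_display} {Om : measurableType d}
    (P : probability Om R) (Z : Om -> R -> R) :
  measurable_fun (slab T t) (fun p : Om * measurableTypeR R => Z p.1 p.2) ->
  measurable_fun setT (fun w => nsq lam (cut t T (Z w))) /\
  forall w, measurable_fun setT (cut t T (Z w)).
Proof.
move=> mZ.
have m2 : measurable_fun (slab T t) (fun p : Om * measurableTypeR R => ((Z p.1 p.2) ^+ 2)%:E).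
  by apply/measurable_EFinP; exact: measurable_funX.
have p0 (p : Om * measurableTypeR R) : (0 <= ((Z p.1 p.2) ^+ 2)%:E :> \bar R)%E.
  by rewrite lee_fin sqr_ge0.
split.
  have -> : (fun w => nsq lam (cut t T (Z w))) =
      (fun w => \int[lam]_(r in `[t, T]) ((Z w r) ^+ 2)%:E)%E.
    apply/funext => w; rewrite /nsq [RHS]integral_mkcond; apply: eq_integral => r _.
    by rewrite /cut !patchE; case: ifPn => //; rewrite expr0n.
  by have [] := measurable_slab_integral P p0 m2.
move=> w; apply: measurable_cut.
apply: (@measurable_comp _ _ _ _ _ _ (slab T t)
      (fun p => Z p.1 p.2) `[t, T] (fun r => (w, r))) => //.
- exact: measurable_slab.
- by move=> _ [r rT <-].
- exact: measurable_funTS (measurable_pair1 w).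
Qed.

Lemma nsq_cut_diff_fin {d : measure_display} {Om : measurableType d}
    (P : probability Om R) (Z Z' : Om -> R -> R) :
  measurable_fun (slab T t) (fun p : Om * measurableTypeR R => Z p.1 p.2) ->
  measurable_fun (slab T t) (fun p : Om * measurableTypeR R => Z' p.1 p.2) ->
  (\int[P]_w nsq lam (cut t T (Z w)) < +oo)%E ->
  (\int[P]_w nsq lam (cut t T (Z' w)) < +oo)%E ->
  (\int[P]_w nsq lam (cut t T (fun s => Z w s - Z' w s)%R) < +oo)%E.
Proof.
move=> /(measurable_nsq_cut P)[mD mc] /(measurable_nsq_cut P)[mD' mc'] f f'.
apply: (@le_lt_trans _ _ (2%:E * \int[P]_w nsq lam (cut t T (Z w)) +
    2%:E * \int[P]_w nsq lam (cut t T (Z' w)))%E); last first.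
  by apply: lte_add_pinfty; exact: lte_mul_pinfty.
rewrite -integral_comb2//; try by move=> w; exact: nsq_ge0.
apply: le_lower_integral => w; first exact: nsq_ge0.
apply: nsq_le_comb; [exact: mc|exact: mc'|by []|by []|move=> r].
rewrite /cut !patchE; case: ifPn => _; last by rewrite expr0n !mulr0 addr0.
have := sqr_ge0 (Z w r + Z' w r); nra.
Qed.

End PathDifference.

Section Difference.
Context {R : realType} {d : measure_display} {Om : measurableType d}.
Variables (P : probability Om R) (W : Om -> R -> R) (T : R).
Hypotheses (brW : is_brownian P W T) (cP : measure_is_complete P).
Local Notation lam := (@lebesgue_measure R).
Local Notation PL := (P \x lam)%E.
Variables (alpha : probability (measurableTypeR R) R) (t K : R).
Hypotheses (tT : 0 <= t <= T) (T0 : 0 < T) (K0 : 0 < K).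
Variables (b f : @coef3 R d Om) (sigma : @coef2 R d Om) (g : @coef1 R d Om).
Hypotheses (A1b : assumption_A1 P W T alpha K b) (A1f : assumption_A1 P W T alpha K f).
Hypotheses (A2 : assumption_A2 P W T alpha K sigma) (A3 : assumption_A3 P W T alpha K g).
Hypothesis small : (33 + 144 * K) * K * expR 1 * Num.max 1 (T ^+ 2) < 1.
Variables (x eps eps' : R).
Hypotheses (eps0 : 0 < eps) (eps_lt : eps < eps') (eps1 : eps' < 1).

Variables (X Y Z J M : Om -> R -> R) (Hs Hz : Om * measurableTypeR R -> R).
Variables (X' Y' Z' J' M' : Om -> R -> R) (Hs' Hz' : Om * measurableTypeR R -> R).
Hypothesis sf : solution_facts P W T t b f sigma g x eps X Y Z J M Hs Hz.
Hypothesis sf' : solution_facts P W T t b f sigma g x eps' X' Y' Z' J' M' Hs' Hz'.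

Local Notation c := (3 / 2 * K).
Let delta := Num.sqrt eps' - Num.sqrt eps.

Let tT' : t <= T. Proof. by case/andP: tT. Qed.
Let c0 : 0 <= c. Proof. by rewrite mulr_ge0// ltW. Qed.

(** 324 = 9 * 12 * 3: the absorption, the weight of the noise data in [delayed_estimate], and
    Young's inequality. *)
Definition difference_bound : R :=
  324 * (a_priori_bound P T K b f sigma g x + 3 * fine (sqnorm2 P T sigma)).

(** Drift and terminal differences are bounded by the Lipschitz conditions alone, without data; K is
    raised to 3/2 K, the constant shared with the noise. *)
Let weaken (y : R) (D : \bar R) : (y%:E <= K%:E * D)%E -> (0 <= D)%E ->
  (y%:E <= c%:E * D + 0)%E.
Proof.
move=> h D0; rewrite adde0; apply: (le_trans h); apply: lee_wpmul2r => //.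
by rewrite lee_fin; have := K0; lra.
Qed.

Let dX w s := X' w s - X w s.
Let dY w s := Y' w s - Y w s.
Let dZ w s := Z' w s - Z w s.

Let nZ := ae_null_before_path (sf_mZ sf) (sf_Z0 sf) (sf_Zfin sf).
Let nZ' := ae_null_before_path (sf_mZ sf') (sf_Z0 sf') (sf_Zfin sf').

Let ae_XY := ae_and (ae_and (sf_X sf) (sf_Y sf)) (ae_and (sf_X sf') (sf_Y sf')).

Let drift phi : assumption_A1 P W T alpha K phi ->
  {ae P, forall w, {ae lam, forall r, t <= r <= T ->
    (((along3 phi X' Y' Z' w r - along3 phi X Y Z w r) ^+ 2)%:E <=
      c%:E * delay3 alpha T (dX w) (dY w) (dZ w) r + 0)%E}}.
Proof.
move=> A1; have lip := coef3_lipschitz tT A1.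
apply: (ae_imply2 (ae_and ae_XY (ae_and nZ nZ')) lip).
move=> w [[[fX fY] [fX' fY']] [fZ fZ']] lw.
apply: (ae_imply lw) => r h rT; apply: weaken (delay3_ge0 _ _ _ _ _ _).
exact: (h rT _ _ _ _ _ _ fX' fY' fZ' fX fY fZ).
Qed.

Let HJ (p : Om * measurableTypeR R) := Num.sqrt eps' * Hs' p + (- Num.sqrt eps * Hs p + 0).

Let diffusion : {ae P, forall w, {ae lam, forall r, t <= r <= T ->
    (((HJ (w, r)) ^+ 2)%:E <= c%:E * delay2 alpha T (dX w) (dY w) r +
       (3 * delta ^+ 2 * (Hs (w, r)) ^+ 2)%:E)%E}}.
Proof.
have lip := coef2_lipschitz tT A2.
apply: (ae_imply2 (ae_and ae_XY (ae_and (ae_sections (sf_Hs sf)) (ae_sections (sf_Hs sf')))) lip).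
move=> w [[[fX fY] [fX' fY']] [hw hw']] lw.
apply: (ae_imply2 (ae_and hw hw') lw) => r /= [hr hr'] h rT.
have := h rT _ _ _ _ fX' fY' fX fY; rewrite -[X in ((X - _) ^+ 2)%:E]/(along2 sigma X' Y' w r).
rewrite -[X in ((_ - X) ^+ 2)%:E]/(along2 sigma X Y w r) (hr rT) (hr' rT) => h'.
have e'1 : eps' <= 1 := ltW eps1.
have e'0 : 0 <= eps' by apply: ltW; exact: lt_trans eps_lt.
apply: (@le_trans _ _ ((3/2)%:E * ((Hs' (w, r) - Hs (w, r)) ^+ 2)%:E +
    (3 * delta ^+ 2 * (Hs (w, r)) ^+ 2)%:E)%E).
  rewrite -EFinM -EFinD lee_fin.
  (* In this splitting the Lipschitz part is multiplied by sqrt(eps') <= 1, and the data only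
     involves the solution for eps, bounded by [diffusion_estimate]. *)
  have -> : HJ (w, r) = Num.sqrt eps' * (Hs' (w, r) - Hs (w, r)) + delta * Hs (w, r).
    by rewrite /HJ /delta; ring.
  apply: (le_trans (sqrD_le_young _ _)); rewrite !exprMn sqr_sqrtr// mulrA.
  rewrite [leLHS]addrC [leRHS]addrC mulrA; apply: lerD => //.
  by rewrite -mulrA; apply: ler_wpM2l => //; rewrite ler_piMl ?sqr_ge0.
apply: leeD2r; rewrite (EFinM (3 / 2) K) -muleA; apply: lee_wpmul2l => //.
Qed.

Let terminal : {ae P, forall w,
  (((g w (segment (X' w) T) - g w (segment (X w) T)) ^+ 2)%:E <=
   c%:E * delay1 alpha T (dX w) T + 0)%E}.
Proof.
apply: (ae_imply ae_XY) => w [[fX _] [fX' _]]; apply: weaken (delay1_ge0 _ _ _ _).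
exact: (coef1_lipschitz T0 tT w A3 fX' fX).
Qed.

Lemma difference_estimate :
  (\int[P]_w dense_sup t T dX w + \int[P]_w dense_sup t T dY w +
     \int[P]_w nsq lam (cut t T (dZ w)) <=
    (difference_bound * delta ^+ 2)%:E)%E.
Proof.
have mdX s : t <= s <= T -> measurable_fun setT (dX ^~ s).
  by move=> sT; apply: measurable_funB; [exact: sf_mX sf' _ sT|exact: sf_mX sf _ sT].
have mdY s : t <= s <= T -> measurable_fun setT (dY ^~ s).
  by move=> sT; apply: measurable_funB; [exact: sf_mY sf' _ sT|exact: sf_mY sf _ sT].
have fdX : {ae P, forall w, frozen_path t T (dX w)}.
  by apply: (ae_imply ae_XY) => w [[? _] [? _]]; exact: frozen_pathB.
have fdY : {ae P, forall w, frozen_path t T (dY w)}.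
  by apply: (ae_imply ae_XY) => w [[_ ?] [_ ?]]; exact: frozen_pathB.
have mdZ : measurable_fun (slab T t) (fun p : Om * measurableTypeR R => dZ p.1 p.2).
  by apply: measurable_funB; [exact: sf_mZ sf'|exact: sf_mZ sf].
have dZ0 w s : - T <= s < t -> dZ w s = 0.
  by move=> sT; rewrite /dZ (sf_Z0 sf' w sT) (sf_Z0 sf w sT) subrr.
have Xfin := dense_sup_diff_fin tT' (sf_mX sf') (sf_mX sf) (sf_Xfin sf') (sf_Xfin sf).
have Yfin := dense_sup_diff_fin tT' (sf_mY sf') (sf_mY sf) (sf_Yfin sf') (sf_Yfin sf).
have Zfin := nsq_cut_diff_fin (sf_mZ sf') (sf_mZ sf) (sf_Zfin sf') (sf_Zfin sf).
have ij0 := ito_pair0 P W T t.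
have ijJ := ito_lincomb brW cP tT (Num.sqrt eps') (sf_J sf')
  (ito_lincomb brW cP tT (- Num.sqrt eps) (sf_J sf) ij0).
have ijM := ito_lincomb brW cP tT 1 (sf_M sf') (ito_lincomb brW cP tT (- 1) (sf_M sf) ij0).
have HJ0 p : ~ (t <= p.2 <= T) -> HJ p = 0.
  by move=> np; rewrite /HJ (sf_Hs0 sf np) (sf_Hs0 sf' np) !mulr0 !addr0.
have HZ0 p : ~ (t <= p.2 <= T) -> 1 * Hz' p + (- 1 * Hz p + 0) = 0.
  by move=> np; rewrite (sf_Hz0 sf np) (sf_Hz0 sf' np) !mulr0 !addr0.
have aeZ : {ae PL, forall p : Om * R, t <= p.2 <= T -> dZ p.1 p.2 = 1 * Hz' p + (- 1 * Hz p + 0)}.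
  apply: (ae_imply2 (sf_Hz sf) (sf_Hz sf')) => p h h' pT.
  by rewrite /dZ h// h'//; ring.
have kT := kappa_T K0 T0; have k1 := kappa_1 T K0; have kT2 := kappa_T2 T K0.
have mH : measurable_fun setT Hs by case: (sf_J sf).
have ps0 p : (0 <= (3 * delta ^+ 2 * (Hs p) ^+ 2)%:E :> \bar R)%E.
  rewrite lee_fin; apply: mulr_ge0 (sqr_ge0 _); exact: (mulr_ge0 _ (sqr_ge0 _)).
have mps : measurable_fun (slab T t) (fun p => (3 * delta ^+ 2 * (Hs p) ^+ 2)%:E).
  apply/measurable_EFinP; apply: measurable_funM => //; apply: measurable_funX.
  exact: measurable_funTS.
pose zp : Om * measurableTypeR R -> \bar R := cst 0%E.
pose zw : Om -> \bar R := cst 0%E.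
have z0 p : (0 <= zp p)%E by [].
have mz0 : measurable_fun (slab T t) zp by exact: measurable_cst.
have w0 w : (0 <= zw w)%E by [].
have mw0 : measurable_fun setT zw by exact: measurable_cst.
have i0 : (\int[P]_w \int[lam]_(r in `[t, T]) zp (w, r) <= 0%:E)%E.
  rewrite (eq_integral (fun=> 0%E)) ?integral0//.
  by move=> w _; exact: integral0.
have iw0 : (\int[P]_w zw w <= 0%:E)%E by rewrite integral0.
have eps1' : eps <= 1 by apply: ltW; exact: lt_trans eps1.
have Sig := diffusion_estimate brW cP tT T0 K0 A1b A1f A2 A3 small sf (ltW eps0) eps1'.
pose Sg := a_priori_bound P T K b f sigma g x + 3 * fine (sqnorm2 P T sigma).
have is_ : (\int[P]_w \int[lam]_(r in `[t, T]) (3 * delta ^+ 2 * (Hs (w, r)) ^+ 2)%:E <=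
    (3 * delta ^+ 2 * Sg)%:E)%E.
  have d0 : 0 <= 3 * delta ^+ 2 by rewrite mulr_ge0// sqr_ge0.
  rewrite (EFinM (3 * delta ^+ 2)); apply: le_trans (lee_wpmul2l _ Sig); last by rewrite lee_fin.
  have H20 p : (0 <= ((Hs p) ^+ 2)%:E :> \bar R)%E by rewrite lee_fin sqr_ge0.
  have mH2 := measurable_sqr_EFin mH.
  rewrite /nsq fubini_tonelli1// -ge0_integralZl//; last 2 first.
  - exact: measurable_fun_fubini_tonelli_F.
  - by move=> w _; exact: integral_ge0.
  apply: le_lower_integral => w; first by apply: integral_ge0 => r _; exact: ps0.
  rewrite /fubini_F -ge0_integralZl//; last exact: (measurableT_comp mH2 (measurable_pair1 w)).
  rewrite [leLHS]integral_mkcond; apply: le_lower_integral => r; rewrite patchE.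
    by case: ifP => // _; exact: ps0.
  by case: ifP => _; [rewrite EFinM|rewrite mule_ge0 ?lee_fin ?sqr_ge0].
have mI : measurable (`[t, T]%classic : set (measurableTypeR R)) by exact: measurable_itv.
have ib : {ae P, forall w, lam.-integrable `[t, T]
    (EFin \o (fun r => along3 b X' Y' Z' w r - along3 b X Y Z w r))}.
  apply: (ae_imply2 (sf_b sf) (sf_b sf')) => w h h'.
  by have := integrableB mI h' h; apply: eq_integrable.
have if_ : {ae P, forall w, lam.-integrable `[t, T]
    (EFin \o (fun r => along3 f X' Y' Z' w r - along3 f X Y Z w r))}.
  apply: (ae_imply2 (sf_f sf) (sf_f sf')) => w h h'.
  by have := integrableB mI h' h; apply: eq_integrable.
have eqd : {ae P, forall w, forall s, t <= s <= T ->
    dX w s = 0 + Rintegral lam `[t, s] (fun r => along3 b X' Y' Z' w r - along3 b X Y Z w r)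
       + (Num.sqrt eps' * J' w s + (- Num.sqrt eps * J w s + 0)) /\
    dY w s = (g w (segment (X' w) T) - g w (segment (X w) T)) +
       Rintegral lam `[s, T] (fun r => along3 f X' Y' Z' w r - along3 f X Y Z w r) -
       ((1 * M' w T + (- 1 * M w T + 0)) - (1 * M' w s + (- 1 * M w s + 0)))}.
  apply: (ae_imply2 (ae_and (sf_eq sf) (sf_eq sf'))
    (ae_and (ae_and (sf_b sf) (sf_b sf')) (ae_and (sf_f sf) (sf_f sf')))).
  move=> w [e e'] [[hb hb'] [hf hf']] s sT; have /andP[ts sT'] := sT.
  have sub1 : `[t, s]%classic `<=` `[t, T] by apply: subset_itvl; rewrite bnd_simp.
  have sub2 : `[s, T]%classic `<=` `[t, T] by apply: subset_itvr; rewrite bnd_simp.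
  have [eX eY] := e s sT; have [eX' eY'] := e' s sT.
  rewrite !RintegralB//; try by [apply: integrableS hb|apply: integrableS hb'|
    apply: integrableS hf|apply: integrableS hf'].
  by split; rewrite /dX /dY ?eX ?eX' ?eY ?eY'; ring.
have aYd : adapted_to P W t (dY ^~ t).
  by apply: adapted_toB; [exact: sf_aY sf'|exact: sf_aY sf].
have := delayed_estimate brW cP tT T0 fdX fdY mdX mdY c0 kT k1 kT2 mdZ dZ0 Zfin
  ijJ ijM HJ0 HZ0 aeZ (kappa_small K0 small) Xfin Yfin aYd
  z0 mz0 z0 mz0 ps0 mps w0 mw0 i0 i0 is_ iw0 ib if_ (drift A1b) (drift A1f) diffusion
  terminal eqd.
rewrite (nsq_integrandE mdZ ijM HZ0 aeZ) => h; apply: (le_trans h).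
by rewrite lee_fin /difference_bound -/Sg; lra.
Qed.

End Difference.

(** * Exponential weights and conclusion *)

Section Weights.
Context {R : realType} (T : R).
Hypothesis T0 : 0 < T.
Local Notation lam := (@lebesgue_measure R).

Let weight_le s (y : R) : 0 <= s <= T -> expR (1 / T * s) * `|y| ^+ 2 <= expR 1 * y ^+ 2.
Proof.
move=> /andP[s0 sT]; rewrite real_normK ?num_real// ler_wpM2r ?sqr_ge0//.
by rewrite ler_expR mul1r mulrC ler_pdivrMr// mul1r.
Qed.

Variable t : R.
Hypothesis tT : 0 <= t <= T.

Let t0 : 0 <= t. Proof. by case/andP: tT. Qed.
Let tT' : t <= T. Proof. by case/andP: tT. Qed.

Lemma weighted_sup_ge0 (u : R -> R) :
  (0 <= ereal_sup [set (expR (1 / T * s) * `|u s| ^+ 2)%:E | s in `[t, T] ])%E.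
Proof.
apply: (@le_trans _ _ (expR (1 / T * t) * `|u t| ^+ 2)%:E).
  by rewrite lee_fin mulr_ge0 ?expR_ge0 ?sqr_ge0.
by apply: ereal_sup_ubound; exists t => //=; rewrite in_itv/= lexx.
Qed.

Lemma weighted_sup_le {d : measure_display} {Om : measurableType d} (U : Om -> R -> R) w :
  {within `[t, T], continuous (U w)} ->
  (ereal_sup [set (expR (1 / T * s) * `|U w s| ^+ 2)%:E | s in `[t, T] ] <=
    (expR 1)%:E * dense_sup t T U w)%E.
Proof.
move=> cU; apply: ge_ereal_sup => y [s /=]; rewrite in_itv/= => sT <- {y}.
apply: (@le_trans _ _ (expR 1 * (U w s) ^+ 2)%:E).
  by rewrite lee_fin weight_le//; case/andP: sT => ts ->; rewrite (le_trans t0).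
rewrite EFinM; apply: lee_wpmul2l; first by rewrite lee_fin expR_ge0.
exact: dense_sup_continuous.
Qed.

(** On [0, t[ the integrand is null by the convention for Z, so that [0, T] can be replaced by
    [t, T]. *)
Lemma weighted_integral_le (z : R -> R) : measurable_fun setT (cut t T z) ->
  (forall s, - T <= s < t -> z s = 0) ->
  (\int[lam]_(s in `[0%R, T]) (expR (1 / T * s) * `|z s| ^+ 2)%:E <=
    (expR 1)%:E * nsq lam (cut t T z))%E.
Proof.
move=> mc z0; rewrite /nsq -ge0_integralZl//; last 2 first.
- exact: measurable_sqr_EFin.
- by move=> s _; rewrite lee_fin sqr_ge0.
rewrite [leLHS]integral_mkcond; apply: le_lower_integral => s; rewrite patchE; case: ifPn => [|_].
- by move=> _; rewrite lee_fin mulr_ge0 ?expR_ge0 ?sqr_ge0.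
- by [].
- rewrite inE/= in_itv/= => sT; rewrite -EFinM lee_fin.
  have -> : z s = cut t T z s; last exact: weight_le.
  case/andP: sT => s0 sT; have [ts|st] := leP t s; first by rewrite cutE ?ts.
  by rewrite cut0 ?leNgt ?st// z0// st andbT (le_trans _ s0)// oppr_le0 ltW.
- by rewrite mule_ge0 ?lee_fin ?expR_ge0 ?sqr_ge0.
Qed.

End Weights.

(* C depends on K, on x and on the sizes at the null trajectory of b, f, sigma
   and g; it is chosen before T, eps and eps'. *)
Theorem lemma2p4 (R : realType) :
  exists C : R -> R -> \bar R -> \bar R -> \bar R -> \bar R -> R,
  (forall K x nb nf ns ng, 0 < C K x nb nf ns ng) /\
  forall (T : R) (d : measure_display) (Om : measurableType d)
    (P : probability Om R) (W : Om -> R -> R)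
    (alpha : probability (measurableTypeR R) R) (K : R)
    (b f : @coef3 R d Om) (sigma : @coef2 R d Om) (g : @coef1 R d Om)
    (t x eps eps' : R) (X Y Z X' Y' Z' : Om -> R -> R),
  0 < T -> is_brownian P W T -> usual_conditions P W T ->
  alpha `[- T, 0]%classic = 1%E -> 0 < K ->
  assumption_A1 P W T alpha K b -> assumption_A1 P W T alpha K f ->
  assumption_A2 P W T alpha K sigma -> assumption_A3 P W T alpha K g ->
  0 < eps -> eps < eps' -> eps' < 1 ->
  (33 + 144 * K) * K * expR 1 * Num.max 1 (T ^+ 2) < 1 ->
  0 <= t <= T ->
  let beta := 1 / T in
  fbsde_solution P W T b f sigma g beta t x eps X Y Z ->
  fbsde_solution P W T b f sigma g beta t x eps' X' Y' Z' ->
  (\int[P]_w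
     (ereal_sup [set (expR (beta * s) * `|X' w s - X w s| ^+ 2)%:E
                | s in `[t, T] ] +
      ereal_sup [set (expR (beta * s) * `|Y' w s - Y w s| ^+ 2)%:E
                | s in `[t, T] ] +
      \int[lebesgue_measure]_(s in `[0%R, T])
        (expR (beta * s) * `|Z' w s - Z w s| ^+ 2)%:E)
   <= (C K x (sqnorm3 P T b) (sqnorm3 P T f) (sqnorm2 P T sigma) (sqnorm1 P g)
       * (Num.sqrt eps' - Num.sqrt eps) ^+ 2)%:E)%E.
Proof.
(* The factor e comes from the weights, the rest is [difference_bound]. Adding 1 to the absolute
   value makes C positive for all arguments, also for K < 0. *)
exists (fun K x nb nf ns ng => 1 + `|expR 1 * (324 *
  (9 * (3 * x ^+ 2 + 9 * K^-1 * fine nb + 51 * K^-1 * fine nf + 36 * fine ns +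
    36 * fine ng) + 3 * fine ns))|).
split; first by move=> *; rewrite ltr_wpDr.
move=> T d Om P W alpha K b f sigma g t x eps eps' X Y Z X' Y' Z'.
move=> T0 brW [cP _] _ K0 A1b A1f A2 A3 eps0 eps_lt eps1 small tT beta sol sol'.
have beta0 : 0 <= beta by rewrite divr_ge0// ltW.
have tT' : t <= T by case/andP: tT.
have [J [M [Hs [Hz sf]]]] := fbsde_solution_facts brW cP tT beta0 sol.
have [J' [M' [Hs' [Hz' sf']]]] := fbsde_solution_facts brW cP tT beta0 sol'.
have diff := difference_estimate brW cP tT T0 K0 A1b A1f A2 A3 small eps0 eps_lt eps1 sf sf'.
set dX := (fun w s => X' w s - X w s) in diff.
set dY := (fun w s => Y' w s - Y w s) in diff.
set dZ := (fun w s => Z' w s - Z w s).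
have mdZ : measurable_fun (slab T t) (fun p : Om * measurableTypeR R => dZ p.1 p.2).
  by apply: measurable_funB; [exact: sf_mZ sf'|exact: sf_mZ sf].
have [mD mc] := measurable_nsq_cut P mdZ.
have mX : measurable_fun setT (dense_sup t T dX).
  apply: measurable_dense_sup => // s sT.
  by apply: measurable_funB; [exact: sf_mX sf' _ sT|exact: sf_mX sf _ sT].
have mY : measurable_fun setT (dense_sup t T dY).
  apply: measurable_dense_sup => // s sT.
  by apply: measurable_funB; [exact: sf_mY sf' _ sT|exact: sf_mY sf _ sT].
have X0 := dense_sup_ge0 t T dX; have Y0 := dense_sup_ge0 t T dY.
have D0 w : (0 <= nsq lebesgue_measure (cut t T (dZ w)))%E by exact: nsq_ge0.
have S0 w : (0 <= dense_sup t T dX w + dense_sup t T dY w +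
    nsq lebesgue_measure (cut t T (dZ w)))%E by apply: adde_ge0 => //; apply: adde_ge0.
have mS : measurable_fun setT (fun w => dense_sup t T dX w + dense_sup t T dY w +
    nsq lebesgue_measure (cut t T (dZ w)))%E.
  by apply: emeasurable_funD => //; exact: emeasurable_funD.
have e0 : (0 <= (expR 1 : R)%:E)%E by rewrite lee_fin expR_ge0.
apply: (@le_trans _ _ ((expR 1)%:E * (difference_bound P T K b f sigma g x *
    (Num.sqrt eps' - Num.sqrt eps) ^+ 2)%:E)%E); last first.
  rewrite -EFinM lee_fin mulrA ler_wpM2r ?sqr_ge0//.
  by rewrite (le_trans (ler_norm _))// lerDr.
apply: le_trans (lee_wpmul2l e0 diff).
rewrite -!ge0_integralD//; last 3 first.
- by move=> w _; apply: adde_ge0.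
- exact: emeasurable_funD.
- by move=> w _; exact: D0.
rewrite -ge0_integralZl//.
apply: ae_le_lower_integral.
- move=> w; apply: adde_ge0; last first.
    by apply: integral_ge0 => s _; rewrite lee_fin mulr_ge0 ?expR_ge0 ?sqr_ge0.
  by apply: adde_ge0; apply: weighted_sup_ge0.
- by move=> w; rewrite mule_ge0.
- exact: measurable_funeM.
- apply: (ae_imply2 (ae_and (sf_X sf) (sf_X sf')) (ae_and (sf_Y sf) (sf_Y sf'))).
  move=> w [fX fX'] [fY fY'].
  have [cX _] := frozen_pathB fX' fX; have [cY _] := frozen_pathB fY' fY.
  rewrite (ge0_muleDr _ (adde_ge0 (X0 w) (Y0 w)) (D0 w)).
  rewrite (ge0_muleDr _ (X0 w) (Y0 w)); apply: leeD; first apply: leeD.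
  + exact: (weighted_sup_le T0 tT (U := dX)).
  + exact: (weighted_sup_le T0 tT (U := dY)).
  + apply: (weighted_integral_le T0 (z := dZ w) (mc w)) => s sT.
    by rewrite /dZ (sf_Z0 sf' w sT) (sf_Z0 sf w sT) subrr.
Qed.
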